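(* Let $H$ be a fixed graph. There exists a local algorithm for $(1+\epsilon)$-approximating the minimum weight spanning graph for the family of $H$-minor free graphs with degree bounded by $d$, with high constant success probability and time and query complexity $(Wd/\epsilon)^{O(\log(W/\epsilon))}$, where $W=\max_{e\in E}w(e)$.
   Context: Graphs $G=(V,E,w)$ are connected, edge-weighted with positive weights satisfying $\min_{e\in E}w(e)\ge1$, have $n=|V|$ vertices, degree bound $d$, distinct vertex ids, and are accessed via incidence-list queries (the $i$-th neighbor of $v$ together with the weight of the edge). $W=W_G=\max_{e\in E}w(e)$. A graph is $H$-minor free if $H$ is not isomorphic to a graph obtainable by edge contractions on a subgraph of it. A local sparse spanning graph algorithm answers, for each queried edge $(u,v)\in E$, whether $(u,v)\in E'$, where $E'$ is determined by $G$ and the algorithm's internal randomness (answers consistent with one subgraph $G'=(V,E')$), such that $G'$ is connected with probability $1$ and $|E'|\le(1+\epsilon)n$ with the stated success probability. A local algorithm for $(1+\epsilon)$-approximating the minimum weight spanning graph is such an algorithm for which additionally $\sum_{e\in E'}w(e)\le(1+\epsilon)\alpha$, where $\alpha$ is the weight of a minimum weight spanning tree of $G$. *)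

(* Defs.v *)
(* MathComp world, with real powers and logarithms from MathComp-Analysis. *)
From mathcomp Require Import all_boot all_order all_algebra.
From mathcomp Require Import boolp reals exp.

Set Implicit Arguments.
Unset Strict Implicit.
Unset Printing Implicit Defensive.
Import Order.TTheory GRing.Theory Num.Theory.
Local Open Scope ring_scope.

(** * Finite simple graphs and minors *)

Record sgraph := SGraph {
  vertex :> finType;
  edges : {set {set vertex}};
  edges_card2 : forall f, f \in edges -> #|f| = 2
}.

Definition adj (V : finType) (F : {set {set V}}) : rel V :=
  fun u v => [set u; v] \in F.

Definition spanning_connected (V : finType) (F : {set {set V}}) : bool :=
  [forall u, forall v, connect (adj F) u v].

(* [ucycle] forbids repeated vertices; the cyclic sequence u, v traverses a
   single edge back and forth, hence the bound 2. *)
Definition acyclic (V : finType) (F : {set {set V}}) : Prop :=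
  forall p : seq V, ucycle (adj F) p -> (size p <= 2)%N.

(* A graph whose vertices form a subset of V: pair (vertices, edges). *)
Definition pgraph (V : finType) := ({set V} * {set {set V}})%type.

Definition subgraph (G : sgraph) (K : pgraph G) : Prop :=
  K.2 \subset edges G /\ (forall f, f \in K.2 -> f \subset K.1).

(* Contraction of {u, v}: v is merged into u; the edges that become loops are
   discarded and parallel edges coincide. *)
Definition contract (V : finType) (u v : V) (K : pgraph V) : pgraph V :=
  (K.1 :\ v,
   [set g in [set [set (if x == v then u else x) | x in f] | f : {set V} in K.2]
      | #|g| == 2]).

Inductive contracts_to (V : finType) : pgraph V -> pgraph V -> Prop :=
| contracts_refl (K : pgraph V) : contracts_to K K
| contracts_step (K L : pgraph V) (u v : V) :
    [set u; v] \in K.2 -> contracts_to (contract u v K) L -> contracts_to K L.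

Definition isomorphic (H : sgraph) (V : finType) (K : pgraph V) : Prop :=
  exists phi : H -> V,
    [/\ injective phi, [set phi x | x : H] = K.1 &
        [set [set phi x | x in f] | f : {set H} in edges H] = K.2].

Definition minor (H G : sgraph) : Prop :=
  exists K L : pgraph G, [/\ subgraph K, contracts_to K L & isomorphic H L].

Definition minor_free (H G : sgraph) : Prop := ~ minor H G.

(** * Weighted graphs given by incidence lists *)

Record wgraph (R : realType) := WGraph {
  graph_of :> sgraph;
  wt : {set graph_of} -> R;
  wt_ge1 : forall f, f \in edges graph_of -> 1 <= wt f;
  vid : graph_of -> nat;
  vid_inj : injective vid;
  inc : graph_of -> seq graph_of;
  inc_uniq : forall u, uniq (inc u);
  mem_inc : forall u v, (v \in inc u) = ([set u; v] \in edges graph_of);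
  graph_connected : spanning_connected (edges graph_of)
}.

Section WeightedGraph.
Variables (R : realType) (G : wgraph R).

Definition degree_bounded (d : nat) : Prop := forall u : G, (size (inc u) <= d)%N.

Definition weight (F : {set {set G}}) : R := \sum_(f in F) wt f.

Definition max_weight : R := \big[Num.max/0]_(f in edges G) wt f.

Definition spanning_tree (T : {set {set G}}) : Prop :=
  [/\ T \subset edges G, spanning_connected T & acyclic T].

(* Weights are positive, so the default value [weight (edges G)] is at least
   the weight of every spanning tree and does not affect the minimum. *)
Definition mst_weight : R :=
  \big[Num.min/weight (edges G)]_(T : {set {set G}} | `[< spanning_tree T >])
    weight T.

(* The i-th neighbour (from 0) of the vertex with id a, and the weight of the
   edge to it; None if there is no such vertex or no such neighbour. *)
Definition ask (a i : nat) : option (nat * R) :=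
  if [pick u : G | vid u == a] is Some u then
    if (i < size (inc u))%N then
      let v := nth u (inc u) i in Some (vid v, wt [set u; v])
    else None
  else None.

End WeightedGraph.

(** * Random access machine

    A unit-cost RAM, in structured form, with one memory N[0], N[1], ... of
    natural numbers and one memory X[0], X[1], ... of real numbers.  Arithmetic
    is restricted to addition and (for naturals, truncated) subtraction: with
    unbounded multiplication at unit cost the number of steps would not be a
    realistic measure of time.  The real memory also has no rounding and no
    conversion to naturals; weights can only be moved, added, subtracted and
    compared.  Programs mention no real number other than 1, so they do not
    depend on the type of reals. *)

Inductive instr :=
| NSkip
| NConst (r k : nat)         (* N[r] := k *)
| NAdd (r a b : nat)         (* N[r] := N[a] + N[b] *)
| NSub (r a b : nat)         (* N[r] := N[a] - N[b] *)
| NLoad (r a : nat)          (* N[r] := N[N[a]] *)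
| NStore (a r : nat)         (* N[N[a]] := N[r] *)
| ROne (x : nat)             (* X[x] := 1 *)
| RAdd (x y z : nat)         (* X[x] := X[y] + X[z] *)
| RSub (x y z : nat)         (* X[x] := X[y] - X[z] *)
| RLoad (x a : nat)          (* X[x] := X[N[a]] *)
| RStore (a x : nat)         (* X[N[a]] := X[x] *)
| Coin (r a : nat)           (* N[r] := random bit number N[a] *)
| Query (f b x a i : nat).   (* neighbour number N[i] of the vertex with id
                                N[a]: N[f] := 1, N[b] := its id,
                                X[x] := weight; N[f] := 0 if there is none *)

Inductive test :=
| TLe (a b : nat) | TLt (a b : nat)        (* on N[a], N[b] *)
| TRLe (x y : nat) | TRLt (x y : nat).     (* on X[x], X[y] *)

Inductive prog :=
| Atom (i : instr)
| Seq (c1 c2 : prog)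
| If (t : test) (c1 c2 : prog)
| While (t : test) (c : prog).

Definition upd (T : Type) (m : nat -> T) (k : nat) (y : T) : nat -> T :=
  fun j => if j == k then y else m j.

Definition tape := nat -> bool.

Section Machine.
Variable R : realType.

Record state := State { nmem : nat -> nat; rmem : nat -> R }.

Variables (oracle : nat -> nat -> option (nat * R)) (omega : tape).

Definition setn (s : state) r k := State (upd (nmem s) r k) (rmem s).
Definition setr (s : state) x y := State (nmem s) (upd (rmem s) x y).

Definition istep (c : instr) (s : state) : state :=
  let N := nmem s in let X := rmem s in
  match c with
  | NSkip => s
  | NConst r k => setn s r k
  | NAdd r a b => setn s r (N a + N b)%N
  | NSub r a b => setn s r (N a - N b)%N
  | NLoad r a => setn s r (N (N a))
  | NStore a r => setn s (N a) (N r)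
  | ROne x => setr s x 1
  | RAdd x y z => setr s x (X y + X z)
  | RSub x y z => setr s x (X y - X z)
  | RLoad x a => setr s x (X (N a))
  | RStore a x => setr s (N a) (X x)
  | Coin r a => setn s r (omega (N a) : nat)
  | Query f b x a i =>
      if oracle (N a) (N i) is Some (k, y)
      then setr (setn (setn s f 1%N) b k) x y
      else setn s f 0%N
  end.

Definition eval_test (t : test) (s : state) : bool :=
  match t with
  | TLe a b => (nmem s a <= nmem s b)%N
  | TLt a b => (nmem s a < nmem s b)%N
  | TRLe x y => rmem s x <= rmem s y
  | TRLt x y => rmem s x < rmem s y
  end.

Definition is_query (c : instr) : bool :=
  if c is Query _ _ _ _ _ then true else false.

(* [exec c s s' t q]: started in s, c halts in s' after t steps (instructions
   and tests), q of which are queries. *)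
Inductive exec : prog -> state -> state -> nat -> nat -> Prop :=
| ExecAtom i s : exec (Atom i) s (istep i s) 1 (is_query i)
| ExecSeq c1 c2 s s1 s2 t1 q1 t2 q2 :
    exec c1 s s1 t1 q1 -> exec c2 s1 s2 t2 q2 ->
    exec (Seq c1 c2) s s2 (t1 + t2) (q1 + q2)
| ExecIf b c1 c2 s s' t q :
    exec (if eval_test b s then c1 else c2) s s' t q ->
    exec (If b c1 c2) s s' t.+1 q
| ExecWhileStop b c s : ~~ eval_test b s -> exec (While b c) s s 1 0
| ExecWhileStep b c s s1 s2 t1 q1 t2 q2 :
    eval_test b s -> exec c s s1 t1 q1 -> exec (While b c) s1 s2 t2 q2 ->
    exec (While b c) s s2 (t1 + t2).+1 (q1 + q2).

Lemma exec_det c s s1 t1 q1 s2 t2 q2 :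
  exec c s s1 t1 q1 -> exec c s s2 t2 q2 -> [/\ s1 = s2, t1 = t2 & q1 = q2].
Proof.
move=> E; elim: E s2 t2 q2 => {c s s1 t1 q1}.
- by move=> i s s2 t2 q2 E; inversion E.
- move=> c1 c2 s s1 s2 t1 q1 t2 q2 _ IH1 _ IH2 s3 t3 q3 E.
  inversion E as [|? ? ? u ? ? ? ? ? E1 E2| | |]; subst.
  by case: (IH1 _ _ _ E1) E2 => <- <- <- /IH2 [-> -> ->].
- move=> b c1 c2 s s' t q _ IH s2 t2 q2 E.
  inversion E as [| |? ? ? ? ? ? ? E1| |]; subst.
  by case: (IH _ _ _ E1) => -> -> ->.
- move=> b c s Nb s2 t2 q2 E.
  inversion E as [| | | |? ? ? ? ? ? ? ? ? Hb]; subst => //.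
  by rewrite Hb in Nb.
- move=> b c s s1 s2 t1 q1 t2 q2 Hb _ IH1 _ IH2 s3 t3 q3 E.
  inversion E as [| | |? ? ? Nb|? ? ? u ? ? ? ? ? _ E1 E2]; subst.
    by rewrite Hb in Nb.
  by case: (IH1 _ _ _ E1) E2 => <- <- <- /IH2 [-> -> ->].
Qed.

End Machine.

(** * Probability over the random tape *)

Definition pad (L : nat) (r : {ffun 'I_L -> bool}) : tape :=
  fun k => if insub k is Some i then r i else false.

(* [P] has probability at least [p] for independent fair bits.  It is applied
   to events that depend on finitely many bits, because programs halt on all
   tapes: the proportion below is then constant for all large L, and equal to
   the probability of [P]. *)
Definition prob_ge (R : realType) (P : tape -> Prop) (p : R) : Prop :=
  exists L0, forall L, (L0 <= L)%N ->
    p * (2 ^ L)%:R <= #|[set r : {ffun 'I_L -> bool} | `[< P (pad r) >]]|%:R.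

(** * Local algorithms *)

Section Local.
Variables (R : realType) (A : prog) (G : wgraph R) (d : nat) (eps : R).

(* Every query starts from this fresh memory: nothing but the random tape is
   shared between two queries. *)
Definition init (u v : G) : state R :=
  State (nth 0%N [:: vid u; vid v; d]) (nth 0 [:: eps; max_weight G]).

Definition answers_yes (omega : tape) (u v : G) : Prop :=
  exists s t q, exec (ask G) omega A (init u v) s t q /\ nmem s 0 <> 0%N.

Definition halts_within (omega : tape) (u v : G) (B : R) : Prop :=
  exists s t q, [/\ exec (ask G) omega A (init u v) s t q, t%:R <= B & q%:R <= B].

(* E' *)
Definition kept (omega : tape) : {set {set G}} :=
  [set f in edges G |
     `[< exists u v, f = [set u; v] /\ answers_yes omega u v >]].

(* A is a local algorithm that (1+eps)-approximates the minimum weight spanning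
   graph of G with success probability at least 1 - delta and with at most B
   steps and at most B queries per answer.  The second clause says that the two
   orientations of an edge get the same answer. *)
Definition local_msg (delta B : R) : Prop :=
  [/\ forall omega (u v : G), [set u; v] \in edges G ->
        halts_within omega u v B,
      forall omega (u v : G), [set u; v] \in edges G ->
        answers_yes omega u v <-> answers_yes omega v u,
      @prob_ge R (fun omega => spanning_connected (kept omega)) 1 &
      prob_ge (fun omega =>
                 #|kept omega|%:R <= (1 + eps) * #|G|%:R /\
                 weight (kept omega) <= (1 + eps) * mst_weight G)
              (1 - delta)].

End Local.

(* (W d / eps)^(C log (W / eps)); the two maxima are inactive as soon as
   W / eps >= e, and only keep base and exponent away from 1 and 0. *)
Definition msg_bound (R : realType) (C W eps : R) (d : nat) : R :=
  Num.max 2 (W * d%:R / eps) `^ (C * Num.max 1 (ln (W / eps))).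

(* Main.v *)
(* The algorithm is deterministic.  Order the edges by weight, ties being broken
   by ids, and let T be the resulting minimum spanning tree: e is in T iff its
   ends are not connected by edges smaller than e.  For a parameter Z let P(x) be
   the first Z + 1 vertices reached by Prim's algorithm from x, and let I(y) be
   the set of all x with y in P(x).  An edge (u, v) is discarded iff u and v are
   connected by smaller edges inside a set S(u, v) that contains I(y) for every y
   in P(u) or P(v) with |I(y)| <= Z^2; since I(y) is connected, it is found by a
   search from y.  Edges of T are never discarded.

   Few other edges are kept.  Let q be about W / eps and Z = q^2 (d + 1).  Choose
   a set of at most n / q vertices meeting all but n / q of the sets P(x), and add
   to it the vertices with |I(y)| > Z^2 and their neighbours; there are few of
   those since the |I(y)| sum up to (Z + 1) n.  Send x to the first special vertex
   that Prim's algorithm meets from x, or to x itself if it meets none.  If Prim's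
   algorithm from x meets c right after exploring B, then from any vertex of B it
   stays inside B until it meets c; hence the classes of this map are connected in
   T.  The class of u lies in S(u, v), so at most one kept edge outside T joins two
   given classes, and none lies inside a class.  The quotient graph is H-minor
   free, hence has at most 2^|H| edges per vertex by Mader's theorem, and there are
   O(n / q) classes.

   If eps >= 2^(|H| + 3) W, all edges can be kept.  The time bound may then be
   constant while d is arbitrarily large, so this case is decided first, in
   constant time. *)
Require Import Defs.
From mathcomp Require Import all_boot all_order all_algebra.
From mathcomp Require Import boolp reals exp.
From mathcomp Require Import zify ring lra.

Set Implicit Arguments.
Unset Strict Implicit.
Unset Printing Implicit Defensive.

(** * Connectivity and minimum spanning trees *)

(** The classes live in the analysis only: the hitting set is chosen globally and without
    construction, so no query could find it. But a class with centre c lies in I(c), and c lies in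
    P(u) for each u of the class. Collecting the sets I(y) hence covers the class of u for all
    hitting sets at once, which makes a deterministic test possible. If I(c) exceeds the cap, the
    class is a single vertex.

    Z balances three counts, each of which must be at most n / q: the hitting set; the explorations
    that miss it, at most q n / Z; and the overloaded vertices with their neighbours, at most (d +
    1) (Z + 1) n / Z^2. With q eps >= 2^(|H| + 3) W the extra weight is at most eps n / 2, and for n
    > 1 the optimum is at least n / 2, all weights being at least 1.

    Outside the case decided first, q and d are at most fixed powers of max(2, W d / eps) for fixed
    H. The running time is therefore polynomial in this base, and of the logarithm in the exponent
    only its lower cut-off 1 is used. *)

Lemma connect_ind (V : finType) (e : rel V) (P : V -> Prop) (u v : V) :
  P u -> (forall x y, P x -> e x y -> P y) -> connect e u v -> P v.
Proof.
move=> Pu He /connectP[p pth ->]; elim: p u Pu pth => //= y p IH u Pu /andP[uy].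
exact/IH/(He u).
Qed.

Lemma connect_exit (V : finType) (e : rel V) (A : {set V}) (u v : V) :
  connect e u v -> u \in A -> v \notin A ->
  exists x y, [/\ x \in A, y \notin A & e x y].
Proof.
move=> uv uA vA; apply: contrapT => H.
have : v \in A; last by rewrite (negPf vA).
apply: (connect_ind (P := fun z => z \in A) uA _ uv) => x y xA xy.
by apply: contrapT => /negP yA; apply: H; exists x, y.
Qed.

Section Connectivity.
Variable V : finType.
Implicit Types (F A : {set {set V}}) (u v x y : V) (X : {set V}).

Definition conn F u v := connect (adj F) u v.

Definition within F X : {set {set V}} := [set f in F | f \subset X].

Lemma adj_sym F : symmetric (adj F).
Proof. by move=> x y; rewrite /adj setUC. Qed.

Lemma conn_sym F : symmetric (conn F).
Proof. exact/sym_connect_sym/adj_sym. Qed.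

Lemma conn0 F u : conn F u u. Proof. exact: connect0. Qed.

Lemma conn_trans F : transitive (conn F).
Proof. exact: connect_trans. Qed.

Lemma conn1 F u v : [set u; v] \in F -> conn F u v.
Proof. by move=> H; apply: connect1. Qed.

Lemma sub_conn F A u v :
  (forall x y, [set x; y] \in F -> conn A x y) -> conn F u v -> conn A u v.
Proof. by move=> H; apply: connect_sub. Qed.

Lemma connS F A u v : F \subset A -> conn F u v -> conn A u v.
Proof. by move=> /subsetP FA; apply: sub_conn => x y /FA; apply: conn1. Qed.

Lemma set2_eq x y u v :
  [set x; y] = [set u; v] -> (x = u /\ y = v) \/ (x = v /\ y = u).
Proof.
move=> E.
have : x \in [set u; v] by rewrite -E !inE eqxx.
have : y \in [set u; v] by rewrite -E !inE eqxx orbT.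
have : u \in [set x; y] by rewrite E !inE eqxx.
have : v \in [set x; y] by rewrite E !inE eqxx orbT.
rewrite !inE => /orP[]/eqP hv /orP[]/eqP hu /orP[]/eqP hy /orP[]/eqP hx;
  by subst; auto.
Qed.

Lemma conn_setU1 F x y u v :
  conn ([set x; y] |: F) u v ->
  [\/ conn F u v, conn F u x /\ conn F y v | conn F u y /\ conn F x v].
Proof.
move=> c; apply: (connect_ind (P := fun v =>
  [\/ conn F u v, conn F u x /\ conn F y v | conn F u y /\ conn F x v]) _ _ c).
  by constructor 1; apply: conn0.
move=> {c}v w Hv; rewrite /adj !inE => /orP[/eqP/set2_eq[]|].
- case=> ? ?; subst v w; case: Hv.
  + by move=> H; constructor 2; split=> //; apply: conn0.
  + by case=> H _; constructor 2; split=> //; apply: conn0.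
  + by case=> H _; constructor 1.
- case=> ? ?; subst v w; case: Hv.
  + by move=> H; constructor 3; split=> //; apply: conn0.
  + by case=> H _; constructor 1.
  + by case=> H _; constructor 3; split=> //; apply: conn0.
move=> /conn1 vw; case: Hv => [H|[H1 H2]|[H1 H2]].
- by constructor 1; apply: conn_trans vw.
- by constructor 2; split=> //; apply: conn_trans vw.
- by constructor 3; split=> //; apply: conn_trans vw.
Qed.

Lemma spanning_connectedP F :
  reflect (forall u v, conn F u v) (spanning_connected F).
Proof.
apply: (iffP forallP) => [H u v | H u]; first exact: (forallP (H u) v).
by apply/forallP => v; apply: H.
Qed.

Lemma spanningS F A :
  F \subset A -> spanning_connected F -> spanning_connected A.
Proof.
by move=> FA /spanning_connectedP H; apply/spanning_connectedP=> u v; apply: connS FA _.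
Qed.

Lemma within_sub F X : within F X \subset F.
Proof. by apply/subsetP => f; rewrite inE => /andP[]. Qed.

Lemma withinSS F A X X' :
  F \subset A -> X \subset X' -> within F X \subset within A X'.
Proof.
move=> FA XX; apply/subsetP => f; rewrite 2![f \in within _ _]inE.
by case/andP=> /(subsetP FA) -> /= fX; apply: subset_trans XX.
Qed.

Lemma withinS F X X' : X \subset X' -> within F X \subset within F X'.
Proof. exact: withinSS. Qed.

Lemma mem_within F X x y :
  ([set x; y] \in within F X) = [&& [set x; y] \in F, x \in X & y \in X].
Proof. by rewrite inE subUset !sub1set. Qed.

End Connectivity.

(** * The minimum spanning tree of an injective ranking *)

Section Kruskal.
Variables (V : finType) (E : {set {set V}}).
Hypothesis E2 : forall f, f \in E -> #|f| = 2.
Variable rk : {set V} -> nat.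
Hypothesis rk_inj : {in E &, injective rk}.
Implicit Types (F A : {set {set V}}) (u v x y : V) (X : {set V}).

Lemma edge_ends f : f \in E -> exists x y, x != y /\ f = [set x; y].
Proof. by move=> /E2/eqP/cards2P[x [y [? ?]]]; exists x, y. Qed.

Lemma edge_neq x y : [set x; y] \in E -> x != y.
Proof. by move=> /E2; rewrite cards2; case: eqP. Qed.

Definition lighter (F : {set {set V}}) (f : {set V}) : {set {set V}} :=
  [set g in F | rk g < rk f].

Definition kruskal : {set {set V}} :=
  [set f in E | [forall u, forall v, (f == [set u; v]) ==> ~~ conn (lighter E f) u v]].

Lemma mem_kruskal u v :
  [set u; v] \in E ->
  ([set u; v] \in kruskal) = ~~ conn (lighter E [set u; v]) u v.
Proof.
move=> uvE; rewrite inE uvE /=; apply/forallP/idP => [H|H x].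
  by have /forallP/(_ v) := H u; rewrite eqxx.
apply/forallP => y; apply/implyP => /eqP /set2_eq[] [? ?]; subst x y => //.
by rewrite conn_sym.
Qed.

Lemma kruskal_sub : kruskal \subset E.
Proof. by apply/subsetP => f; rewrite inE => /andP[]. Qed.

Lemma lighterS F A f : F \subset A -> lighter F f \subset lighter A f.
Proof. by move=> /subsetP FA; apply/subsetP => g; rewrite !inE => /andP[/FA -> ->]. Qed.

(** The cut property: a path from u to v must leave X, and every edge by which it can do so is at
    least as heavy as [[set u; v]]. *)
Lemma cut_kruskal X u v :
  [set u; v] \in E -> u \in X -> v \notin X ->
  (forall x y, x \in X -> y \notin X -> [set x; y] \in E ->
     rk [set u; v] <= rk [set x; y]) ->
  [set u; v] \in kruskal.
Proof.
move=> uvE uX vX min; rewrite mem_kruskal //; apply/negP => c.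
have [x [y [xX yX]]] := connect_exit c uX vX.
by rewrite /adj inE => /andP[/(min _ _ xX yX)]; rewrite leqNgt => /negPf ->.
Qed.

Lemma exit_min (P : {set V} -> bool) f : P f -> f \in E ->
  exists g, [/\ g \in E, P g & forall h, h \in E -> P h -> rk g <= rk h].
Proof.
move=> Pf fE; case: (@arg_minnP _ f (fun g => (g \in E) && P g) rk).
  by rewrite fE.
by move=> g /andP[gE Pg] H; exists g; split=> // h hE Ph; apply: H; rewrite hE.
Qed.

(** Otherwise some edge of E leaves the component of u in T, and the lightest such edge is in T by
    [cut_kruskal]. *)
Lemma kruskal_connected : spanning_connected E -> spanning_connected kruskal.
Proof.
move=> /spanning_connectedP cE; apply/spanning_connectedP => u v.
apply: contrapT => /negP nc; pose X := [set w | conn kruskal u w].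
have uX : u \in X by rewrite inE conn0.
have vX : v \notin X by rewrite inE.
have [x [y [xX yX xyE]]] := connect_exit (cE u v) uX vX.
pose P (f : {set V}) := [exists x, exists y, [&& x \in X, y \notin X & f == [set x; y]]].
have [|g [gE /existsP[a /existsP[b /and3P[aX bX /eqP eg]]] gmin]] := @exit_min P _ _ xyE.
  by apply/existsP; exists x; apply/existsP; exists y; rewrite xX yX eqxx.
have : [set a; b] \in kruskal.
  subst g; apply: cut_kruskal aX bX _ => // x' y' x'X y'X x'y'E; apply: gmin => //.
  by apply/existsP; exists x'; apply/existsP; exists y'; rewrite x'X y'X eqxx.
move=> abT; move: bX; rewrite inE => /negP; apply.
by apply: conn_trans (conn1 abT); move: aX; rewrite inE.
Qed.

(* [set x; y] is the heaviest edge of a path from u to v, chosen as light as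
   possible. *)
Lemma bottleneck F u v : F \subset E -> conn F u v -> u != v ->
  exists x y, [/\ [set x; y] \in F, conn (lighter F [set x; y]) u x &
                  conn (lighter F [set x; y]) y v].
Proof.
move=> FE cF uv.
pose L n := [set g in F | rk g < n].
have exL : exists n, conn (L n) u v.
  exists (\max_(g in F) rk g).+1; apply: connS cF; apply/subsetP => g gF.
  by rewrite inE gF /= ltnS; apply: leq_bigmax_cond.
case: (ex_minnP exL) => -[|n] cn nmin.
  have : v = u; last by move=> E0; rewrite E0 eqxx in uv.
  apply: (connect_ind (P := fun w => w = u)) cn => // x y _.
  by rewrite /adj inE ltn0 andbF.
have ncn : ~~ conn (L n) u v by apply/negP => /nmin; rewrite ltnn.
case: (pselect (exists2 f, f \in F & rk f = n)) => [[f fF fn]|nof]; last first.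
  case/negP: ncn; apply: connS cn; apply/subsetP => g; rewrite !inE ltnS => /andP[gF].
  by rewrite gF leq_eqVlt => /orP[/eqP e|//]; case: nof; exists g.
have [x [y [_ ef]]] := edge_ends (subsetP FE _ fF).
have Ln : lighter F f = L n by rewrite /lighter fn.
have LnS : L n.+1 \subset f |: L n.
  apply/subsetP => g; rewrite !inE ltnS => /andP[gF]; rewrite leq_eqVlt gF.
  case/orP=> [/eqP e|->]; last by rewrite orbT.
  by rewrite (rk_inj (subsetP FE _ gF) (subsetP FE _ fF)) ?eqxx // e fn.
have := connS LnS cn; rewrite ef => /conn_setU1 [H|[H1 H2]|[H1 H2]].
- by rewrite H in ncn.
- by exists x, y; rewrite -ef Ln.
- by exists y, x; rewrite setUC -ef Ln.
Qed.

(** The cycle property in the form that drives all later arguments. The bottleneck edge of A between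
    u and v cannot be heavier than [[set u; v]]: it would be in T, although its ends are joined by
    lighter edges through [[set u; v]]. *)
Lemma conn_lighter A u v :
  A \subset E -> [set u; v] \in E -> [set u; v] \notin A -> conn A u v ->
  (forall f, f \in A -> rk [set u; v] < rk f -> f \in kruskal) ->
  conn (lighter A [set u; v]) u v.
Proof.
move=> AE uvE uvA cA HT.
have [x [y [xyA ux yv]]] := bottleneck AE cA (edge_neq uvE).
have xyE := subsetP AE _ xyA.
case: (ltngtP (rk [set x; y]) (rk [set u; v])) => [lt|lt|eq].
- have sub : lighter A [set x; y] \subset lighter A [set u; v].
    by apply/subsetP => g; rewrite !inE => /andP[-> /= /ltn_trans]; apply.
  apply: conn_trans (connS sub ux) _; apply: conn_trans (connS sub yv).
  by apply: conn1; rewrite inE xyA.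
- have := HT _ xyA lt; rewrite mem_kruskal // => /negP[].
  have sub := lighterS [set x; y] AE.
  have vu : conn (lighter E [set x; y]) u v by apply: conn1; rewrite inE uvE.
  rewrite conn_sym in ux; rewrite conn_sym in yv.
  rewrite conn_sym in vu; apply: conn_trans (connS sub _) (conn_trans _ (connS sub _)).
  + exact: ux.
  + by rewrite conn_sym in vu; exact: vu.
  + by rewrite conn_sym in yv; rewrite conn_sym.
- by move: uvA; rewrite -(rk_inj xyE uvE eq) xyA.
Qed.

(** The edge given up is the bottleneck of F between u and v. Were it lighter than [[set u; v]], the
    path through it would exclude [[set u; v]] from T. *)
Lemma kruskal_exchange F u v :
  F \subset E -> spanning_connected F ->
  [set u; v] \in kruskal -> [set u; v] \notin F ->
  exists f, [/\ f \in F, rk [set u; v] < rk f &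
               spanning_connected ([set u; v] |: (F :\ f))].
Proof.
move=> FE /spanning_connectedP cF uvT uvF.
have uvE := subsetP kruskal_sub _ uvT.
have [x [y [xyF ux yv]]] := bottleneck FE (cF u v) (edge_neq uvE).
have xyE := subsetP FE _ xyF.
have lt : rk [set u; v] < rk [set x; y].
  rewrite ltnNge; apply/negP; rewrite leq_eqVlt => /orP[/eqP eq|lt].
    by move: uvF; rewrite -(rk_inj xyE uvE eq) xyF.
  move: uvT; rewrite mem_kruskal // => /negP[].
  have sub : lighter F [set x; y] \subset lighter E [set u; v].
    apply/subsetP => g; rewrite !inE => /andP[gF /ltn_trans gxy].
    by rewrite (subsetP FE) //= gxy.
  apply: conn_trans (connS sub ux) _; apply: conn_trans (connS sub yv).
  by apply: conn1; rewrite inE xyE.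
exists [set x; y]; split=> //; apply/spanning_connectedP => a b.
apply: sub_conn (cF a b) => c d cdF.
set A := _ |: _.
have sub : lighter F [set x; y] \subset A.
  apply/subsetP => g; rewrite !inE => /andP[gF lg]; rewrite gF andbT.
  by apply/orP; right; apply/eqP => E0; rewrite E0 ltnn in lg.
have xyA : conn A x y.
  have uvA : conn A u v by apply: conn1; rewrite !inE eqxx.
  apply: conn_trans (conn_trans _ uvA) _; rewrite conn_sym; exact: connS sub _.
case: (eqVneq [set c; d] [set x; y]) => [/set2_eq[] [-> ->]|ne] //.
  by rewrite conn_sym.
by apply: conn1; rewrite !inE ne cdF orbT.
Qed.

(** An exchange argument for any P that survives swaps towards smaller rank. Taking for P a bound on
    the number of edges bounds the size of T; taking a bound on the weight shows that T is
    lightest. *)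
Lemma kruskal_opt (P : {set {set V}} -> Prop) F :
  F \subset E -> spanning_connected F -> P F ->
  (forall A f g, P A -> f \in A -> g \notin A -> g \in E -> f \in E ->
      rk g < rk f -> P (g |: (A :\ f))) ->
  exists A, [/\ P A, A \subset E & kruskal \subset A].
Proof.
move=> FE cF PF Pswap.
pose Q (A : {set {set V}}) := [&& A \subset E, spanning_connected A & `[< P A >]].
have QF : Q F by rewrite /Q FE cF; apply/asboolP.
(* The sum of the ranks serves as potential: each exchange lowers it strictly, so a minimizer
   contains all of T. *)
case: (@arg_minnP _ F Q (fun A => \sum_(f in A) rk f) QF) => A.
case/and3P=> AE cA /asboolP PA Amin; exists A; split=> //.
apply/subsetP => g gT; apply: contrapT => /negP gA.
have gE := subsetP kruskal_sub _ gT.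
have [u [v [_ eg]]] := edge_ends gE; subst g.
have [f [fA lt cA']] := kruskal_exchange AE cA gT gA.
have fE := subsetP AE _ fA.
have /Amin : Q ([set u; v] |: (A :\ f)).
  rewrite /Q cA' /=; apply/andP; split; last by apply/asboolP; apply: Pswap.
  apply/subsetP => h; rewrite !inE => /orP[/eqP -> //|/andP[_]]; exact: subsetP AE h.
rewrite big_setU1 ?inE ?negb_and ?gA ?orbT // (big_setD1 f fA) /= leq_add2r.
by rewrite leqNgt lt.
Qed.

Lemma small_spanning : spanning_connected E ->
  exists F, [/\ F \subset E, spanning_connected F & #|F| <= #|V|].
Proof.
move=> /spanning_connectedP cE.
case: (pickP [pred x : V | true]) => [r _|V0]; last first.
  exists set0; rewrite sub0set cards0; split=> //.
  by apply/spanning_connectedP => u; have := V0 u.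
suff H n : n < #|V| -> exists (X : {set V}) F,
    [/\ #|X| = n.+1, #|F| <= n, F \subset E & forall x, x \in X -> conn F r x].
  have V1 : 0 < #|V| by apply/card_gt0P; exists r.
  have [|X [F [cX cF FE XF]]] := H #|V|.-1; first by rewrite prednK.
  have XT : X = setT.
    by apply/eqP; rewrite eqEcard subsetT cardsT cX prednK // leqnn.
  exists F; split=> //; last exact: leq_trans cF (leq_pred _).
  apply/spanning_connectedP => u v; apply: (@conn_trans _ _ r).
    by rewrite conn_sym; apply: XF; rewrite XT inE.
  by apply: XF; rewrite XT inE.
elim: n => [_|n IH lt].
  exists [set r], set0; rewrite cards1 cards0 sub0set; split=> //.
  by move=> x; rewrite inE => /eqP ->; apply: conn0.
have [|X [F [cX cF FE XF]]] := IH; first exact: ltnW.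
have [y yX] : exists y, y \notin X.
  apply: contrapT => H; have : #|V| <= #|X|; last by rewrite cX leqNgt lt.
  rewrite -cardsT; apply/subset_leq_card/subsetP => z _.
  by apply: contrapT => /negP zX; apply: H; exists z.
have [x xX] : exists x, x \in X by apply/card_gt0P; rewrite cX.
have [a [b [aX bX abE]]] := connect_exit (cE x y) xX yX.
exists (b |: X), ([set a; b] |: F); split.
- by rewrite cardsU1 bX cX.
- by rewrite cardsU1; case: (_ \notin _); rewrite ?add1n ?add0n // ltnW.
- by apply/subsetP => f; rewrite !inE => /orP[/eqP -> //|/(subsetP FE)].
- have sub : F \subset [set a; b] |: F by apply: subsetUr.
  have abF : conn ([set a; b] |: F) a b by apply: conn1; rewrite !inE eqxx.
  move=> z; rewrite !inE => /orP[/eqP ->|/XF]; last exact: connS.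
  by apply: conn_trans abF; apply: connS sub (XF _ aX).
Qed.

Lemma card_kruskal : spanning_connected E -> #|kruskal| <= #|V|.
Proof.
move=> cE; have [F [FE cF nF]] := small_spanning cE.
have [|A [nA _ /subset_leq_card TA]] :=
    @kruskal_opt (fun A => #|A| <= #|V|) F FE cF nF.
  move=> A f g nA fA gA _ _ _; rewrite cardsU1 !inE (negPf gA) andbF /=.
  by move: nA; rewrite (cardsD1 f A) fA.
exact: leq_trans TA nA.
Qed.

(** Every vertex lies on an edge and an edge has two ends. With weights at least 1 this bounds the
    optimum below by half the number of vertices, so errors proportional to that number become
    relative errors. *)
Lemma spanning_card F : (forall f, f \in F -> #|f| = 2) ->
  spanning_connected F -> 1 < #|V| -> #|V| <= #|F|.*2.
Proof.
move=> F2 /spanning_connectedP cF V1.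
have H x : exists f, (f \in F) && (x \in f).
  have [y yx] : exists y, y != x.
    apply: contrapT => H; have : #|V| <= 1; last by rewrite leqNgt V1.
    rewrite -(cards1 x) -cardsT; apply/subset_leq_card/subsetP => z _; rewrite inE.
    by apply: contrapT => /negP zx; apply: H; exists z.
  have [||a [b [+ _ abF]]] := @connect_exit _ _ [set x] x y (cF x y).
  - by rewrite inE.
  - by rewrite inE.
  - by rewrite inE => /eqP ax; exists [set a; b]; subst a; rewrite set21 andbT.
have : #|V| <= \sum_(x : V) \sum_(f in F) (x \in f).
  rewrite -sum1_card; apply: leq_sum => x _; have [f /andP[fF xf]] := H x.
  by rewrite (bigD1 f) //= xf.
move/leq_trans; apply; rewrite exchange_big /= -mul2n mulnC -sum_nat_const.
apply: leq_sum => f /F2 <-; rewrite -sum1_card [leqRHS]big_mkcond /=.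
by apply: leq_sum => x _; case: (x \in f).
Qed.

End Kruskal.

(** * Local explorations by Prim's algorithm *)

Section Prim.
Variables (V : finType) (E : {set {set V}}).
Hypothesis E2 : forall f, f \in E -> #|f| = 2.
Variable rk : {set V} -> nat.
Hypothesis rk_inj : {in E &, injective rk}.
Hypothesis cE : spanning_connected E.
Implicit Types (u v x y z : V) (X S : {set V}).

Local Notation T := (kruskal E rk).

Definition leaves X x y := [&& x \in X, y \notin X & [set x; y] \in E].

Definition exits X x y := leaves X x y &&
  [forall a, forall b, leaves X a b ==> (rk [set x; y] <= rk [set a; b])].

Definition isnext X y := [exists x, exits X x y].

Lemma exitsP X x y :
  reflect (leaves X x y /\ forall a b, leaves X a b -> rk [set x; y] <= rk [set a; b])
          (exits X x y).
Proof.
apply: (iffP andP) => [[lxy H]|[lxy H]]; split=> //.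
  by move=> a b; have /forallP/(_ b)/implyP := forallP H a.
by apply/forallP => a; apply/forallP => b; apply/implyP/H.
Qed.

Lemma exits_inj X x y a b : exits X x y -> exits X a b -> x = a /\ y = b.
Proof.
move=> /exitsP[lxy Hxy] /exitsP[lab Hab].
have /and3P[xX yX xyE] := lxy; have /and3P[aX bX abE] := lab.
have : [set x; y] = [set a; b].
  by apply: rk_inj => //; apply/eqP; rewrite eqn_leq Hxy ?Hab.
by case/set2_eq => // -[? ?]; subst; rewrite xX in bX.
Qed.

Lemma isnext_inj X y b : isnext X y -> isnext X b -> y = b.
Proof. by move=> /existsP[x H1] /existsP[a H2]; case: (exits_inj H1 H2). Qed.

Lemma leaves_exits X a b : leaves X a b -> exists x y, exits X x y.
Proof.
move=> lab.
case: (@arg_minnP _ (a, b) (fun p => leaves X p.1 p.2) (fun p => rk [set p.1; p.2])).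
  exact: lab.
move=> [x y] /= lxy H; exists x, y; apply/exitsP; split=> // c d lcd.
exact: (H (c, d)).
Qed.

Lemma exists_next X x y : x \in X -> y \notin X -> exists b, isnext X b.
Proof.
move=> xX yX.
have [a [b [aX bX ab]]] := connect_exit (spanning_connectedP _ cE x y) xX yX.
have [|c [d H]] := @leaves_exits X a b; first by rewrite /leaves aX bX.
by exists d; apply/existsP; exists c.
Qed.

Lemma isnext_notin X y : isnext X y -> y \notin X.
Proof. by case/existsP => x /andP[/and3P[]]. Qed.

Definition grow X : {set V} := if [pick y | isnext X y] is Some y then y |: X else X.

Definition prim n x : {set V} := iter n grow [set x].

Lemma primS n x : prim n.+1 x = grow (prim n x). Proof. by []. Qed.

Lemma grow_next X y : isnext X y -> grow X = y |: X.
Proof.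
rewrite /grow; case: pickP => [b nb ny|H ny]; last by rewrite H in ny.
by rewrite (isnext_inj nb ny).
Qed.

Lemma subset_grow X : X \subset grow X.
Proof. by rewrite /grow; case: pickP => // b _; apply: subsetUr. Qed.

Lemma prim_sub m n x : m <= n -> prim m x \subset prim n x.
Proof.
move=> /subnKC <-; elim: (n - m) => [|k IH]; first by rewrite addn0.
by rewrite addnS; apply: subset_trans IH (subset_grow _).
Qed.

Lemma prim_refl n x : x \in prim n x.
Proof. by have /subsetP := @prim_sub 0 n x (leq0n n); apply; rewrite inE. Qed.

Lemma prim_next n x y : y \notin prim n x -> exists b, isnext (prim n x) b.
Proof. exact: exists_next (prim_refl n x). Qed.

Lemma card_prim n x : n < #|V| -> #|prim n x| = n.+1.
Proof.
elim: n => [|n IH] nV; first by rewrite cards1.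
have cn := IH (ltnW nV).
have [y yP] : exists y, y \notin prim n x.
  apply: contrapT => H; have : #|V| <= #|prim n x|; last by rewrite cn leqNgt nV.
  rewrite -cardsT; apply/subset_leq_card/subsetP => z _.
  by apply: contrapT => /negP zx; apply: H; exists z.
have [b nb] := prim_next yP.
by rewrite primS (grow_next nb) cardsU1 isnext_notin // cn.
Qed.

Lemma prim_full n x : #|V| <= n.+1 -> prim n x = setT.
Proof.
move=> Vn; apply/eqP; rewrite eqEcard subsetT cardsT.
have V0 : 0 < #|V| by apply/card_gt0P; exists x.
rewrite -(prednK V0) -(@card_prim #|V|.-1 x) ?prednK //.
by apply/subset_leq_card/prim_sub; rewrite -ltnS prednK.
Qed.

Lemma card_prim_le n x : #|prim n x| <= n.+1.
Proof.
elim: n => [|n IH]; first by rewrite cards1.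
rewrite primS /grow; case: pickP => [y _|_]; last exact: leq_trans IH _.
by rewrite cardsU1; case: (_ \notin _); rewrite ?add1n ?add0n ?ltnS // leqW.
Qed.

(** Each edge along which Prim's algorithm advances is in T by the cut property. *)
Lemma prim_conn n x y : y \in prim n x -> conn (within T (prim n x)) x y.
Proof.
elim: n y => [|n IH] y; first by rewrite inE => /eqP ->; apply: conn0.
have sub : within T (prim n x) \subset within T (prim n.+1 x).
  exact/withinS/prim_sub.
have old z : z \in prim n x -> conn (within T (prim n.+1 x)) x z.
  by move/IH; apply: connS.
rewrite primS {1}/grow; case: pickP => [b nb|_] yP; last exact: old.
move: yP; rewrite !inE => /orP[/eqP -> {y}|]; last exact: old.
have /existsP[a /exitsP[/and3P[aP bP abE] H]] := nb.
apply: conn_trans (old _ aP) (conn1 _); rewrite mem_within.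
rewrite primS (grow_next nb) setU11 in_setU1 aP orbT !andbT.
apply: (cut_kruskal abE aP bP) => c d cP dP cdE; apply: H.
by rewrite /leaves cP dP.
Qed.

(* U is the set of vertices reachable from s by edges lighter than [s; o].
   Once Prim's algorithm enters U it must exhaust it, and o comes next. *)
Lemma prim_stays n x c S o :
  isnext (prim n x) c -> S \subset prim n x -> isnext S o ->
  o \in c |: prim n x.
Proof.
set B := prim n x => nc SB /existsP[s /exitsP[/and3P[sS oS soE] Smin]].
set h := [set s; o] in soE Smin.
pose U := [set w | conn (lighter rk E h) s w].
have sU : s \in U by rewrite inE conn0.
have US : U \subset S.
  apply/subsetP => w; rewrite inE => sw; apply: contrapT => /negP wS.
  have [a [b [aS bS]]] := connect_exit sw sS wS.
  rewrite /adj inE => /andP[abE]; rewrite ltnNge Smin //.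
  by rewrite /leaves aS bS.
have Uout a b : a \in U -> b \notin U -> [set a; b] \in E -> rk h <= rk [set a; b].
  move=> aU bU abE; rewrite leqNgt; apply/negP => lt; move: bU; rewrite inE => /negP[].
  by move: aU; rewrite inE => /conn_trans; apply; apply: conn1; rewrite inE abE.
have oU : o \notin U by apply: contra oS; apply: (subsetP US).
apply: contrapT => /negP; rewrite !inE negb_or => /andP[oc oB].
(* The edge by which U is entered is heavier than h and was the lightest one leaving the explored
   set. Hence all edges that leave it from outside U are heavier than h, and this persists until U
   is exhausted. *)
have inv m : m <= n -> [disjoint U & prim m x] \/
    (exists2 w, w \in U & w \in prim m x) /\
    (forall a b, leaves (prim m x) a b -> a \notin U -> rk h < rk [set a; b]).
  elim: m => [_|m IH mn].
    case: (boolP (x \in U)) => xU; [right|left].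
      split; first by exists x => //; rewrite inE.
      by move=> a b /and3P[]; rewrite inE => /eqP -> _ _; rewrite xU.
    rewrite disjoint_subset; apply/subsetP => z zU; rewrite inE; apply/negP.
    rewrite inE => /eqP zx.
    by rewrite -zx zU in xU.
  have sub : prim m x \subset B by apply: prim_sub; apply: ltnW.
  have oP : o \notin prim m x by apply: contra oB; apply: (subsetP sub).
  have {IH} IH := IH (ltnW mn).
  have [b nb] := prim_next oP; have := nb.
  case/existsP => a /exitsP[lab amin]; have /and3P[aP bP abE] := lab.
  have bo : [set a; b] <> h.
    case/set2_eq => -[ao bo]; last by rewrite -ao aP in oP.
    case/negP: oB; rewrite -bo; apply: (subsetP (prim_sub x mn)).
    by rewrite primS (grow_next nb) setU11.
  have abh : b \in U -> a \notin U -> rk h < rk [set a; b].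
    move=> bU aU; have := Uout b a bU aU; rewrite setUC => /(_ abE) le.
    rewrite ltn_neqAle le andbT.
    by apply/eqP => e; case: bo; rewrite (rk_inj soE abE e).
  rewrite primS (grow_next nb); case: IH => [dis|[[w wU wP] Hout]].
    case: (boolP (b \in U)) => bU; last first.
      left; rewrite disjoint_subset; apply/subsetP => z zU; rewrite inE; apply/negP.
      rewrite in_setU1 => /orP[/eqP zb|zP].
        by rewrite -zb zU in bU.
      by rewrite (disjointFr dis zU) in zP.
    have aU : a \notin U by apply/negP => aU; rewrite (disjointFr dis aU) in aP.
    right; split; first by exists b => //; rewrite setU11.
    move=> p q /and3P[]; rewrite in_setU1 in_setU1 negb_or.
    case/orP=> [/eqP -> _ _|pP /andP[_ qP] pqE pU]; first by rewrite bU.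
    apply: leq_trans (abh bU aU) _.
    by apply: amin; rewrite /leaves pP qP.
  have [aU bU] : a \in U /\ b \in U.
    case: (boolP (U \subset prim m x)) => [UP|/subsetPn[z zU zP]].
      have le : rk [set a; b] <= rk h by apply: amin; rewrite /leaves (subsetP UP) //= oP.
      have aU : a \in U by apply: contraLR le => aU; rewrite -ltnNge; apply: Hout.
      have bU : b \notin U by apply: contra bP; apply: (subsetP UP).
      case: bo; apply: (rk_inj abE soE).
      by apply/eqP; rewrite eqn_leq le Uout.
    have wz : conn (lighter rk E h) w z.
      apply: (@conn_trans _ _ s); first by rewrite conn_sym; move: wU; rewrite inE.
      by move: zU; rewrite inE.
    have [p [q [pP qP]]] := connect_exit wz wP zP.
    rewrite /adj inE => /andP[pqE pqh].
    have abh' : rk [set a; b] < rk h.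
      by apply: leq_ltn_trans pqh; apply: amin; rewrite /leaves pP qP.
    have aU : a \in U.
      by apply: contraLR abh' => aU; rewrite -leqNgt ltnW // Hout.
    split=> //; apply: contraLR abh' => bU; rewrite -leqNgt; exact: Uout.
  right; split; first by exists w => //; rewrite in_setU1 wP orbT.
  move=> p q /and3P[]; rewrite in_setU1 in_setU1 negb_or.
  case/orP=> [/eqP ->|pP] /andP[_ qP] pqE pU; first by rewrite bU in pU.
  by apply: Hout; rewrite // /leaves pP qP.
have UB := subset_trans US SB.
case: (inv n (leqnn n)) => [dis|[_ Hout]].
  by have := disjointFr dis sU; rewrite (subsetP UB).
(* The edge to c is at most as heavy as h, so it starts in U; no edge leaving U is lighter than h,
   so it is h and c is o. *)
have /existsP[a /exitsP[/and3P[aB cB acE] amin]] := nc.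
have le : rk [set a; c] <= rk h by apply: amin; rewrite /leaves (subsetP UB) //= oB.
have aU : a \in U.
  by apply: contraLR le => aU; rewrite -ltnNge; apply: Hout; rewrite // /leaves aB cB.
have cU : c \notin U by apply: contra cB; apply: (subsetP UB).
have /(rk_inj acE soE) : rk [set a; c] = rk h by apply/eqP; rewrite eqn_leq le Uout.
case/set2_eq => -[ac co]; first by rewrite co eqxx in oc.
by rewrite -ac aU in oU.
Qed.

(* Until Prim's algorithm started in z reaches c, it stays inside prim n x. *)
Lemma prim_nested n x c z :
  isnext (prim n x) c -> z \in prim n x ->
  exists m, [/\ m <= n, prim m z \subset prim n x & isnext (prim m z) c].
Proof.
set B := prim n x => nc zB.
have cB := isnext_notin nc.
have inv i : prim i z \subset B \/
    exists m, [/\ m < i, prim m z \subset B & isnext (prim m z) c].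
  elim: i => [|i [PB|[m [mi PB nm]]]]; first by left; rewrite sub1set.
    have cP : c \notin prim i z by apply: contra cB; apply: (subsetP PB).
    have [b nb] := prim_next cP.
    have := prim_stays nc PB nb; rewrite in_setU1 => /orP[/eqP bc|bB].
      by right; exists i; rewrite -bc.
    left; rewrite primS (grow_next nb); apply/subsetP => w; rewrite in_setU1.
    by case/orP=> [/eqP -> //|/(subsetP PB)].
  by right; exists m; rewrite (leq_trans mi).
have nB : #|B| < #|V|.
  by rewrite -[#|V|]cardsT; apply/proper_card/properP; split; [apply: subsetT|exists c].
(* If c were never met, [#|B|] steps from z would place [#|B| + 1] vertices inside B. *)
case: (inv #|B|) => [/subset_leq_card|[m [mB PB nm]]].
  by rewrite card_prim // ltnn.
by exists m; split=> //; rewrite -ltnS; apply: leq_trans mB (card_prim_le n x).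
Qed.

End Prim.

(** * Hitting sets and the clusters they define *)

Lemma disjointsU1r (V : finType) (A D : {set V}) (y : V) :
  [disjoint A & y |: D] = (y \notin A) && [disjoint A & D].
Proof.
by rewrite disjoint_sym disjoints_subset subUset sub1set inE -disjoints_subset disjoint_sym.
Qed.

(** An extremal substitute for random sampling: D minimizes [#|D| * q] plus the number of missed
    sets. Comparison with [set0] gives the first bound. Comparison with [y |: D] shows that y lies
    in at most q missed sets, and counting incidences gives the second. *)
Lemma hitting_set (V : finType) (P : V -> {set V}) (k q : nat) :
  (forall x, k <= #|P x|) ->
  exists D : {set V}, #|D| * q <= #|V| /\
    #|[set x | [disjoint P x & D]]| * k <= q * #|V|.
Proof.
move=> Pk; pose unhit (D : {set V}) := [set x | [disjoint P x & D]].
case: (@arg_minnP _ set0 xpredT (fun D : {set V} => #|D| * q + #|unhit D|)) => // D _ Dmin.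
have le0 : #|D| * q + #|unhit D| <= #|V|.
  by apply: leq_trans (Dmin set0 isT) _; rewrite cards0 mul0n add0n max_card.
exists D; split; first by apply: leq_trans le0; apply: leq_addr.
have gain y : #|[set x in unhit D | y \in P x]| <= q.
  have split_unhit : unhit D = unhit (y |: D) :|: [set x in unhit D | y \in P x].
    apply/setP => x; rewrite !inE disjointsU1r.
    by case: (y \in P x); rewrite ?andbT ?andbF ?orbF //=.
  have := Dmin (y |: D) isT; have : #|y |: D| <= #|D|.+1.
    by rewrite cardsU1; case: (_ \notin _); rewrite ?add1n.
  have : #|unhit D| = #|unhit (y |: D)| + #|[set x in unhit D | y \in P x]|.
    rewrite {1}split_unhit cardsU; set I := _ :&: _.
    have -> : I = set0; last by rewrite cards0 subn0.
    apply/setP => x; rewrite !inE disjointsU1r.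
    by case: (y \in P x); rewrite ?andbT ?andbF.
  nia.
apply: (@leq_trans (\sum_(x in unhit D) \sum_(y : V) (y \in P x))).
  rewrite -sum_nat_const; apply: leq_sum => x _.
  by rewrite -big_mkcond sum1_card; apply: leq_trans (Pk x) _.
rewrite exchange_big /= mulnC -sum_nat_const; apply: leq_sum => y _.
apply: leq_trans (gain y); rewrite -sum1_card big_mkcond [leqRHS]big_mkcond /=.
by apply: leq_sum => x _; rewrite inE; case: (x \in unhit D); case: (y \in P x).
Qed.

Section Clusters.
Variables (V : finType) (E : {set {set V}}).
Hypothesis E2 : forall f, f \in E -> #|f| = 2.
Variable rk : {set V} -> nat.
Hypothesis rk_inj : {in E &, injective rk}.
Hypothesis cE : spanning_connected E.

Local Notation T := (kruskal E rk).
Local Notation prim := (prim E rk).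
Local Notation isnext := (isnext E rk).

Definition nbh (u : V) : {set V} := [set v | [set u; v] \in E].

Variable k : nat.

Definition inflow (y : V) : {set V} := [set x | y \in prim k x].

Lemma sum_inflow : \sum_(y : V) #|inflow y| <= k.+1 * #|V|.
Proof.
have -> : \sum_(y : V) #|inflow y| = \sum_(y : V) \sum_(x : V) (y \in prim k x).
  apply: eq_bigr => y _; rewrite -sum1_card big_mkcond /=.
  by apply: eq_bigr => x _; rewrite inE; case: (_ \in _).
rewrite exchange_big /= mulnC -sum_nat_const; apply: leq_sum => x _.
by rewrite -big_mkcond sum1_card card_prim_le.
Qed.

(** Markov's inequality for the sizes of the inflows. *)
Lemma card_overloaded (M : nat) :
  #|[set y | M < #|inflow y|]| * M <= k.+1 * #|V|.
Proof.
apply: leq_trans sum_inflow; rewrite -sum_nat_const big_mkcond /=.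
by apply: leq_sum => y _; rewrite inE; case: ifP => // /ltnW.
Qed.

Variable Sp : {set V}.

Definition meets (x : V) (i : nat) (c : V) :=
  [&& [disjoint prim i x & Sp], isnext (prim i x) c & c \in Sp].

Definition center (x : V) : V :=
  if x \in Sp then x
  else if [pick c | [exists i : 'I_k, meets x i c]] is Some c then c else x.

Lemma meets_inj x i c j b : meets x i c -> meets x j b -> c = b.
Proof.
wlog ij : i c j b / i <= j => [H H1 H2|].
  by case/orP: (leq_total i j) => ij; [apply: H ij H1 H2|apply/esym; apply: H ij H2 H1].
move=> /and3P[_ ic cS] /and3P[dj jb _].
case: (ltngtP i j) ij => // [ij _|ij _]; last first.
  by move: ic; rewrite ij => ic; exact (isnext_inj rk_inj ic jb).
have : c \in prim j x.
  by apply: (subsetP (prim_sub E rk x ij)); rewrite primS (grow_next rk_inj ic) setU11.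
by move=> cj; have := disjointFr dj cj; rewrite cS.
Qed.

Lemma center_meets x i c : i < k -> meets x i c -> center x = c.
Proof.
move=> ik m; have /and3P[dj _ _] := m; rewrite /center.
rewrite (disjointFr dj (prim_refl _ _ _ _)).
case: pickP => [b /existsP[j mj]|/(_ c)/existsP[]]; first exact: meets_inj mj m.
by exists (Ordinal ik).
Qed.

Lemma center_special x : x \in Sp -> center x = x.
Proof. by rewrite /center => ->. Qed.

Lemma centerP x :
  center x <> x -> exists2 i, i < k & meets x i (center x).
Proof.
rewrite /center; case: ifP => // xS; case: pickP => // c /existsP[i m] _.
by exists i.
Qed.

Lemma center_prim x : center x \in prim k x.
Proof.
case: (eqVneq (center x) x) => [->|/eqP ne]; first exact: prim_refl.
have [i ik /and3P[_ nc _]] := centerP ne.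
by apply: (subsetP (prim_sub E rk x ik)); rewrite primS (grow_next rk_inj nc) setU11.
Qed.

Definition fiber (x : V) : {set V} := [set z | center z == center x].

Lemma fiber_inflow x : fiber x \subset inflow (center x).
Proof. by apply/subsetP => z; rewrite !inE => /eqP <-; apply: center_prim. Qed.

Lemma center_center x : center (center x) = center x.
Proof.
case: (eqVneq (center x) x) => [E0|/eqP ne]; first by rewrite E0.
by have [i _ /and3P[_ _ cS]] := centerP ne; apply: center_special.
Qed.

Lemma conn_center x : conn (within T (fiber x)) x (center x).
Proof.
case: (eqVneq (center x) x) => [->|/eqP ne]; first exact: conn0.
have [i ik m] := centerP ne; have /and3P[dj nc cS] := m.
have sub : prim i.+1 x \subset fiber x.
  rewrite primS (grow_next rk_inj nc); apply/subsetP => z; rewrite in_setU1.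
  case/orP=> [/eqP ->|zB]; first by rewrite inE center_center.
  (* From z Prim's algorithm stays in a set disjoint from [Sp] until it meets c, and at an index
     still below k; so z has the same center as x. *)
  have [j [ji jB jc]] := prim_nested rk_inj cE nc zB.
  rewrite inE; apply/eqP; apply: (@center_meets _ j); first exact: leq_ltn_trans ik.
  by rewrite /meets jc cS !andbT; apply: disjointWl dj.
apply: connS (withinS T sub) _; apply: prim_conn => //.
by rewrite primS (grow_next rk_inj nc) setU11.
Qed.

Lemma fiber_conn x y : center x = center y -> conn (within T (fiber x)) x y.
Proof.
move=> xy; apply: conn_trans (conn_center x) _; rewrite conn_sym xy /fiber xy.
exact: conn_center.
Qed.

(** A center outside [Sp] is its own center, and its whole exploration misses [Sp]: the first
    special vertex met would have been the center instead. *)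
Lemma card_centers :
  #|[set center x | x in V]| <= #|Sp| + #|[set x | [disjoint prim k x & Sp]]|.
Proof.
apply: leq_trans (leq_trans _ (leq_card_setU _ _)).
  2: exact: leqnn.
apply/subset_leq_card/subsetP => c /imsetP[x _ ->]; rewrite !inE.
case: (eqVneq (center x) x) => [ex|/eqP ne]; last first.
  by have [i _ /and3P[_ _ ->]] := centerP ne.
rewrite ex; case: (boolP (x \in Sp)) => //= xS.
suff H i : i <= k -> [disjoint prim i x & Sp] by apply: H.
elim: i => [_|i IH ik].
  by rewrite disjoint_subset; apply/subsetP => z; rewrite !inE => /eqP ->.
have di := IH (ltnW ik).
rewrite primS /grow; case: pickP => [b nb|_] //.
rewrite disjoint_subset; apply/subsetP => z; rewrite in_setU1 inE.
case/orP=> [/eqP ->|zP]; last by rewrite (disjointFr di zP).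
apply/negP => bS; have m : meets x i b by rewrite /meets di nb bS.
by move: xS; rewrite -ex (center_meets ik m) bS.
Qed.

End Clusters.

(* The partition into the fibers of [cl]; [nD], [nO], [nU] count the vertices
   of a hitting set, those of large inflow, and those whose exploration misses
   the hitting set. *)
Lemma clustering (V : finType) (E : {set {set V}}) (rk : {set V} -> nat) (k M q d : nat) :
  (forall f, f \in E -> #|f| = 2) -> {in E &, injective rk} ->
  spanning_connected E -> (forall u, #|nbh E u| <= d) -> k < #|V| ->
  exists cl : V -> V,
  [/\ forall x y, cl x = cl y ->
        conn (within (kruskal E rk) [set z | cl z == cl x]) x y,
      forall (u : V) (S : {set V}), u \in S ->
        (forall y, y \in prim E rk k u -> #|inflow E rk k y| <= M ->
           inflow E rk k y \subset S) ->
        [set z | cl z == cl u] \subset S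
    & exists nD nO nU, [/\ #|[set cl x | x in V]| <= nD + d.+1 * nO + nU,
        nD * q <= #|V|, nO * M <= k.+1 * #|V| & nU * k.+1 <= q * #|V|]].
Proof.
move=> E2 rk_inj cE degd kV.
have [D [Dq Du]] := @hitting_set V (prim E rk k) k.+1 q
  (fun x => eq_leq (esym (card_prim rk_inj cE x kV))).
pose Over := [set y | M < #|inflow E rk k y|].
pose Sp := D :|: Over :|: \bigcup_(o in Over) nbh E o.
exists (center E rk k Sp); split.
- by move=> x y; apply: fiber_conn.
- move=> u S uS HS; case: (boolP (#|inflow E rk k (center E rk k Sp u)| <= M)) => [le|].
    by apply: subset_trans (fiber_inflow rk_inj k Sp u) _; apply: HS le; apply: center_prim.
  rewrite -ltnNge => cO; apply/subsetP => z; rewrite inE => /eqP zu.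
  (* This is why the neighbours of overloaded vertices are made special. Prim's algorithm enters
     such a vertex from a neighbour, where it has already met [Sp]; so nothing but the vertex itself
     is sent to it, and its fiber is a singleton. *)
  have H w : center E rk k Sp w = center E rk k Sp u -> w = center E rk k Sp u.
    move=> wu; apply: contrapT => ne.
    have [|i ik /and3P[dj nc cS]] := @centerP _ E rk k Sp w; first by rewrite wu => /esym.
    have /existsP[a /andP[/and3P[aB _ acE] _]] := nc.
    have aS : a \in Sp.
      rewrite !inE; apply/orP; right; apply/bigcupP; exists (center E rk k Sp u).
        by rewrite inE.
      by rewrite inE setUC -wu.
    by have := disjointFr dj aB; rewrite aS.
  by rewrite (H z zu) -(H u erefl).
- exists #|D|, #|Over|, #|[set x | [disjoint prim E rk k x & D]]|; split=> //.
  + apply: leq_trans (card_centers rk_inj k Sp) _; apply: leq_add.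
      apply: leq_trans (leq_card_setU _ _) _; rewrite mulSn addnA.
      apply: leq_add; first exact: leq_card_setU.
      rewrite mulnC -sum_nat_const; apply: leq_trans (_ : _ <= \sum_(o in Over) #|nbh E o|) _.
        apply: (big_ind2 (fun (A : {set V}) n => #|A| <= n)); rewrite ?cards0 //.
        move=> A n B m An Bm; apply: leq_trans (leq_card_setU _ _) _; exact: leq_add.
      exact: leq_sum.
    apply/subset_leq_card/subsetP => x; rewrite !inE => dj; apply: disjointWr dj.
    by rewrite /Sp -setUA subsetUl.
  + exact: card_overloaded.
Qed.

(** * Counting the kept edges outside the tree *)

Definition class_pairs (V : finType) (E : {set {set V}}) (cl : V -> V) : {set V * V} :=
  [set p | (p.1 != p.2) &&
     [exists x, exists y, [&& cl x == p.1, cl y == p.2 & [set x; y] \in E]]].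

(** Two kept edges outside T with the same pair of classes cannot coexist: the lighter one and tree
    paths inside the two classes connect the ends of the heavier one, and [conn_lighter] turns this
    into a connection by lighter edges. *)
Lemma extra_edges (V : finType) (E K : {set {set V}}) (rk : {set V} -> nat) (cl : V -> V) :
  (forall f, f \in E -> #|f| = 2) -> {in E &, injective rk} ->
  (forall x y, cl x = cl y ->
     conn (within (kruskal E rk) [set z | cl z == cl x]) x y) ->
  K \subset E ->
  (forall u v, [set u; v] \in K ->
     ~~ conn (lighter rk (within E ([set z | cl z == cl u] :|: [set z | cl z == cl v]))
               [set u; v]) u v) ->
  #|K :\: kruskal E rk| <= #|class_pairs E cl|.
Proof.
move=> E2 rk_inj cl_conn KE HK; set T := kruskal E rk.
pose fib u := [set z | cl z == cl u].
have TE : T \subset E by apply: kruskal_sub.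
have fibTE u : within T (fib u) \subset E by apply: subset_trans (within_sub _ _) TE.
have lighterW (A B : {set {set V}}) e : A \subset B -> lighter rk A e \subset lighter rk B e.
  exact: lighterS.
have cl_neq u v : [set u; v] \in K -> [set u; v] \notin T -> cl u != cl v.
  move=> uvK uvT; apply/eqP => uv; have /negP[] := HK u v uvK.
  apply: connS (conn_lighter E2 rk_inj (fibTE u) (subsetP KE _ uvK) _ (cl_conn _ _ uv) _).
  - by apply: lighterW; apply: withinSS => //; apply: subsetUl.
  - by apply: contra uvT; apply: (subsetP (within_sub _ _)).
  - by move=> f /(subsetP (within_sub _ _)).
(* One orientation is fixed for each edge. Edges that join the same classes in opposite orientations
   are not compared with each other; [class_pairs] counts ordered pairs. *)
pose ends (f : {set V}) : option (V * V) := [pick p : V * V | f == [set p.1; p.2]].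
pose phi (f : {set V}) : option (V * V) := omap (fun p => (cl p.1, cl p.2)) (ends f).
have endsP f : f \in K -> exists u v, ends f = Some (u, v) /\ f = [set u; v].
  move=> /(subsetP KE)/(edge_ends E2)[u [v [_ ef]]]; rewrite /ends.
  case: pickP => [[a b] /= /eqP e|/(_ (u, v))]; first by exists a, b.
  by rewrite ef eqxx.
have phi_inj : {in K :\: T &, injective phi}.
  move=> e1 e2; rewrite !in_setD => /andP[T1 K1] /andP[T2 K2].
  wlog lt : e1 e2 T1 K1 T2 K2 / rk e1 < rk e2 => [H|] e12.
    case: (ltngtP (rk e1) (rk e2)) => [lt|lt|]; first exact: H lt e12.
      by apply/esym; apply: H lt (esym e12).
    by apply: rk_inj; apply: (subsetP KE).
  have [u1 [v1 [p1 E1]]] := endsP _ K1; have [u2 [v2 [p2 E2']]] := endsP _ K2.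
  move: e12; rewrite /phi p1 p2 /= => -[cu cv].
  have u2v2K : [set u2; v2] \in K by rewrite -E2'.
  have /negP[] := HK _ _ u2v2K.
  (* As [e1] is lighter than [e2], all edges of A heavier than [e2] are in T, which is what
     [conn_lighter] asks for. *)
  pose A := e1 |: (within T (fib u2) :|: within T (fib v2)).
  have AE : A \subset E.
    by rewrite subUset sub1set (subsetP KE) //= subUset !fibTE.
  have subA u : fib u = fib u2 \/ fib u = fib v2 -> within T (fib u) \subset A.
    by case=> ->; rewrite /A; apply: subset_trans (subsetUr _ _); rewrite ?subsetUl ?subsetUr.
  have cA : conn A u2 v2.
    apply: (@conn_trans _ _ u1).
      by apply: (connS (subA u2 (or_introl erefl))); apply: cl_conn.
    apply: (@conn_trans _ _ v1).
      by apply: conn1; rewrite -E1 setU11.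
    apply: (connS (subA v1 _)); last exact: cl_conn.
    by right; rewrite /fib cv.
  apply: connS (conn_lighter E2 rk_inj AE _ _ cA _); first apply: lighterW.
  - rewrite !subUset sub1set !withinSS ?subsetUl ?subsetUr // !andbT.
    rewrite {1}E1 mem_within -E1 (subsetP KE) //=.
    by rewrite !in_setU 4!inE cu cv !eqxx orbT.
  - by rewrite -E2' (subsetP KE).
  - apply/negP; rewrite -E2' in_setU1 in_setU => /orP[/eqP e|/orP[]].
    + by rewrite e ltnn in lt.
    + by move=> /(subsetP (within_sub _ _)) e2T; rewrite e2T in T2.
    + by move=> /(subsetP (within_sub _ _)) e2T; rewrite e2T in T2.
  - move=> f; rewrite -E2' in_setU1 in_setU => /orP[/eqP -> lt'|].
      by have := ltn_trans lt lt'; rewrite ltnn.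
    by case/orP=> /(subsetP (within_sub _ _)).
rewrite -(card_in_imset phi_inj) -(card_imset (class_pairs E cl) (@Some_inj _)).
apply/subset_leq_card/subsetP => _ /imsetP[f fKT ->].
move: fKT; rewrite in_setD => /andP[fT fK].
have [u [v [p ef]]] := endsP f fK; rewrite /phi p /=; apply/imsetP.
exists (cl u, cl v) => //; rewrite inE /= cl_neq -?ef //=.
by apply/existsP; exists u; apply/existsP; exists v; rewrite !eqxx -ef (subsetP KE).
Qed.

(** * Sparsity of minor-free graphs *)

Section Mader.
Variables (V : finType) (E : {set {set V}}).
Implicit Types (X Y Z : {set V}) (P : {set {set V}}).

Definition connected_set X :=
  X != set0 /\ {in X &, forall x y, conn (within E X) x y}.

Definition touch X Y := [exists x, exists y, [&& x \in X, y \in Y & [set x; y] \in E]].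

Definition block_adj X Y := (X != Y) && touch X Y.

(** The degree sum of the quotient graph, that is, twice its number of edges. *)
Definition adj_count P := \sum_(X in P) \sum_(Y in P) block_adj X Y.

Lemma touchP X Y :
  reflect (exists x y, [/\ x \in X, y \in Y & [set x; y] \in E]) (touch X Y).
Proof.
apply: (iffP existsP) => [[x /existsP[y /and3P[? ? ?]]]|[x [y [xX yY xyE]]]].
  by exists x, y.
by exists x; apply/existsP; exists y; rewrite xX yY.
Qed.

Lemma touchC X Y : touch X Y = touch Y X.
Proof. by apply/touchP/touchP => -[x [y [? ? ?]]]; exists y, x; rewrite setUC. Qed.

Lemma block_adjC X Y : block_adj X Y = block_adj Y X.
Proof. by rewrite /block_adj eq_sym touchC. Qed.

Lemma touchUl X Y Z : touch (X :|: Y) Z = touch X Z || touch Y Z.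
Proof.
apply/touchP/orP => [[x [z [+ zZ xz]]]|].
  by rewrite inE => /orP[xX|xY]; [left|right]; apply/touchP; exists x, z.
by case=> /touchP[x [z [xX zZ xz]]]; exists x, z; rewrite inE xX ?orbT.
Qed.

Lemma touchS X Y Z : Y \subset Z -> touch X Y -> touch X Z.
Proof.
by move=> /subsetP YZ /touchP[x [y [xX /YZ yZ xy]]]; apply/touchP; exists x, y.
Qed.

Lemma connected_setU X Y :
  connected_set X -> connected_set Y -> touch X Y -> connected_set (X :|: Y).
Proof.
move=> [/set0Pn[x0 x0X] cX] [_ cY] /touchP[x [y [xX yY xyE]]]; split.
  by apply/set0Pn; exists x0; rewrite inE x0X.
have subX := withinS E (subsetUl X Y); have subY := withinS E (subsetUr X Y).
have H z : z \in X :|: Y -> conn (within E (X :|: Y)) x z.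
  rewrite inE => /orP[zX|zY]; first by apply: connS subX _; apply: cX.
  apply: conn_trans (connS subY (cY _ _ yY zY)); apply: conn1.
  by rewrite mem_within xyE !inE xX yY orbT.
by move=> a b /H xa /H; apply: conn_trans; rewrite conn_sym.
Qed.

Lemma adj_countU1 Z P : Z \notin P ->
  adj_count (Z |: P) = adj_count P + 2 * \sum_(Y in P) block_adj Z Y.
Proof.
move=> ZP; have sumU1 (F : {set V} -> nat) :
    \sum_(Y in Z |: P) F Y = F Z + \sum_(Y in P) F Y by apply: big_setU1.
rewrite /adj_count sumU1 (sumU1 (block_adj Z)) {1}/block_adj eqxx add0n mul2n -addnn addnCA; congr addn.
  under eq_bigr => X _ do rewrite (sumU1 (block_adj X)).
  rewrite big_split /= addnC; congr addn.
  by apply: eq_bigr => X _; rewrite block_adjC.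
Qed.

Lemma trivIset_disjoint P X Y :
  trivIset P -> X \in P -> Y \in P -> X != Y -> [disjoint X & Y].
Proof. by move=> /trivIsetP; apply. Qed.

(* Merging X and Y destroys the edge between them and one edge for each common
   neighbour. *)
Lemma adj_count_merge P X Y :
  trivIset P -> (forall Z, Z \in P -> connected_set Z) ->
  X \in P -> Y \in P -> block_adj X Y ->
  exists P', [/\ trivIset P', forall Z, Z \in P' -> connected_set Z,
    cover P' = cover P, forall Z, Z \in P' -> exists2 W, W \in P & W \subset Z
    & #|P| = #|P'|.+1 /\
      adj_count P <= adj_count P' + 2 +
        2 * \sum_(Z in P) (block_adj X Z && block_adj Y Z)].
Proof.
move=> tP cP XP YP XY; have /andP[neXY tXY] := XY.
pose R := P :\ X :\ Y; pose Z := X :|: Y.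
have dXY := trivIset_disjoint tP XP YP neXY.
have [x xX] : exists x, x \in X by apply/set0Pn; have [] := cP X XP.
have [y yY] : exists y, y \in Y by apply/set0Pn; have [] := cP Y YP.
have RP W : W \in R -> [/\ W \in P, W != X & W != Y].
  by rewrite !inE => /and3P[].
have ZP : Z \notin P.
  apply/negP => ZP; have neZX : Z != X.
    apply/eqP => ZX; have yX : y \in X by rewrite -ZX inE yY orbT.
    by have := disjointFr dXY yX; rewrite yY.
  have := disjointFr (trivIset_disjoint tP ZP XP neZX) (_ : x \in Z).
  by rewrite inE xX /= => /(_ isT).
have ZR : Z \notin R by apply: contra ZP => /RP[].
have YR : Y \notin R by rewrite !inE eqxx.
have XYR : X \notin Y |: R by rewrite !inE eqxx andbF orbF.
have PE : P = X |: (Y |: R) by rewrite /R setD1K ?setD1K // !inE eq_sym neXY.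
have sumYR (F : {set V} -> nat) :
    \sum_(W in Y |: R) F W = F Y + \sum_(W in R) F W by apply: big_setU1.
have sumXYR (F : {set V} -> nat) :
    \sum_(W in X |: (Y |: R)) F W = F X + \sum_(W in Y |: R) F W by apply: big_setU1.
have dZ W : W \in R -> [disjoint Z & W].
  case/RP=> WP WX WY; rewrite -setI_eq0 setIUl setU_eq0 !setI_eq0.
  by rewrite !(trivIset_disjoint tP) // eq_sym.
exists (Z |: R); split.
- apply/trivIsetP => A B; rewrite !in_setU1 => /orP[/eqP ->|AR] /orP[/eqP ->|BR].
  + by rewrite eqxx.
  + by move=> _; apply: dZ.
  + by move=> _; rewrite disjoint_sym; apply: dZ.
  + by case: (RP _ AR) => AP _ _; case: (RP _ BR) => BP _ _; exact: (trivIset_disjoint tP).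
- move=> W; rewrite in_setU1 => /orP[/eqP ->|/RP[WP _ _]]; last exact: cP.
  by apply: connected_setU => //; apply: cP.
- by rewrite PE /cover !bigcup_setU !big_set1 setUA.
- move=> W; rewrite in_setU1 => /orP[/eqP ->|/RP[WP _ _]]; last by exists W.
  by exists X => //; apply: subsetUl.
- split; first by rewrite PE !cardsU1 XYR YR ZR.
  rewrite {1}PE !adj_countU1 // sumYR XY.
  have E1 : \sum_(W in R) block_adj X W + \sum_(W in R) block_adj Y W =
      \sum_(W in R) block_adj Z W + \sum_(W in R) (block_adj X W && block_adj Y W).
    rewrite -!big_split /=; apply: eq_bigr => W WR; have [WP WX WY] := RP _ WR.
    have WZ : W != Z by apply: contraNneq ZP => <-.
    rewrite /block_adj touchUl !(eq_sym _ W) WX WY WZ /=.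
    by case: (touch X W); case: (touch Y W).
  have := sumXYR (fun W => block_adj X W && block_adj Y W).
  rewrite sumYR -PE => ->; move: E1.
  move: (\sum_(W in R) block_adj X W) (\sum_(W in R) block_adj Y W) => sX sY.
  move: (\sum_(W in R) block_adj Z W) => sZ.
  move: (\sum_(W in R) (block_adj X W && block_adj Y W)) (adj_count R) => sXY aR.
  move: (nat_of_bool (block_adj X X && block_adj Y X)) => b1.
  move: (nat_of_bool (block_adj X Y && block_adj Y Y)) => b2.
  by clear; lia.
Qed.

(** For r + 1: if two adjacent blocks have fewer than [2 ^ r] common neighbours, merging them loses
    at most [2 ^ r.+1] ordered pairs and one block, so the density hypothesis survives. Otherwise
    the neighbours of any X that has one form a family of minimum degree at least [2 ^ r]; the r
    sets found there touch X because each contains a neighbour of X, which is what the last clause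
    on the members of s records. *)
Lemma mader r P :
  trivIset P -> (forall X, X \in P -> connected_set X) -> 0 < #|P| ->
  2 ^ r * #|P| <= adj_count P ->
  exists s : seq {set V}, [/\ size s = r,
    forall X, X \in s -> [/\ connected_set X, X \subset cover P &
                            exists2 Y, Y \in P & Y \subset X]
    & pairwise (fun X Y => [disjoint X & Y] && touch X Y) s].
Proof.
elim: r P => [|r IHr] P; first by exists [::].
have [n] := ubnP #|P|; elim: n P => // n IHn P Pn tP cP P0 HP.
case: (pselect (exists X Y, [/\ X \in P, Y \in P, block_adj X Y &
    \sum_(Z in P) (block_adj X Z && block_adj Y Z) < 2 ^ r])) => [|NC].
  case=> X [Y [XP YP XY lt]].
  have [P' [tP' cP' covP subP [nP aP]]] := adj_count_merge tP cP XP YP XY.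
  have P'0 : 0 < #|P'|.
    rewrite lt0n; apply/eqP => P'0.
    have : #|[set X; Y]| <= #|P|.
      by apply/subset_leq_card; rewrite subUset !sub1set XP.
    by rewrite cards2 nP P'0; case/andP: XY => ->.
  have [||s [sr Hs ps]] := IHn P' _ tP' cP' P'0.
  - by rewrite -ltnS -nP.
  - move: HP aP lt; rewrite nP expnS.
    move: (2 ^ r) (\sum_(_ in _) _) (adj_count P) (adj_count P') #|P'| => x S a a' p.
    by clear; nia.
  exists s; split=> // Z /Hs[cZ Zcov [W /subP[U UP UW] WZ]].
  by rewrite covP in Zcov; split=> //; exists U => //; apply: subset_trans WZ.
have [X [Y0 [XP Y0P XY0]]] : exists X Y, [/\ X \in P, Y \in P & block_adj X Y].
  apply: contrapT => N; have : adj_count P = 0.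
    apply: big1 => X XP; apply: big1 => Y YP; case: (boolP (block_adj X Y)) => // XY.
    by case: N; exists X, Y.
  by move: HP => /[swap] ->; rewrite leqn0 muln_eq0 expn_eq0 /= -leqn0 leqNgt P0.
pose N := [set Y in P | block_adj X Y].
have NP : N \subset P by apply/subsetP => Y; rewrite inE => /andP[].
have XN : X \notin N by rewrite inE /block_adj eqxx andbF.
have [|Y YN|||s [sr Hs ps]] := IHr N.
- exact: trivIsetS NP tP.
- exact: cP (subsetP NP _ YN).
- by apply/card_gt0P; exists Y0; rewrite inE Y0P.
- rewrite /adj_count mulnC -sum_nat_const; apply: leq_sum => Y.
  rewrite inE => /andP[YP XY]; rewrite leqNgt; apply/negP => lt; case: NC.
  exists X, Y; split=> //; apply: leq_ltn_trans lt.
  rewrite [leqRHS](eq_bigl (fun W => (W \in P) && block_adj X W)) => [|W]; last by rewrite inE.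
  rewrite big_mkcondr /=; apply: leq_sum => W _.
  by case: (block_adj X W); rewrite ?andbF.
exists (X :: s); split; first by rewrite /= sr.
- move=> Z; rewrite inE => /orP[/eqP ->|/Hs[cZ Zcov [Y YN YZ]]].
    split; [exact: cP|exact: bigcup_sup|by exists X].
  split=> //; last by exists Y => //; apply: (subsetP NP).
  apply: subset_trans Zcov _; apply/bigcupsP => W /(subsetP NP) WP; exact: bigcup_sup.
- rewrite /= ps andbT; apply/allP => Z /Hs[cZ Zcov [Y YN YZ]].
  have := YN; rewrite inE => /andP[YP /andP[_ XY]].
  rewrite (touchS YZ XY) andbT; apply: disjointWr Zcov _.
  rewrite disjoint_sym disjoints_subset; apply/bigcupsP => W WN; rewrite -disjoints_subset.
  rewrite disjoint_sym; apply: (trivIset_disjoint tP XP (subsetP NP _ WN)).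
  by apply: contraNneq XN => ->.
Qed.

End Mader.

(** * From branch sets to minors *)

Section Contraction.
Variables (H : sgraph) (V : finType) (l : V -> option H).

Definition same_label (K : pgraph V) : rel V :=
  fun x y => ([set x; y] \in K.2) && (l x == l y).

(* The label classes are branch sets of H in K. *)
Definition branch_labeling (K : pgraph V) : Prop :=
  [/\ forall f, f \in K.2 -> #|f| = 2 /\ f \subset K.1,
      forall x, x \in K.1 -> exists h, l x = Some h,
      forall h, exists2 x, x \in K.1 & l x = Some h,
      forall x y, x \in K.1 -> y \in K.1 -> l x = l y -> connect (same_label K) x y
    & (forall x y, [set x; y] \in K.2 -> l x <> l y ->
        exists h h', [/\ l x = Some h, l y = Some h' & [set h; h'] \in edges H]) /\
      (forall h h', [set h; h'] \in edges H ->
        exists x y, [/\ l x = Some h, l y = Some h' & [set x; y] \in K.2])].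

Lemma imset_set2 (A B : finType) (f : A -> B) x y :
  f @: [set x; y] = [set f x; f y].
Proof. by rewrite imsetU1 imset_set1. Qed.

Definition merge (u v x : V) := if x == v then u else x.

Lemma mem_contract (K : pgraph V) u v x y :
  [set x; y] \in K.2 -> merge u v x != merge u v y ->
  [set merge u v x; merge u v y] \in (contract u v K).2.
Proof.
move=> xyK ne; rewrite inE cards2 ne andbT; apply/imsetP; exists [set x; y] => //.
by rewrite imset_set2.
Qed.

Lemma contractP (K : pgraph V) u v f :
  (forall f, f \in K.2 -> #|f| = 2 /\ f \subset K.1) ->
  f \in (contract u v K).2 ->
  exists x y, [/\ [set x; y] \in K.2, merge u v x != merge u v y &
                  f = [set merge u v x; merge u v y]].
Proof.
move=> K2; rewrite inE => /andP[/imsetP[g gK ->]].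
have [/eqP/cards2P[x [y [_ eg]]] _] := K2 g gK; subst g.
by rewrite imset_set2 cards2 => ne; exists x, y; split=> //; move: ne; case: (_ != _).
Qed.

Lemma branch_labeling_contract K u v :
  branch_labeling K -> [set u; v] \in K.2 -> l u = l v ->
  branch_labeling (contract u v K).
Proof.
case=> K2 Kl Kh Kc [KE KE'] uvK luv.
have [cuv uvK1] := K2 _ uvK.
have neuv : u != v by move: cuv; rewrite cards2; case: (_ != _).
have uK : u \in K.1 by apply: (subsetP uvK1); rewrite set21.
have lm x : l (merge u v x) = l x by rewrite /merge; case: eqP => // ->.
have m1 x : x \in K.1 -> merge u v x \in (contract u v K).1.
  by move=> xK; rewrite /merge !inE; case: (eqVneq x v) => [_|xv]; rewrite ?neuv ?uK ?xv.
have mid x : x != v -> merge u v x = x by rewrite /merge => /negPf ->.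
split.
- move=> f fK; have [x [y [xyK ne ->]]] := contractP K2 fK.
  have [_ xy1] := K2 _ xyK; rewrite cards2 ne; split=> //.
  rewrite subUset !sub1set !m1 //; apply: (subsetP xy1).
    by rewrite set22.
  by rewrite set21.
- by move=> x; rewrite !inE => /andP[_ /Kl].
- move=> h; have [x xK lx] := Kh h.
  by exists (merge u v x); rewrite ?lm //; apply: m1.
- move=> x y; rewrite !inE => /andP[xv xK] /andP[yv yK] lxy.
  have c := Kc x y xK yK lxy.
  rewrite -[x]mid // -[y]mid //.
  apply: (connect_ind (P := fun z => connect _ (merge u v x) (merge u v z))) c.
    exact: connect0.
  move=> a b xa /andP[abK /eqP lab]; apply: connect_trans xa _.
  case: (eqVneq (merge u v a) (merge u v b)) => [->|ne]; first exact: connect0.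
  by apply: connect1; rewrite /same_label mem_contract // !lm lab eqxx.
- split=> [x y xyK lxy|h h' hh'E].
    have [a [b [abK ne exy]]] := contractP K2 xyK.
    case: (set2_eq exy) => -[ex ey]; subst x y; move: lxy; rewrite !lm; first exact: KE.
    by rewrite setUC in abK; apply: KE.
  have [x [y [lx ly xyK]]] := KE' h h' hh'E.
  exists (merge u v x), (merge u v y); rewrite !lm; split=> //; apply: mem_contract => //.
  apply/eqP => /(congr1 l); rewrite !lm lx ly => -[hh].
  by have := edges_card2 hh'E; rewrite hh setUid cards1.
Qed.

(** Edges inside a label class are contracted one by one; once the labels are injective, the
    labeling itself is the isomorphism with H. *)
Lemma contract_labeling K :
  branch_labeling K -> exists L, contracts_to K L /\ isomorphic H L.
Proof.
have [n] := ubnP #|K.1|; elim: n K => // n IH K Kn mK.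
have [K2 Kl Kh Kc [KE KE']] := mK.
case: (pselect {in K.1 &, injective l}) => [linj|ninj].
  exists K; split; first exact: contracts_refl.
  have [phi Hphi] : exists phi : H -> V, forall h, phi h \in K.1 /\ l (phi h) = Some h.
    apply: (fin_all_exists (P := fun h x => x \in K.1 /\ l x = Some h)) => h.
    by have [x xK lx] := Kh h; exists x.
  have phiE x h : x \in K.1 -> l x = Some h -> x = phi h.
    by move=> xK lx; case: (Hphi h) => pK lp; apply: linj => //; rewrite lp.
  have K1 x y : [set x; y] \in K.2 -> x \in K.1 /\ y \in K.1.
    by move=> /K2[_]; rewrite subUset !sub1set => /andP.
  exists phi; split.
  - by move=> h h' e; case: (Hphi h) (Hphi h') => _ + [_]; rewrite e => -> [].
  - apply/setP => x; apply/imsetP/idP => [[h _ ->]|xK]; first by case: (Hphi h).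
    by have [h lx] := Kl x xK; exists h => //; apply: phiE.
  - apply/setP => f; apply/imsetP/idP => [[g gE ->]|fK].
      have /eqP/cards2P[h [h' [_ eg]]] := edges_card2 gE; subst g.
      have [x [y [lx ly xyK]]] := KE' h h' gE; have [xK yK] := K1 _ _ xyK.
      by rewrite imset_set2 -(phiE x h) // -(phiE y h').
    have [/eqP/cards2P[x [y [ne ef]]] _] := K2 f fK; subst f.
    have [xK yK] := K1 _ _ fK.
    have [|h [h' [lx ly hhE]]] := KE x y fK; first by move/(linj _ _ xK yK)/eqP; rewrite (negPf ne).
    by exists [set h; h'] => //; rewrite imset_set2 -(phiE x h) // -(phiE y h').
have [u [v [uvK luv]]] : exists u v, [set u; v] \in K.2 /\ l u = l v.
  apply: contrapT => N; apply: ninj => x y xK yK lxy.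
  apply: contrapT => ne; apply: N.
  case/connectP: (Kc x y xK yK lxy) => -[|z p] /= => [_ yx|/andP[/andP[xzK /eqP lxz] _] _].
    by case: ne.
  by exists x, z.
have uvK1 := (K2 _ uvK).2.
have [||L [KL HL]] := IH (contract u v K).
- have vK : v \in K.1 by apply: (subsetP uvK1); rewrite set22.
  by move: Kn; rewrite (cardsD1 v) vK /= add1n ltnS.
- exact: branch_labeling_contract.
- by exists L; split=> //; apply: contracts_step uvK KL.
Qed.

End Contraction.

Lemma clique_minor (H G : sgraph) (s : seq {set G}) :
  size s = #|H| -> (forall X, X \in s -> connected_set (edges G) X) ->
  pairwise (fun X Y : {set G} => [disjoint X & Y] && touch (edges G) X Y) s ->
  minor H G.
Proof.
move=> ss cs ps; pose B (h : H) := nth set0 s (enum_rank h).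
have Bs h : B h \in s by apply: mem_nth; rewrite ss ltn_ord.
have Bd h h' : h != h' -> [disjoint B h & B h'] /\ touch (edges G) (B h) (B h').
  move=> ne; have /(pairwiseP set0) H0 := ps.
  wlog lt : h h' ne / enum_rank h < enum_rank h' => [W|].
    case: (ltngtP (enum_rank h) (enum_rank h')) => [lt|lt|e]; first exact: W.
      by rewrite disjoint_sym touchC; apply: W; rewrite // eq_sym.
    by move/val_inj/enum_rank_inj: e ne => ->; rewrite eqxx.
  by apply/andP; apply: H0; rewrite // inE ss ltn_ord.
pose l (x : G) : option H := [pick h | x \in B h].
have lB x h : x \in B h -> l x = Some h.
  rewrite /l; case: pickP => [h' xB' xB|/(_ h) ->] //; congr Some.
  apply: contrapT => /eqP ne; have [dis _] := Bd _ _ ne.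
  by have := disjointFr dis xB'; rewrite xB.
have Bl x h : l x = Some h -> x \in B h.
  by rewrite /l; case: pickP => // h' xB [<-].
pose ok (a b : option H) :=
  if a is Some h then if b is Some h' then (h == h') || ([set h; h'] \in edges H) else false
  else false.
have okC a b : ok a b = ok b a by case: a b => [a|] [b|] //=; rewrite eq_sym setUC.
(* An isomorphism must match the edge sets exactly, so edges between branch sets of non-adjacent
   vertices of H are deleted before contracting. *)
pose K : pgraph G := ([set x | l x != None],
  [set f in edges G | [exists x, exists y, (f == [set x; y]) && ok (l x) (l y)]]).
have KE x y : ([set x; y] \in K.2) = ([set x; y] \in edges G) && ok (l x) (l y).
  rewrite inE; congr andb; apply/existsP/idP => [[a /existsP[b /andP[/eqP e oab]]]|oxy].
    by case/set2_eq: e => -[-> ->] //; rewrite okC.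
  by exists x; apply/existsP; exists y; rewrite eqxx.
have oks a b : ok a b -> a != None /\ b != None by case: a b => [a|] [b|].
have K1 f : f \in K.2 -> f \subset K.1.
  rewrite inE => /andP[_ /existsP[x /existsP[y /andP[/eqP -> /oks[lx ly]]]]].
  by rewrite subUset !sub1set !inE lx.
have [|L [KL HL]] := @contract_labeling H G l K; last first.
  exists K, L; split=> //; split=> //.
  by apply/subsetP => f; rewrite inE => /andP[].
split.
- by move=> f fK; split; [move: fK; rewrite inE => /andP[/edges_card2]|apply: K1].
- by move=> x; rewrite inE; case: (l x) => // h _; exists h.
- move=> h; have [/set0Pn[x xB] _] := cs _ (Bs h).
  by exists x; rewrite ?inE (lB _ _ xB).
- move=> x y; rewrite inE; case lx: (l x) => [h|] // _ _ /esym ly.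
  have [_ cB] := cs _ (Bs h); have := cB x y (Bl _ _ lx) (Bl _ _ ly).
  apply: connect_sub => a b; rewrite /adj mem_within => /and3P[abE aB bB].
  by apply: connect1; rewrite /same_label KE abE (lB _ _ aB) (lB _ _ bB) /= !eqxx.
- split=> [x y|h h' hhE].
    rewrite KE => /andP[_]; case: (l x) (l y) => [h|] [h'|] //= /orP[/eqP -> //|hhE] _.
    by exists h, h'.
  have ne : h != h' by have := edges_card2 hhE; rewrite cards2; case: (_ != _).
  have [_ /touchP[x [y [xB yB xyE]]]] := Bd _ _ ne.
  by exists x, y; rewrite KE xyE (lB _ _ xB) (lB _ _ yB) /= hhE orbT.
Qed.

Lemma minor_free_sparse (H G : sgraph) (P : {set {set G}}) :
  minor_free H G -> trivIset P ->
  (forall X, X \in P -> connected_set (edges G) X) ->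
  adj_count (edges G) P <= 2 ^ #|H| * #|P|.
Proof.
move=> mf tP cP; rewrite leqNgt; apply/negP => lt.
have P0 : 0 < #|P|.
  rewrite lt0n; apply/eqP => /eqP; rewrite cards_eq0 => /eqP P0.
  by move: lt; rewrite P0 /adj_count big_set0.
have [s [ss cs ps]] := mader tP cP P0 (ltnW lt).
by apply: mf; apply: (clique_minor ss _ ps) => X /cs[].
Qed.

Lemma card_class_pairs (H G : sgraph) (cl : G -> G) :
  minor_free H G ->
  (forall x y, cl x = cl y -> conn (within (edges G) [set z | cl z == cl x]) x y) ->
  #|class_pairs (edges G) cl| <= 2 ^ #|H| * #|[set cl x | x in G]|.
Proof.
move=> mf cl_conn; pose fib c := [set z | cl z == c].
pose I := [set cl x | x in G].
have fib_inj : {in I &, injective fib}.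
  move=> _ b /imsetP[x _ ->] _ /setP/(_ x); rewrite !inE eqxx => /esym/eqP //.
have := @minor_free_sparse H G (fib @: I) mf _ _; rewrite card_in_imset //.
move=> sparse; apply: leq_trans (sparse _ _).
- rewrite /adj_count big_imset //=; under eq_bigr => c _ do rewrite big_imset //=.
  rewrite pair_big_dep /= -sum1_card big_mkcond [leqRHS]big_mkcond /=.
  apply: leq_sum => -[a b] _; rewrite inE /=.
  case: ifP => // /andP[ne /existsP[x /existsP[y /and3P[/eqP xa /eqP yb xyE]]]].
  have aI : a \in I by rewrite -xa imset_f.
  have bI : b \in I by rewrite -yb imset_f.
  rewrite aI bI /= /block_adj (inj_in_eq fib_inj) // ne /= lt0b.
  by apply/touchP; exists x, y; rewrite !inE xa yb.
- apply/trivIsetP => _ _ /imsetP[a _ ->] /imsetP[b _ ->] ne.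
  rewrite disjoint_subset; apply/subsetP => z; rewrite !inE => /eqP za.
  by apply: contra ne => /eqP zb; rewrite -za -zb.
- move=> _ /imsetP[_ /imsetP[x _ ->] ->]; split.
    by apply/set0Pn; exists x; rewrite inE.
  move=> y z; rewrite !inE => /eqP yx /eqP zx.
  by have := cl_conn y z; rewrite yx zx; apply.
Qed.

(** * Extra edges in a minor-free graph *)

Section Sparse.
Variables (H G : sgraph) (rk : {set G} -> nat).
Hypothesis mf : minor_free H G.
Hypothesis rk_inj : {in edges G &, injective rk}.
Hypothesis cG : spanning_connected (edges G).

Local Notation E := (edges G).
Local Notation T := (kruskal E rk).

Lemma extra_edges_classes (K : {set {set G}}) (cl : G -> G) :
  (forall x y, cl x = cl y -> conn (within T [set z | cl z == cl x]) x y) ->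
  K \subset E ->
  (forall u v, [set u; v] \in K ->
     ~~ conn (lighter rk (within E ([set z | cl z == cl u] :|: [set z | cl z == cl v]))
               [set u; v]) u v) ->
  #|K :\: T| <= 2 ^ #|H| * #|[set cl x | x in G]|.
Proof.
move=> cl_conn KE HK.
apply: leq_trans (extra_edges (@edges_card2 G) rk_inj cl_conn KE HK) _.
apply: card_class_pairs mf _ => x y /cl_conn; apply: connS.
by apply: withinSS => //; apply: kruskal_sub.
Qed.

(** The clustering into singletons: no edge within {u, v} is lighter than [[set u; v]], so every
    edge passes the test. This bound permits keeping all edges when eps is large. *)
Lemma card_edges_le : #|E :\: T| <= 2 ^ #|H| * #|G|.
Proof.
apply: leq_trans (@extra_edges_classes E id _ (subxx _) _) _.
- by move=> x y ->; apply: conn0.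
- move=> u v uvE; apply/negP => c.
  have := edge_neq (@edges_card2 G) uvE => /eqP; apply; apply/esym.
  apply: (connect_ind (P := fun z => z = u)) c => // x y ->.
  rewrite /adj inE mem_within => /andP[/and3P[uyE _ +]].
  rewrite !inE => /orP[/eqP -> //|/eqP ->]; by rewrite ltnn.
- by rewrite leq_mul2l leq_imset_card orbT.
Qed.

(** The 3 stands for the three terms of [clustering], each at most [#|G| / q] by the choice of k. *)
Lemma extra_edges_local (K : {set {set G}}) (q d k : nat) :
  (forall u, #|nbh E u| <= d) -> 1 < q -> k = q ^ 2 * d.+1 -> K \subset E ->
  (forall u v, [set u; v] \in K -> exists S : {set G},
     [/\ u \in S, v \in S,
       forall y, y \in prim E rk k u :|: prim E rk k v ->
         #|inflow E rk k y| <= k ^ 2 -> inflow E rk k y \subset S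
     & ~~ conn (lighter rk (within E S) [set u; v]) u v]) ->
  #|K :\: T| * q <= 2 ^ #|H| * (3 * #|G|).
Proof.
move=> degd q1 kE KE HK.
have k0 : 0 < k by rewrite kE muln_gt0 expn_gt0 ltnW.
have sparse (cl : G -> G) :
    (forall x y, cl x = cl y -> conn (within T [set z | cl z == cl x]) x y) ->
    (forall u (S : {set G}), u \in S ->
       (forall y, y \in prim E rk k u -> #|inflow E rk k y| <= k ^ 2 ->
          inflow E rk k y \subset S) -> [set z | cl z == cl u] \subset S) ->
  #|K :\: T| <= #|class_pairs E cl|.
  move=> cl_conn cl_sub; apply: (extra_edges (@edges_card2 G)) => // u v uvK.
  have [S [uS vS HS nc]] := HK u v uvK; apply: contra nc; apply: connS.
  apply: lighterS; apply: withinSS => //; rewrite subUset !cl_sub //.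
    by move=> y yv; apply: HS; rewrite inE yv orbT.
  by move=> y yu; apply: HS; rewrite inE yu.
(* If k is at least [#|G|], all explorations and all inflows are the whole graph and stay within the
   cap; one class suffices and no edge outside T is kept. *)
case: (ltnP k #|G|) => [kG|Gk]; last first.
  have primT x : prim E rk k x = setT by apply: prim_full => //; apply: leqW.
  have inT y : inflow E rk k y = setT.
    by apply/setP => x; rewrite !inE primT inE.
  case: (pickP [pred x : G | true]) => [r _|G0]; last first.
    suff -> : K = set0 by rewrite set0D cards0.
    apply/setP => f; rewrite inE; apply/negP => /(subsetP KE)/edges_card2/eqP.
    by case/cards2P => x; have := G0 x.
  have e0 : class_pairs E (fun=> r) = set0.
    apply/setP => -[a b]; rewrite !inE /=; apply/negP => /andP[ne].
    by case/existsP=> x /existsP[y /and3P[/eqP ra /eqP rb _]]; rewrite -ra -rb eqxx in ne.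
  have := sparse (fun=> r); rewrite e0 cards0 leqn0 => key.
  suff /eqP -> : #|K :\: T| == 0 by [].
  apply: key => [x y _|u S _ HS].
    have -> : [set z : G | r == r] = setT by apply/setP => z; rewrite !inE eqxx.
    apply: connS (spanning_connectedP _ (kruskal_connected rk cG) x y).
    by apply/subsetP => f fT; rewrite inE fT subsetT.
  apply: subset_trans (subsetT _) _; rewrite -(inT u); apply: HS; rewrite ?primT ?inE //.
  by rewrite inT cardsT (leq_trans Gk) // expnS expn1 leq_pmulr.
have [cl [cl_conn cl_sub [nD [nO [nU [cN cD cO cU]]]]]] :=
  @clustering G E rk k (k ^ 2) q d (@edges_card2 G) rk_inj cG degd kG.
have le := leq_trans (sparse cl cl_conn cl_sub) (card_class_pairs mf _).
have {}le : #|K :\: T| <= 2 ^ #|H| * #|[set cl x | x in G]|.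
  apply: le => x y /cl_conn; apply: connS.
  by apply: withinSS => //; apply: kruskal_sub.
apply: (@leq_trans (2 ^ #|H| * #|[set cl x | x in G]| * q)); first by rewrite leq_mul2r le orbT.
rewrite -mulnA leq_mul2l; apply/orP; right.
move: cN cD cO cU; move: (#|[set cl x | x in G]|) => N.
move: (#|G|) => n; rewrite kE => cN cD cO cU.
have hU : nU * q <= n.
  have q0 : 0 < q by apply: ltnW.
  rewrite -(leq_pmul2l q0); apply: leq_trans cU.
  rewrite mulnCA leq_mul2l; apply/orP; right.
  by rewrite leqW // expnS expn1 leq_pmulr.
(* [nO * k ^ 2 <= k.+1 * n <= q * k * n], as q is at least 2; divide by [q ^ 3 * d.+1]. *)
have hO : d.+1 * nO * q <= n.
  have w0 : 0 < q ^ 3 * d.+1 by rewrite muln_gt0 expn_gt0 ltnW.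
  rewrite -(leq_pmul2l w0); apply: (@leq_trans (nO * (q ^ 2 * d.+1) ^ 2)).
    by apply: eq_leq; rewrite !expnS !expn0; lia.
  apply: leq_trans cO _; rewrite leq_mul2r; apply/orP; right.
  rewrite (expnS q 2) -mulnA.
  have : 0 < q ^ 2 * d.+1 by rewrite -kE.
  by move: (q ^ 2 * d.+1) q1 => w; clear; nia.
move: (d.+1 * nO) hO cN => m hm cN.
apply: (@leq_trans ((nD + m + nU) * q)); first by rewrite leq_mul2r cN orbT.
rewrite !mulnDl (_ : 3 * n = n + n + n); last by lia.
by rewrite leq_add // leq_add.
Qed.

End Sparse.

(** * A machine with lists and bounded loops *)

Inductive linstr :=
| ISkip
| IConst (r k : nat)
| ICopy (r a : nat)
| IAdd (r a b : nat)
| ISub (r a b : nat)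
| IInc (r : nat)
| IRCopy (x y : nat)
| IQuery (f b x a i : nat)
| IPush (j r : nat)
| IClear (j : nat)
| INth (r j p : nat).

Inductive ltest :=
| LTLt (a b : nat)
| LTRLt (x y : nat)
| LTPos (f : nat)
| LTIn (p j : nat).

(* [LLoop c] runs c exactly Z times, so that the running time is bounded by the
   syntax of the command. *)
Inductive lcmd :=
| LI (i : linstr)
| LSeq (c1 c2 : lcmd)
| LIf (t : ltest) (c1 c2 : lcmd)
| LLoop (c : lcmd).

(* Registers, real registers and lists occupy interleaved addresses; the
   remaining residues hold loop counters, list lengths, scratch cells, the
   constant 1 (address 4) and the loop bound Z (address 5). *)
Definition reg (r : nat) := 16 * r.
Definition ctr (n : nat) := 16 * n + 1.
Definition len (j : nat) := 16 * j + 2.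
Definition cell (j i : nat) := 16 * i + (8 + j).
Definition rreg (x : nat) := 2 * x.

Fixpoint seqs (l : seq instr) (i : instr) : prog :=
  if l is i' :: l' then Seq (Atom i') (seqs l' i) else Atom i.

(* N[3] := address of the entry number N[a] of the list j. *)
Definition locate (a j : nat) : seq instr :=
  [:: NAdd 3 a a; NAdd 3 3 3; NAdd 3 3 3; NAdd 3 3 3; NConst 19 (8 + j); NAdd 3 3 19].

(** The machine has neither a direct copy nor a real constant 0: copying adds a zero prepared in a
    scratch cell, and for reals this zero is [X[1] - X[1]], odd real addresses not being
    registers. *)
Definition compile_instr (i : linstr) : prog :=
  match i with
  | ISkip => Atom NSkip
  | IConst r k => Atom (NConst (reg r) k)
  | ICopy r a => seqs [:: NConst 3 0] (NAdd (reg r) (reg a) 3)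
  | IAdd r a b => Atom (NAdd (reg r) (reg a) (reg b))
  | ISub r a b => Atom (NSub (reg r) (reg a) (reg b))
  | IInc r => Atom (NAdd (reg r) (reg r) 4)
  | IRCopy x y => seqs [:: RSub 1 1 1] (RAdd (rreg x) (rreg y) 1)
  | IQuery f b x a i => Atom (Query (reg f) (reg b) (rreg x) (reg a) (reg i))
  | IPush j r => seqs (rcons (locate (len j) j) (NStore 3 (reg r))) (NAdd (len j) (len j) 4)
  | IClear j => Atom (NConst (len j) 0)
  | INth r j p => If (TLt (reg p) (len j)) (seqs (locate (reg p) j) (NLoad (reg r) 3))
                    (Atom (NConst (reg r) 0))
  end.

Definition compile_test (t : ltest) : test :=
  match t with
  | LTLt a b => TLt (reg a) (reg b)
  | LTRLt x y => TRLt (rreg x) (rreg y)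
  | LTPos f => TLe 4 (reg f)
  | LTIn p j => TLt (reg p) (len j)
  end.

(* [n] is the number of enclosing loops. *)
Fixpoint compile (n : nat) (c : lcmd) : prog :=
  match c with
  | LI i => compile_instr i
  | LSeq c1 c2 => Seq (compile n c1) (compile n c2)
  | LIf t c1 c2 => If (compile_test t) (compile n c1) (compile n c2)
  | LLoop c => Seq (Atom (NConst (ctr n) 0))
      (While (TLt (ctr n) 5) (Seq (compile n.+1 c) (Atom (NAdd (ctr n) (ctr n) 4))))
  end.

Definition wf_instr (i : linstr) : bool :=
  match i with
  | IPush j _ | IClear j | INth _ j _ => j < 8
  | _ => true
  end.

Fixpoint wf (c : lcmd) : bool :=
  match c with
  | LI i => wf_instr i
  | LSeq c1 c2 => wf c1 && wf c2
  | LIf t c1 c2 => [&& (if t is LTIn _ j then j < 8 else true), wf c1 & wf c2]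
  | LLoop c => wf c
  end.

Section ListMachine.
Variables (R : realType) (oracle : nat -> nat -> option (nat * R)) (omega : tape).
Variable Z : nat.

Record lstate := LState { hn : nat -> nat; hx : nat -> R; hl : nat -> seq nat }.

Definition lsetn (h : lstate) r k := LState (upd (hn h) r k) (hx h) (hl h).
Definition lsetx (h : lstate) x y := LState (hn h) (upd (hx h) x y) (hl h).
Definition lsetl (h : lstate) j l := LState (hn h) (hx h) (upd (hl h) j l).

Definition leval_instr (i : linstr) (h : lstate) : lstate :=
  match i with
  | ISkip => h
  | IConst r k => lsetn h r k
  | ICopy r a => lsetn h r (hn h a)
  | IAdd r a b => lsetn h r (hn h a + hn h b)
  | ISub r a b => lsetn h r (hn h a - hn h b)
  | IInc r => lsetn h r (hn h r).+1
  | IRCopy x y => lsetx h x (hx h y)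
  | IQuery f b x a i =>
      if oracle (hn h a) (hn h i) is Some (k, y)
      then lsetx (lsetn (lsetn h f 1) b k) x y
      else lsetn h f 0
  | IPush j r => lsetl h j (rcons (hl h j) (hn h r))
  | IClear j => lsetl h j [::]
  | INth r j p => lsetn h r (nth 0 (hl h j) (hn h p))
  end.

Definition leval_test (t : ltest) (h : lstate) : bool :=
  match t with
  | LTLt a b => hn h a < hn h b
  | LTRLt x y => (hx h x < hx h y)%R
  | LTPos f => 0 < hn h f
  | LTIn p j => hn h p < size (hl h j)
  end.

Fixpoint leval (c : lcmd) (h : lstate) : lstate :=
  match c with
  | LI i => leval_instr i h
  | LSeq c1 c2 => leval c2 (leval c1 h)
  | LIf t c1 c2 => if leval_test t h then leval c1 h else leval c2 h
  | LLoop c => iter Z (leval c) h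
  end.

Fixpoint lcost (c : lcmd) : nat :=
  match c with
  | LI i => 12
  | LSeq c1 c2 => lcost c1 + lcost c2
  | LIf t c1 c2 => (lcost c1 + lcost c2).+1
  | LLoop c => Z * (lcost c + 2) + 2
  end.

(** Cells beyond the length of a list are left free, so a list is cleared by resetting its length
    alone. *)
Record represents (h : lstate) (s : state R) : Prop := Represents {
  rep_n : forall r, nmem s (reg r) = hn h r;
  rep_x : forall x, rmem s (rreg x) = hx h x;
  rep_len : forall j, j < 8 -> nmem s (len j) = size (hl h j);
  rep_cell : forall j i, j < 8 -> i < size (hl h j) -> nmem s (cell j i) = nth 0 (hl h j) i;
  rep_one : nmem s 4 = 1;
  rep_Z : nmem s 5 = Z
}.

Lemma updE (A : Type) (m : nat -> A) k y j : upd m k y j = if j == k then y else m j.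
Proof. by []. Qed.

Lemma exec_queries c s s' t q : @exec R oracle omega c s s' t q -> q <= t.
Proof.
elim=> {c s s' t q} //.
- by case.
- by move=> *; apply: leq_add.
- by move=> *; apply: leqW.
- by move=> *; apply: leqW; apply: leq_add.
Qed.

Lemma exec_seqs l i s :
  exists q, exec oracle omega (seqs l i) s
    (istep oracle omega i (foldl (fun s i => istep oracle omega i s) s l)) (size l).+1 q.
Proof.
elim: l s => [|i' l IH] s /=; first by eexists; apply: ExecAtom.
have [q E] := IH (istep oracle omega i' s).
by eexists; rewrite -add1n; apply: ExecSeq E; apply: ExecAtom.
Qed.

(** Code compiled at depth n must leave the counters of its n enclosing loops alone; this makes the
    induction through nested loops work. *)
Definition preserves n (s s' : state R) := forall m, m < n -> nmem s' (ctr m) = nmem s (ctr m).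

Definition realizes n c (f : lstate -> lstate) B := forall h s, represents h s ->
  exists s' t q, [/\ exec oracle omega c s s' t q, represents (f h) s',
                     preserves n s s' & t <= B].

Lemma represents_setn h s r k : represents h s -> represents (lsetn h r k) (setn s (reg r) k).
Proof.
case=> Hn Hx Hl Hc H1 HZ; split=> //=.
- by move=> r'; rewrite !updE -Hn /reg; do 2!case: eqP => //; lia.
- by move=> j j8; rewrite updE -Hl // /len /reg; case: eqP => //; lia.
- by move=> j i j8 ij; rewrite updE -Hc // /cell /reg; case: eqP => //; lia.
- by rewrite updE /reg; case: eqP => //; lia.
- by rewrite updE /reg; case: eqP => //; lia.
Qed.

Lemma represents_scratch h s a k : represents h s ->
  [|| a == 3, a == 19 | a %% 16 == 1] -> represents h (setn s a k).
Proof.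
move=> [Hn Hx Hl Hc H1 HZ] Ha; split=> //=.
- by move=> r; rewrite updE Hn; case: eqP => // e; move: Ha; rewrite -e /reg; lia.
- by move=> j j8; rewrite updE Hl //; case: eqP => // e; move: Ha; rewrite -e /len; lia.
- by move=> j i j8 ij; rewrite updE Hc //; case: eqP => // e; move: Ha; rewrite -e /cell; lia.
- by rewrite updE H1; case: eqP => // e; move: Ha; rewrite -e.
- by rewrite updE HZ; case: eqP => // e; move: Ha; rewrite -e.
Qed.

Lemma represents_setx h s x y : represents h s -> represents (lsetx h x y) (setr s (rreg x) y).
Proof.
case=> Hn Hx Hl Hc H1 HZ; split=> //= x'.
by rewrite !updE -Hx /rreg; do 2!case: eqP => //; lia.
Qed.

Lemma preserves_setn n s a k : a %% 16 != 1 -> preserves n s (setn s a k).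
Proof. by move=> Ha m _ /=; rewrite updE; case: eqP => // e; move: Ha; rewrite -e /ctr; lia. Qed.

Lemma preserves_trans n s1 s2 s3 :
  preserves n s1 s2 -> preserves n s2 s3 -> preserves n s1 s3.
Proof. by move=> H1 H2 m mn; rewrite H2 // H1. Qed.

Lemma locateP a j h s : represents h s -> a != 3 ->
  let s' := foldl (fun s i => istep oracle omega i s) s (locate a j) in
  [/\ represents h s', nmem s' 3 = cell j (nmem s a),
      forall b, b != 3 -> b != 19 -> nmem s' b = nmem s b & forall n, preserves n s s'].
Proof.
move=> Hh a3 /=; split.
- by do !(apply: represents_scratch => //).
- by rewrite /= !updE /= /cell; lia.
- by move=> b /negPf b3 /negPf b19; rewrite !updE b3 b19.
- by move=> n; do !(apply: preserves_trans; last exact: preserves_setn).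
Qed.

Lemma rep_setn n h h' s s' r k : represents h s -> preserves n s' s ->
  h' = lsetn h r k ->
  represents h' (setn s (reg r) k) /\ preserves n s' (setn s (reg r) k).
Proof.
move=> Hh Hp ->; split; first exact: represents_setn.
by apply: preserves_trans Hp _; apply: preserves_setn; rewrite /reg; lia.
Qed.

Lemma preserves0 n s : preserves n s s.
Proof. by []. Qed.

Lemma compile_instrP n i : wf_instr i -> realizes n (compile_instr i) (leval_instr i) 12.
Proof.
move=> wfi h s Hh.
have atom a : [/\ represents (leval_instr i h) (istep oracle omega a s) &
                  preserves n s (istep oracle omega a s)] ->
    exists s' t q, [/\ exec oracle omega (Atom a) s s' t q,
      represents (leval_instr i h) s', preserves n s s' & t <= 12].
  by case=> H1 H2; do 3!eexists; split; [exact: ExecAtom|exact: H1|exact: H2|].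
have p0 := @preserves0 n s.
case: i wfi atom => [|r k|r a|r b c|r b c|r|x y|f b x a i|j r|j|r j p] /= wfi atom.
- exact: atom.
- by apply: atom; apply: (rep_setn Hh p0).
- have [q /= E] := exec_seqs [:: NConst 3 0] (NAdd (reg r) (reg a) 3) s.
  do 3!eexists; split; first exact: E; last by [].
    have H1 : represents h (setn s 3 0) by apply: represents_scratch.
    by rewrite -(rep_n H1) -[nmem _ (reg a)]addn0; apply: represents_setn.
  apply: (@preserves_trans _ _ (setn s 3 0)); apply: preserves_setn => //.
  by rewrite /reg; lia.
- by apply: atom; apply: (rep_setn Hh p0); rewrite // !(rep_n Hh).
- by apply: atom; apply: (rep_setn Hh p0); rewrite // !(rep_n Hh).
- by apply: atom; apply: (rep_setn Hh p0); rewrite // (rep_n Hh) (rep_one Hh) addn1.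
- have [q /= E] := exec_seqs [:: RSub 1 1 1] (RAdd (rreg x) (rreg y) 1) s.
  do 3!eexists; split; first exact: E; [|by []|by []].
  have -> : (upd (rmem s) 1 (rmem s 1 - rmem s 1) (rreg y) +
             upd (rmem s) 1 (rmem s 1 - rmem s 1) 1 = hx h y)%R.
    rewrite !updE /= GRing.subrr GRing.addr0 -(rep_x Hh) ifN //; rewrite /rreg; lia.
  apply: represents_setx; case: Hh => Hn Hx Hl Hc H1 HZ; split=> //= z.
  by rewrite updE -Hx ifN //; rewrite /rreg; lia.
- apply: atom; rewrite /= !(rep_n Hh); case: (oracle _ _) => [[k y]|]; last exact: (rep_setn Hh p0 erefl).
  have [H1 p1] := @rep_setn n _ _ _ s f 1 Hh p0 erefl.
  have [H2 p2] := @rep_setn n _ _ _ s b k H1 p1 erefl.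
  by split; [apply: represents_setx|].
- have [q E] := exec_seqs (rcons (locate (len j) j) (NStore 3 (reg r)))
                  (NAdd (len j) (len j) 4) s.
  do 3!eexists; split; first exact: E; last by [].
    rewrite foldl_rcons; have [] := @locateP (len j) j h s Hh _; first by rewrite /len; lia.
    move: (foldl _ s _) => s1 H1 n3 Hb _ /=; rewrite n3 (rep_n H1) -(rep_n Hh).
    rewrite (rep_len Hh) //; case: (H1) => Hn Hx Hl Hc Ho HZ; split=> //=.
    + move=> r'; rewrite !updE -Hn ifN ?ifN //; rewrite /reg /len /cell; lia.
    + move=> i i8; rewrite !updE /len; case: (eqVneq i j) => [->|ij].
        rewrite eqxx size_rcons ifN; last by rewrite /cell; lia.
        rewrite ifN; last by rewrite /cell; lia.
        by rewrite Ho -/(len j) Hl // addn1.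
      rewrite ifN; last lia.
      rewrite ifN; last by rewrite /cell; lia.
      exact: Hl.
    + move=> i m i8; rewrite !updE; case: (eqVneq i j) => [->|ij] im.
        rewrite ifN; last by rewrite /cell /len; lia.
        rewrite nth_rcons; move: im; rewrite size_rcons ltnS leq_eqVlt.
        case/orP=> [/eqP ->|im]; first by rewrite !eqxx ltnn.
        rewrite im ifN; last by rewrite /cell; lia.
        exact: Hc.
      rewrite ifN; last by rewrite /cell /len; lia.
      rewrite ifN; last by rewrite /cell; lia.
      exact: Hc.
    + by rewrite !updE ifN ?ifN //; rewrite /cell /len; lia.
    + by rewrite !updE ifN ?ifN //; rewrite /cell /len; lia.
  rewrite foldl_rcons; have [] := @locateP (len j) j h s Hh _; first by rewrite /len; lia.
  move: (foldl _ s _) => s1 H1 n3 Hb /(_ n) p1 /=.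
  apply: preserves_trans p1 _; apply: (@preserves_trans _ _ (setn s1 (nmem s1 3) (nmem s1 (reg r)))).
    by apply: preserves_setn; rewrite n3 /cell; lia.
  by apply: (@preserves_setn _ (setn s1 _ _)); rewrite /len; lia.
- apply: atom; split; last by apply: preserves_setn; rewrite /len; lia.
  case: Hh => Hn Hx Hl Hc Ho HZ; split=> //=.
  + by move=> r; rewrite updE ifN //; rewrite /reg /len; lia.
  + move=> i i8; rewrite !updE; case: (eqVneq i j) => [->|ij]; first by rewrite eqxx.
    by rewrite ifN ?Hl //; rewrite /len; lia.
  + move=> i m i8; rewrite !updE; case: (eqVneq i j) => // ij im.
    by rewrite ifN ?Hc //; rewrite /cell /len; lia.
  + by rewrite updE ifN //; rewrite /len; lia.
  + by rewrite updE ifN //; rewrite /len; lia.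
- case: (ltnP (hn h p) (size (hl h j))) => pj.
    have [q E] := exec_seqs (locate (reg p) j) (NLoad (reg r) 3) s.
    do 3!eexists; split; first apply: ExecIf.
    + by rewrite /= (rep_n Hh) (rep_len Hh) // pj; exact: E.
    + have [] := @locateP (reg p) j h s Hh _; first by rewrite /reg; lia.
      move: (foldl _ s _) => s1 H1 n3 Hb _ /=.
      rewrite n3 (rep_n Hh) (rep_cell H1) //; exact: represents_setn.
    + have [] := @locateP (reg p) j h s Hh _; first by rewrite /reg; lia.
      move: (foldl _ s _) => s1 H1 n3 Hb /(_ n) p1 /=.
      by apply: preserves_trans p1 _; apply: preserves_setn; rewrite /reg; lia.
    + by [].
  have [H1 p1] := @rep_setn n _ _ _ s r 0 Hh p0 erefl.
  do 3!eexists; split; first apply: ExecIf.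
  + by rewrite /= (rep_n Hh) (rep_len Hh) // ltnNge pj /=; exact: ExecAtom.
  + by rewrite nth_default //=; exact: H1.
  + exact: p1.
  + by [].
Qed.

Lemma compile_testP t h s : represents h s ->
  (if t is LTIn _ j then j < 8 else true) -> eval_test (compile_test t) s = leval_test t h.
Proof.
move=> Hh; case: t => [a b|x y|f|p j] wft /=.
- by rewrite !(rep_n Hh).
- by rewrite !(rep_x Hh).
- by rewrite (rep_one Hh) (rep_n Hh).
- by rewrite (rep_n Hh) (rep_len Hh).
Qed.

Lemma preservesW n s s' : preserves n.+1 s s' -> preserves n s s'.
Proof. by move=> H m mn; apply: H; apply: ltnW. Qed.

Theorem compileP n c : wf c -> realizes n (compile n c) (leval c) (lcost c).
Proof.
elim: c n => [i|c1 IH1 c2 IH2|t c1 IH1 c2 IH2|c IH] n /=.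
- exact: compile_instrP.
- move=> /andP[w1 w2] h s Hh; have [s1 [t1 [q1 [E1 H1 p1 b1]]]] := IH1 n w1 h s Hh.
  have [s2 [t2 [q2 [E2 H2 p2 b2]]]] := IH2 n w2 _ _ H1.
  do 3!eexists; split; [exact: ExecSeq E1 E2|exact: H2|exact: preserves_trans p1 p2|].
  exact: leq_add.
- move=> /and3P[wt w1 w2] h s Hh; have Et := compile_testP Hh wt.
  case: ifP => Ht.
    have [s1 [t1 [q1 [E1 H1 p1 b1]]]] := IH1 n w1 h s Hh.
    do 3!eexists; split; [apply: ExecIf; rewrite Et Ht; exact: E1|exact: H1|exact: p1|].
    by rewrite ltnS (leq_trans b1) // leq_addr.
  have [s1 [t1 [q1 [E1 H1 p1 b1]]]] := IH2 n w2 h s Hh.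
  do 3!eexists; split; [apply: ExecIf; rewrite Et Ht; exact: E1|exact: H1|exact: p1|].
  by rewrite ltnS (leq_trans b1) // leq_addl.
move=> wc h s Hh.
have loop m h0 s0 : represents h0 s0 -> nmem s0 (ctr n) + m = Z ->
    exists s' t q, [/\ exec oracle omega (While (TLt (ctr n) 5)
        (Seq (compile n.+1 c) (Atom (NAdd (ctr n) (ctr n) 4)))) s0 s' t q,
      represents (iter m (leval c) h0) s', preserves n s0 s' & t <= m * (lcost c + 2) + 1].
  elim: m h0 s0 => [|m IHm] h0 s0 H0 cm.
    do 3!eexists; split; [apply: ExecWhileStop|exact: H0|exact: preserves0|by []].
    by rewrite /= (rep_Z H0) -cm addn0 ltnn.
  have [s1 [t1 [q1 [E1 H1 p1 b1]]]] := IH n.+1 wc h0 s0 H0.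
  pose s2 := setn s1 (ctr n) (nmem s1 (ctr n)).+1.
  have E2 : exec oracle omega (Atom (NAdd (ctr n) (ctr n) 4)) s1 s2 1 false.
    have -> : s2 = istep oracle omega (NAdd (ctr n) (ctr n) 4) s1.
      by rewrite /s2 /= (rep_one H1) addn1.
    exact: ExecAtom.
  have H2 : represents (leval c h0) s2.
    by apply: represents_scratch => //; rewrite /ctr; lia.
  have [|s3 [t3 [q3 [E3 H3 p3 b3]]]] := IHm _ s2 H2.
    by rewrite /s2 /= updE eqxx p1 // addSnnS.
  do 3!eexists; split.
  - apply: ExecWhileStep; [|exact: ExecSeq E1 E2|exact: E3].
    by rewrite /= (rep_Z H0) -cm addnS ltnS leq_addr.
  - by rewrite iterSr.
  - apply: preserves_trans (preservesW p1) _; apply: preserves_trans p3 => k kn.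
    by rewrite /s2 /= updE ifN //; rewrite /ctr; lia.
  - by rewrite mulSn; move: (m * _) b3 b1 => ?; lia.
pose s1 := setn s (ctr n) 0.
have H1 : represents h s1 by apply: represents_scratch => //; rewrite /ctr; lia.
have [|s2 [t2 [q2 [E2 H2 p2 b2]]]] := loop Z h s1 H1; first by rewrite /= updE eqxx.
do 3!eexists; split.
- by apply: ExecSeq E2; apply: (ExecAtom _ _ (NConst _ _)).
- exact: H2.
- by apply: preserves_trans p2 => k kn /=; rewrite updE ifN //; rewrite /ctr; lia.
- by move: (Z * _) b2 => ?; lia.
Qed.

Fixpoint lsize (c : lcmd) : nat :=
  match c with
  | LI i => 12
  | LSeq c1 c2 => lsize c1 + lsize c2
  | LIf t c1 c2 => (lsize c1 + lsize c2).+1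
  | LLoop c => lsize c + 2
  end.

Fixpoint ldepth (c : lcmd) : nat :=
  match c with
  | LI i => 0
  | LSeq c1 c2 => maxn (ldepth c1) (ldepth c2)
  | LIf t c1 c2 => maxn (ldepth c1) (ldepth c2)
  | LLoop c => (ldepth c).+1
  end.

(** A polynomial in Z whose degree and coefficient depend on the program text only. *)
Lemma lcost_le c : lcost c <= lsize c * Z.+1 ^ ldepth c.
Proof.
have mono s a b : a <= s * Z.+1 ^ b -> forall m, b <= m -> a <= s * Z.+1 ^ m.
  by move=> H m bm; apply: leq_trans H _; rewrite leq_mul2l leq_pexp2l ?orbT.
elim: c => [i|c1 IH1 c2 IH2|t c1 IH1 c2 IH2|c IH] /=; first by rewrite expn0 muln1.
- by rewrite mulnDl leq_add // ?(mono _ _ _ IH1) ?(mono _ _ _ IH2) ?leq_maxl ?leq_maxr.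
- rewrite -add1n mulSn leq_add ?expn_gt0 // mulnDl.
  by rewrite leq_add // ?(mono _ _ _ IH1) ?(mono _ _ _ IH2) ?leq_maxl ?leq_maxr.
- rewrite expnS mulnCA; have := expn_gt0 Z.+1 (ldepth c); rewrite /=.
  move: (Z.+1 ^ _) IH => w IH w0; apply: (@leq_trans (Z.+1 * (lcost c + 2))); first lia.
  by rewrite leq_mul2l /= mulnDl leq_add // leq_pmulr.
Qed.

End ListMachine.

(** * The search *)

Section EdgeOrder.
Variables (R : realType) (G : wgraph R).
Local Notation E := (edges G).
Implicit Types (f g : {set G}).

(** The tie-break must be symmetric in the two ends and computable by addition and truncated
    subtraction. The sum and the distance of two ids determine the unordered pair; [id_diff] is that
    distance, one of the two differences being 0. *)
Definition id_sum f := \sum_(x in f) vid x.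
Definition id_diff f := \sum_(x in f) \sum_(y in f) (vid x - vid y).

Definition edge_lt f g :=
  (wt f < wt g)%R || ~~ (wt g < wt f)%R &&
    ((id_sum f < id_sum g) || ~~ (id_sum g < id_sum f) && (id_diff f < id_diff g)).

(** Turns the order into the natural-number ranking used for T. The program only ever compares
    edges; [edge_rankE] links both views. *)
Definition edge_rank f := #|[set g in E | edge_lt g f]|.

Lemma sum_set2 (T : finType) (x y : T) (F : T -> nat) :
  x != y -> \sum_(z in [set x; y]) F z = F x + F y.
Proof. by move=> ne; rewrite big_setU1 ?inE // big_set1. Qed.

Lemma id_sum2 x y : x != y -> id_sum [set x; y] = vid x + vid y.
Proof. exact: sum_set2. Qed.

Lemma id_diff2 x y : x != y -> id_diff [set x; y] = (vid x - vid y) + (vid y - vid x).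
Proof. by move=> ne; rewrite /id_diff !sum_set2 // !subnn addn0. Qed.

Lemma edge_lt_irr f : edge_lt f f = false.
Proof. by rewrite /edge_lt Order.POrderTheory.ltxx !ltnn. Qed.

Lemma edge_lt_trans f g h : edge_lt f g -> edge_lt g h -> edge_lt f h.
Proof.
rewrite /edge_lt; case: (Order.TotalTheory.ltgtP (wt f) (wt g)) => [fg|//|e1] //=;
  case: (Order.TotalTheory.ltgtP (wt g) (wt h)) => [gh|//|e2] //=.
- by rewrite (Order.POrderTheory.lt_trans fg gh).
- by rewrite -e2 fg.
- by rewrite e1 gh.
- by rewrite e1 e2 Order.POrderTheory.ltxx /=; lia.
Qed.

Lemma edge_lt_total f g : f \in E -> g \in E -> f <> g -> edge_lt f g || edge_lt g f.
Proof.
move=> fE gE ne; apply: contrapT => /negP; rewrite negb_or => /andP[].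
rewrite /edge_lt; case: (Order.TotalTheory.ltgtP (wt f) (wt g)) => //= _.
have [a [b [ab ef]]] := edge_ends (@edges_card2 G) fE.
have [c [d [cd eg]]] := edge_ends (@edges_card2 G) gE.
move: ne; rewrite ef eg !id_sum2 // !id_diff2 // => ne n1 n2; case: ne.
have : (vid a = vid c /\ vid b = vid d) \/ (vid a = vid d /\ vid b = vid c) by lia.
by case=> -[/(@vid_inj _ G) -> /(@vid_inj _ G) ->]; rewrite // setUC.
Qed.

Lemma edge_rank_lt f g : f \in E -> edge_lt f g -> edge_rank f < edge_rank g.
Proof.
move=> fE fg; apply: proper_card; apply/properP; split.
  by apply/subsetP => h; rewrite !inE => /andP[-> /= hf]; apply: edge_lt_trans fg.
by exists f; rewrite !inE fE ?fg // edge_lt_irr.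
Qed.

Lemma edge_rankE f g : f \in E -> g \in E -> (edge_rank f < edge_rank g) = edge_lt f g.
Proof.
move=> fE gE; apply/idP/idP; last exact: edge_rank_lt.
move=> lt; apply: contrapT => /negP nfg; case: (pselect (f = g)) => [e|ne].
  by rewrite e ltnn in lt.
have := edge_lt_total fE gE ne; rewrite (negPf nfg) /= => /(edge_rank_lt gE).
by move/(ltn_trans lt); rewrite ltnn.
Qed.

Lemma edge_rank_inj : {in E &, injective edge_rank}.
Proof.
move=> f g fE gE e; apply: contrapT => ne.
have /orP[/(edge_rank_lt fE)|/(edge_rank_lt gE)] := edge_lt_total fE gE ne.
  by rewrite e ltnn.
by rewrite e ltnn.
Qed.

Lemma edge_rank_wt f g : f \in E -> g \in E ->
  edge_rank f < edge_rank g -> (wt f <= wt g)%R.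
Proof.
move=> fE gE; rewrite edge_rankE // /edge_lt.
by case: (Order.TotalTheory.ltgtP (wt f) (wt g)).
Qed.

End EdgeOrder.

(** Syntactic write sets: with them the frame conditions of concrete programs are decided by
    computation. *)
Definition wreg_instr (i : linstr) : seq nat :=
  match i with
  | IConst r _ | ICopy r _ | IAdd r _ _ | ISub r _ _ | IInc r | INth r _ _ => [:: r]
  | IQuery f b _ _ _ => [:: f; b]
  | _ => [::]
  end.

Definition wlist_instr (i : linstr) : seq nat :=
  match i with IPush j _ | IClear j => [:: j] | _ => [::] end.

Definition wreal_instr (i : linstr) : seq nat :=
  match i with IRCopy x _ | IQuery _ _ x _ _ => [:: x] | _ => [::] end.

Fixpoint written (w : linstr -> seq nat) (c : lcmd) : seq nat :=
  match c with
  | LI i => w i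
  | LSeq c1 c2 => written w c1 ++ written w c2
  | LIf t c1 c2 => written w c1 ++ written w c2
  | LLoop c => written w c
  end.

Notation wreg := (written wreg_instr).
Notation wlist := (written wlist_instr).
Notation wreal := (written wreal_instr).

Definition skip := LI ISkip.
Definition loopn m c := iter m LLoop c.

(* For x in the list j, which the body may extend. *)
Definition each m p j x body :=
  LSeq (LI (IConst p 0))
    (loopn m (LIf (LTIn p j) (LSeq (LI (INth x j p)) (LSeq body (LI (IInc p)))) skip)).

(* For each neighbour b, by an edge of weight w, of the vertex a. *)
Definition nbrs i f b w a body :=
  LSeq (LI (IConst i 0))
    (LLoop (LSeq (LI (IQuery f b w a i)) (LIf (LTPos f) (LSeq body (LI (IInc i))) skip))).

Definition if_eq a b c := LIf (LTLt a b) skip (LIf (LTLt b a) skip c).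

(* N[42] := whether N[b] is in the list j. *)
Definition member m j b :=
  LSeq (LI (ICopy 43 b)) (LSeq (LI (IConst 42 0))
    (each m 40 j 41 (if_eq 41 43 (LI (IConst 42 1))))).

(* N[49] := whether the edge (a, b) of weight w precedes (a', b') of weight w'. *)
Definition less a b w a' b' w' :=
  LSeq (LI (IAdd 44 a b)) (LSeq (LI (IAdd 45 a' b'))
  (LSeq (LI (ISub 46 a b)) (LSeq (LI (ISub 48 b a)) (LSeq (LI (IAdd 46 46 48))
  (LSeq (LI (ISub 47 a' b')) (LSeq (LI (ISub 48 b' a')) (LSeq (LI (IAdd 47 47 48))
  (LSeq (LI (IConst 49 0))
    (LIf (LTRLt w w') (LI (IConst 49 1)) (LIf (LTRLt w' w) skip
    (LIf (LTLt 44 45) (LI (IConst 49 1)) (LIf (LTLt 45 44) skip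
    (LIf (LTLt 46 47) (LI (IConst 49 1)) skip))))))))))))).

(** * Proof rules for list programs *)

Section Rules.
Variables (R : realType) (G : wgraph R) (Z : nat).
Hypothesis degZ : forall u : G, size (inc u) <= Z.

Local Notation lstate := (lstate R).
Local Notation eval := (leval (ask G) Z).
Implicit Types (h g : lstate).

Lemma hn_frame c h r : r \notin wreg c -> hn (eval c h) r = hn h r.
Proof.
elim: c h => [i|c1 IH1 c2 IH2|t c1 IH1 c2 IH2|c IH] h /=.
- case: i => //=; rewrite ?inE.
  + by move=> r' k; rewrite inE updE => /negPf ->.
  + by move=> r' k; rewrite inE updE => /negPf ->.
  + by move=> r' a b; rewrite inE updE => /negPf ->.
  + by move=> r' a b; rewrite inE updE => /negPf ->.
  + by move=> r'; rewrite inE updE => /negPf ->.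
  + move=> f b x a i; rewrite !inE negb_or => /andP[/negPf rf /negPf rb].
    by case: (ask _ _ _) => [[k y]|] /=; rewrite !updE ?rb rf.
  + by move=> r' j p; rewrite inE updE => /negPf ->.
- by rewrite mem_cat negb_or => /andP[r1 r2]; rewrite IH2 // IH1.
- by rewrite mem_cat negb_or => /andP[r1 r2]; case: ifP => _; rewrite ?IH1 ?IH2.
- by move=> rc; elim: {1}Z h => //= n IHn h; rewrite IH.
Qed.

Lemma hl_frame c h j : j \notin wlist c -> hl (eval c h) j = hl h j.
Proof.
elim: c h => [i|c1 IH1 c2 IH2|t c1 IH1 c2 IH2|c IH] h /=.
- case: i => //=.
  + by move=> f b x a i; case: (ask _ _ _) => [[k y]|].
  + by move=> j' r; rewrite inE updE => /negPf ->.
  + by move=> j'; rewrite inE updE => /negPf ->.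
- by rewrite mem_cat negb_or => /andP[r1 r2]; rewrite IH2 // IH1.
- by rewrite mem_cat negb_or => /andP[r1 r2]; case: ifP => _; rewrite ?IH1 ?IH2.
- by move=> rc; elim: {1}Z h => //= n IHn h; rewrite IH.
Qed.

Lemma hx_frame c h x : x \notin wreal c -> hx (eval c h) x = hx h x.
Proof.
elim: c h => [i|c1 IH1 c2 IH2|t c1 IH1 c2 IH2|c IH] h /=.
- case: i => //=.
  + by move=> x' y; rewrite inE updE => /negPf ->.
  + by move=> f b x' a i; rewrite inE; case: (ask _ _ _) => [[k y]|] //= /negPf xx; rewrite updE xx.
- by rewrite mem_cat negb_or => /andP[r1 r2]; rewrite IH2 // IH1.
- by rewrite mem_cat negb_or => /andP[r1 r2]; case: ifP => _; rewrite ?IH1 ?IH2.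
- by move=> rc; elim: {1}Z h => //= n IHn h; rewrite IH.
Qed.

Lemma eval_loopn m c h : eval (loopn m c) h = iter (Z ^ m) (eval c) h.
Proof.
elim: m h => [|m IH] h //=; rewrite expnS.
by rewrite (eq_iter (f' := iter (Z ^ m) (eval c))) // iterM.
Qed.

Lemma iter_inv (T : Type) (f : T -> T) (I : nat -> T -> Prop) n x :
  I 0 x -> (forall k y, k < n -> I k y -> I k.+1 (f y)) -> I n (iter n f x).
Proof.
move=> I0 IS; suff H k : k <= n -> I k (iter k f x) by apply: H.
by elim: k => //= k IH kn; apply: IS => //; apply: IH; apply: ltnW.
Qed.

(** As the body may extend the list, the loop can stop for two reasons: the budget of [Z ^ m] rounds
    is spent, or the queue is exhausted. Callers rule out the first by a bound on the list, or
    accept truncation. *)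
Lemma each_queue m p j x body h (I : nat -> lstate -> Prop) :
  p \notin wreg body -> p != x -> I 0 (lsetn h p 0) ->
  (forall k g, hn g p = k -> k < size (hl g j) -> I k g ->
     I k.+1 (lsetn (eval body (lsetn g x (nth 0 (hl g j) k))) p k.+1)) ->
  exists k, [/\ I k (eval (each m p j x body) h), k <= Z ^ m &
    k = Z ^ m \/ size (hl (eval (each m p j x body) h) j) <= k].
Proof.
move=> pb px I0 IS; rewrite [eval _ _]/= eval_loopn.
pose J t g := exists k, [/\ I k g, hn g p = k, k <= t & k = t \/ size (hl g j) <= k].
have : J (Z ^ m) (iter (Z ^ m) (eval (LIf (LTIn p j) (LSeq (LI (INth x j p))
    (LSeq body (LI (IInc p)))) skip)) (lsetn h p 0)).
  apply: iter_inv => [|t g _ [k [Ik pk kt kend]]].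
    by exists 0; split=> //=; [rewrite updE eqxx|left].
  rewrite /= pk; case: ltnP => kj; last first.
    by exists k; split=> //; [apply: leqW|right].
  have {kend} kt' : k = t by case: kend => // /(leq_trans kj); rewrite ltnn.
  have e : hn (eval body (lsetn g x (nth 0 (hl g j) k))) p = k.
    by rewrite hn_frame //= updE (negPf px).
  exists k.+1; split; last by left; rewrite kt'.
  - by rewrite e; apply: IS.
  - by rewrite /= updE eqxx e.
  - by rewrite kt'.
by case=> k [Ik _ kt kend]; exists k.
Qed.

Lemma each_list m p j x body h (L : seq nat) (I : nat -> lstate -> Prop) :
  p \notin wreg body -> p != x -> j \notin wlist body -> hl h j = L ->
  size L <= Z ^ m -> I 0 (lsetn h p 0) ->
  (forall k g, hn g p = k -> hl g j = L -> k < size L -> I k g ->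
     I k.+1 (lsetn (eval body (lsetn g x (nth 0 L k))) p k.+1)) ->
  I (size L) (eval (each m p j x body) h).
Proof.
move=> pb px jb hL sL I0 IS.
pose J k g := [/\ I k g, hl g j = L & k <= size L].
have [||k [[Ik kL kl] km kend]] := @each_queue m p j x body h J pb px.
- by split.
- move=> k g pk kj [Ik gL kl]; rewrite gL in kj *; split=> //=; first exact: IS.
  by rewrite hl_frame.
rewrite kL in kend; suff -> : size L = k by [].
by apply/eqP; rewrite eqn_leq kl andbT; case: kend => // ->.
Qed.

Lemma askE (u : G) i : ask G (vid u) i =
  if i < size (inc u) then Some (vid (nth u (inc u) i), wt [set u; nth u (inc u) i]) else None.
Proof.
rewrite /ask; case: pickP => [v /eqP/(@vid_inj _ G) -> //|/(_ u)]; by rewrite eqxx.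
Qed.

(** The loop always runs Z times. Beyond the degree of u the query fails and merely resets [N[f]],
    which the last premise allows for. *)
Lemma nbrsP i f b w a body h (u : G) (I : nat -> lstate -> Prop) :
  a \notin wreg body -> i \notin wreg body -> uniq [:: a; i; f; b] ->
  hn h a = vid u -> I 0 (lsetn h i 0) ->
  (forall k g v, k < size (inc u) -> v = nth u (inc u) k -> hn g a = vid u -> hn g i = k ->
     I k g ->
     I k.+1 (lsetn (eval body
       (lsetx (lsetn (lsetn g f 1) b (vid v)) w (wt [set u; v]))) i k.+1)) ->
  (forall g, I (size (inc u)) g -> I (size (inc u)) (lsetn g f 0)) ->
  I (size (inc u)) (eval (nbrs i f b w a body) h).
Proof.
move=> ab ib /=; rewrite !inE !negb_or => /and4P[/and3P[ai af_ ab_] /andP[if_ ib_] fb _].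
move=> ha I0 IS Iskip; set n := size (inc u).
pose J t g := [/\ I (minn t n) g, hn g i = minn t n & hn g a = vid u].
suff [] : J Z (iter Z (eval (LSeq (LI (IQuery f b w a i))
    (LIf (LTPos f) (LSeq body (LI (IInc i))) skip))) (lsetn h i 0)).
  by rewrite (minn_idPr (degZ u)).
apply: iter_inv => [|t g _ [It it at_]].
  by rewrite /J min0n /= !updE eqxx (negPf ai).
rewrite /= at_ askE; case: (ltnP t n) => tn; last first.
  have mn : minn t n = n by apply/minn_idPr.
  have mn' : minn t.+1 n = n by apply/minn_idPr/leqW.
  rewrite mn in it It; rewrite it ltnn /= updE eqxx /= /J mn'; split=> /=.
  - exact: Iskip.
  - by rewrite updE (negPf if_) it.
  - by rewrite updE (negPf af_).
have mt : minn t n = t by apply/minn_idPl/ltnW.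
have mt' : minn t.+1 n = t.+1 by apply/minn_idPl.
rewrite it mt tn /= !updE (negPf fb) eqxx /= /J mt'.
set g1 := lsetx _ _ _.
have e : hn (eval body g1) i = t.
  by rewrite hn_frame //= !updE (negPf ib_) (negPf if_) it mt.
split=> /=.
- by rewrite e; apply: IS => //; rewrite -mt.
- by rewrite updE eqxx e.
- by rewrite updE (negPf ai) hn_frame //= !updE (negPf ab_) (negPf af_).
Qed.

Lemma memberP m j b h : size (hl h j) <= Z ^ m ->
  hn (eval (member m j b) h) 42 = (hn h b \in hl h j).
Proof.
move=> sz; set L := hl h j.
pose I k (g : lstate) := hn g 42 = (hn h b \in take k L) /\ hn g 43 = hn h b.
have [|k g gp gL kL [I1 I2]|+ _] := @each_list m 40 j 41 (if_eq 41 43 (LI (IConst 42 1)))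
  (lsetn (lsetn h 43 (hn h b)) 42 0) L I isT isT isT erefl sz.
- by split; rewrite ?take0.
- rewrite /I (take_nth 0) // mem_rcons inE; rewrite /= !updE /=.
  case: ltngtP => /= e; rewrite /= !updE /= ?I1 ?I2; split=> //.
  + by rewrite -I2 eq_sym (ltn_eqF e).
  + by rewrite -I2 (ltn_eqF e).
  + by rewrite -I2 -e eqxx.
by rewrite take_size.
Qed.

Lemma lessP a b w a' b' w' h (u v u' v' : G) :
  u != v -> u' != v' ->
  [&& a < 44, b < 44, a' < 44 & b' < 44] ->
  hn h a = vid u -> hn h b = vid v -> hn h a' = vid u' -> hn h b' = vid v' ->
  hx h w = wt [set u; v] -> hx h w' = wt [set u'; v'] ->
  hn (eval (less a b w a' b' w') h) 49 = edge_lt [set u; v] [set u'; v'].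
Proof.
move=> uv uv' /and4P[la lb la' lb'] ha hb ha' hb' hw hw'.
have ne k c : 44 <= k -> c < 44 -> (c == k) = false.
  by move=> k44 c44; apply/eqP => e; rewrite e ltnNge k44 in c44.
rewrite /edge_lt !id_sum2 // !id_diff2 // /less.
pose inputs g := [/\ hn g a = vid u, hn g b = vid v, hn g a' = vid u', hn g b' = vid v' &
  hx g w = wt [set u; v] /\ hx g w' = wt [set u'; v']].
have Hin g r k : inputs g -> 44 <= r -> inputs (lsetn g r k).
  case=> Ha Hb Ha' Hb' Hw r44.
  by split; rewrite //= updE !(ne _ _ r44).
have seqE i c g : eval (LSeq (LI i) c) g = eval c (leval_instr (ask G) i g) by [].
(* Symbolic execution: l lists the registers whose values are known, and each [step] updates it, so
   the state never unfolds into a tower of updates. *)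
pose V (l : seq (nat * nat)) g := inputs g /\ forall p, p \in l -> hn g p.1 = p.2.
have Vset l g r k : V l g -> 44 <= r ->
    V ((r, k) :: [seq p <- l | p.1 != r]) (lsetn g r k).
  case=> Hg Hl r44; split; first exact: Hin.
  move=> p; rewrite inE mem_filter /= updE => /orP[/eqP -> /=|/andP[/negPf -> /Hl //]].
  by rewrite eqxx.
have step l g r k i c P : leval_instr (ask G) i g = lsetn g r k -> 44 <= r -> V l g ->
    (forall g', V ((r, k) :: [seq p <- l | p.1 != r]) g' -> P (eval c g')) ->
    P (eval (LSeq (LI i) c) g).
  by move=> e r44 Vg; apply; rewrite /= e; apply: Vset.
have V0 : V [::] h by split.
set rhs := (X in _ = nat_of_bool X); pose P g := hn g 49 = rhs.
apply: (step _ _ 44 (vid u + vid v) _ _ P _ _ V0) => [|//|g1 V1]; first by rewrite /= ha hb.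
have [[Ha Hb Ha' Hb' _] _] := V1.
apply: (step _ _ 45 (vid u' + vid v') _ _ P _ _ V1) => [|//|g2 V2]; first by rewrite /= Ha' Hb'.
have [[{}Ha {}Hb {}Ha' {}Hb' _] _] := V2.
apply: (step _ _ 46 (vid u - vid v) _ _ P _ _ V2) => [|//|g3 V3]; first by rewrite /= Ha Hb.
have [[{}Ha {}Hb {}Ha' {}Hb' _] _] := V3.
apply: (step _ _ 48 (vid v - vid u) _ _ P _ _ V3) => [|//|g4 V4]; first by rewrite /= Ha Hb.
have [[{}Ha {}Hb {}Ha' {}Hb' _] W] := V4.
apply: (step _ _ 46 (vid u - vid v + (vid v - vid u)) _ _ P _ _ V4) => [|//|g5 V5].
  have /= e := W (46, vid u - vid v); have /= e' := W (48, vid v - vid u).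
  by rewrite /= e ?e' // !inE !eqxx ?orbT.
have [[{}Ha {}Hb {}Ha' {}Hb' _] _] := V5.
apply: (step _ _ 47 (vid u' - vid v') _ _ P _ _ V5) => [|//|g6 V6]; first by rewrite /= Ha' Hb'.
have [[{}Ha {}Hb {}Ha' {}Hb' _] _] := V6.
apply: (step _ _ 48 (vid v' - vid u') _ _ P _ _ V6) => [|//|g7 V7]; first by rewrite /= Ha' Hb'.
have [[{}Ha {}Hb {}Ha' {}Hb' _] {}W] := V7.
apply: (step _ _ 47 (vid u' - vid v' + (vid v' - vid u')) _ _ P _ _ V7) => [|//|g8 V8].
  have /= e := W (47, vid u' - vid v'); have /= e' := W (48, vid v' - vid u').
  by rewrite /= e ?e' // !inE !eqxx ?orbT.
apply: (step _ _ 49 0 _ _ P _ _ V8) => [//|//|g9 [[_ _ _ _ [Hw Hw']] {}W]].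
have W44 := W (44, vid u + vid v); have W45 := W (45, vid u' + vid v').
have W46 := W (46, vid u - vid v + (vid v - vid u)).
have W47 := W (47, vid u' - vid v' + (vid v' - vid u')).
have W49 := W (49, 0).
rewrite /= in W44 W45 W46 W47 W49.
rewrite !inE !eqxx ?orbT in W44 W45 W46 W47 W49.
have one g : hn (lsetn g 49 1) 49 = 1 by [].
rewrite /P /rhs /= Hw Hw' W44 // W45 // W46 // W47 //.
case: ifP => [_|_]; first by rewrite one.
case: ifP => [_|_]; first by rewrite /= W49.
case: ifP => [_|_]; first by rewrite one.
case: ifP => [_|_]; first by rewrite /= W49.
by case: ifP => _; rewrite ?one //= W49.
Qed.

End Rules.

(** * The search program *)

Definition prim_update :=
  LSeq (LI (ICopy 36 32)) (LSeq (LI (ICopy 37 35)) (LSeq (LI (IRCopy 4 3)) (LI (IConst 38 1)))).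

(* Keeps the lightest edge leaving the list 0 in N[36], N[37], X[4]; N[38] tells
   whether there is one. *)
Definition prim_candidate :=
  LSeq (member 2 0 35) (LIf (LTPos 42) skip
    (LIf (LTPos 38) (LSeq (less 32 35 3 36 37 4) (LIf (LTPos 49) prim_update skip)) prim_update)).

Definition prim_step :=
  LSeq (LI (IConst 38 0)) (LSeq (each 2 31 0 32 (nbrs 33 34 35 3 32 prim_candidate))
    (LIf (LTPos 38) (LI (IPush 0 37)) skip)).

(* list 0 := the exploration from the vertex N[30]. *)
Definition prim_cmd :=
  LSeq (LI (IClear 0)) (LSeq (LI (IPush 0 30)) (LLoop prim_step)).

Definition bfs_candidate :=
  LSeq (member 2 1 25) (LIf (LTPos 42) skip
    (LSeq (LI (ICopy 30 25)) (LSeq prim_cmd (LSeq (member 2 0 20)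
      (LIf (LTPos 42) (LI (IPush 1 25)) skip))))).

(* list 1 := vertices whose exploration meets N[20], found by a search from N[20]. *)
Definition bfs_cmd :=
  LSeq (LI (IClear 1)) (LSeq (LI (IPush 1 20))
    (each 2 21 1 22 (nbrs 23 24 25 5 22 bfs_candidate))).

Definition explore r := LSeq (LI (ICopy 30 r)) (LSeq prim_cmd (each 2 10 0 11 (LI (IPush 3 11)))).

(** List 3 holds P(u) followed by P(v), and list 2 accumulates S. At most [Z ^ 2] entries are copied
    for each of at most [Z ^ 2] vertices, whence the exponent 4 in the loops over S. *)
Definition collect :=
  LSeq (LI (IClear 3)) (LSeq (explore 0) (LSeq (explore 1) (LSeq (LI (IClear 2))
    (each 2 10 3 20 (LSeq bfs_cmd (each 2 12 1 13 (LI (IPush 2 13)))))))).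

(** Weights are revealed only together with a neighbour, so the weight of the queried edge is found
    by scanning the neighbours of one end. *)
Definition get_weight := nbrs 14 15 16 7 0 (if_eq 16 1 (LI (IRCopy 6 7))).

Definition reach_candidate :=
  LSeq (member 4 1 25) (LIf (LTPos 42) skip
    (LSeq (member 4 2 25) (LIf (LTPos 42)
      (LSeq (less 22 25 5 0 1 6) (LIf (LTPos 49) (LI (IPush 1 25)) skip)) skip))).

Definition reach_cmd :=
  LSeq (LI (IClear 1)) (LSeq (LI (IPush 1 0))
    (each 4 21 1 22 (nbrs 23 24 25 5 22 reach_candidate))).

Definition edge_cmd :=
  LSeq collect (LSeq get_weight (LSeq reach_cmd (LSeq (member 4 1 1)
    (LSeq (LI (IConst 0 1)) (LI (ISub 0 0 42)))))).

(** If Prim's algorithm from x meets y, then by [prim_nested] so does the one from every vertex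
    explored before y, and no later. That exploration is thus a connected part of the inflow joining
    x to y. *)
Lemma inflow_conn (V : finType) (E : {set {set V}}) (rk : {set V} -> nat) k x y :
  {in E &, injective rk} -> spanning_connected E -> x \in inflow E rk k y ->
  conn (within E (inflow E rk k y)) y x.
Proof.
move=> rk_inj cE; rewrite inE => yP.
case: (eqVneq y x) => [->|ne]; first exact: conn0.
have [i [ik nc]] : exists i, i < k /\ isnext E rk (prim E rk i x) y.
  elim: k yP => [|k IH]; first by rewrite inE (negPf ne).
  case: (boolP (y \in prim E rk k x)) => [/IH[i [ik nc]] _|yk].
    by exists i; split=> //; apply: ltnW.
  rewrite primS /grow; case: pickP => [b nb|_]; last by rewrite (negPf yk).
  by rewrite in_setU1 (negPf yk) orbF => /eqP ->; exists k.
have sub : prim E rk i.+1 x \subset inflow E rk k y.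
  rewrite primS (grow_next rk_inj nc); apply/subsetP => z; rewrite in_setU1.
  case/orP=> [/eqP ->|zB]; first by rewrite inE prim_refl.
  have [j [ji jB jc]] := prim_nested rk_inj cE nc zB.
  rewrite inE; apply: (subsetP (prim_sub E rk z (leq_ltn_trans ji ik))).
  by rewrite primS (grow_next rk_inj jc) setU11.
rewrite conn_sym; apply: connS (withinSS (kruskal_sub E rk) sub) _.
apply: prim_conn => //; by rewrite primS (grow_next rk_inj nc) setU11.
Qed.

Lemma leq_square_of_leqS Z n : 4 <= Z -> n <= Z.+1 -> n <= Z ^ 2.
Proof. by move=> Z4 nZ; apply: leq_trans nZ _; rewrite expnS expn1; nia. Qed.

#[local] Arguments leval : simpl never.

(** * Correctness of the search *)

Section Specs.
Variables (R : realType) (G : wgraph R) (Z : nat).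
Hypothesis degZ : forall u : G, size (inc u) <= Z.
Hypothesis Z4 : 4 <= Z.

Local Notation lstate := (lstate R).
Local Notation eval := (leval (ask G) Z).
Local Notation E := (edges G).
Local Notation rk := (@edge_rank R G).
Local Notation ids := (map (@vid R G)).
Implicit Types (h g : lstate) (u v x y z : G) (L S : seq G).

Let rk_inj := @edge_rank_inj R G.
Let cG := graph_connected G.

Lemma mem_ids u L : (vid u \in ids L) = (u \in L).
Proof. by rewrite mem_map //; apply: vid_inj. Qed.

Lemma nth_ids y k L : k < size L -> nth 0 (ids L) k = vid (nth y L k).
Proof. by move=> kL; rewrite (nth_map y). Qed.

Lemma member_ids m j b h u L : hn h b = vid u -> hl h j = ids L -> size L <= Z ^ m ->
  hn (eval (member m j b) h) 42 = (u \in L).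
Proof. by move=> hb hL sL; rewrite memberP hL ?size_map // hb mem_ids. Qed.

Lemma evalI i h : eval (LI i) h = leval_instr (ask G) i h. Proof. by []. Qed.

Lemma evalS c1 c2 h : eval (LSeq c1 c2) h = eval c2 (eval c1 h). Proof. by []. Qed.

Lemma evalIf t c1 c2 h :
  eval (LIf t c1 c2) h = if leval_test t h then eval c1 h else eval c2 h.
Proof. by []. Qed.

Lemma eval_skip h : eval skip h = h. Proof. by []. Qed.

Lemma if_eqE (a b : nat) c h :
  eval (if_eq a b c) h = if hn h a == hn h b then eval c h else h.
Proof. by rewrite /if_eq !evalIf /=; case: ltngtP. Qed.

Lemma copyP (m p j x j' : nat) h : p != x -> j != j' ->
  hl (eval (each m p j x (LI (IPush j' x))) h) j' = hl h j' ++ take (Z ^ m) (hl h j).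
Proof.
move=> px jj; set L := hl h j.
pose I k g := hl g j = L /\ hl g j' = hl h j' ++ take k L.
have [||k [[Ij Ij'] km kend]] := @each_queue R G Z m p j x (LI (IPush j' x)) h I isT px.
- by rewrite /I take0 cats0.
- move=> k g gp kL [gj gj']; rewrite gj in kL *; split=> /=; rewrite !updE ?eqxx.
    by rewrite (negPf jj).
  by rewrite gj' (take_nth 0) // -rcons_cat.
rewrite Ij'; congr cat; case: kend => [-> //|]; rewrite Ij => sk.
by rewrite !take_oversize // (leq_trans sk).
Qed.

(** C describes the pairs scanned so far, so that one invariant serves both the loop over explored
    vertices and the loop over their neighbours. *)
Definition best (X : {set G}) (C : G -> G -> Prop) g :=
  (hn g 38 = 0 /\ forall a b, C a b -> ~~ leaves E X a b) \/
  (hn g 38 = 1 /\ exists a b, [/\ hn g 36 = vid a, hn g 37 = vid b, hx g 4 = wt [set a; b],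
     leaves E X a b & forall a' b', C a' b' -> leaves E X a' b' -> rk [set a; b] <= rk [set a'; b']]).

Lemma prim_candidateP L C g a b :
  hn g 32 = vid a -> hn g 35 = vid b -> hx g 3 = wt [set a; b] -> a \in L ->
  [set a; b] \in E -> hl g 0 = ids L -> size L <= Z ^ 2 -> best [set x in L] C g ->
  best [set x in L] (fun x y => C x y \/ (x = a /\ y = b)) (eval prim_candidate g).
Proof.
move=> ga gb gx aL abE gL sL.
have ab := edge_neq (@edges_card2 G) abE.
rewrite /prim_candidate evalS.
have := member_ids gb gL sL.
have : hn (eval (member 2 0 35) g) 32 = hn g 32 by rewrite hn_frame.
have : hn (eval (member 2 0 35) g) 35 = hn g 35 by rewrite hn_frame.
have : hn (eval (member 2 0 35) g) 36 = hn g 36 by rewrite hn_frame.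
have : hn (eval (member 2 0 35) g) 37 = hn g 37 by rewrite hn_frame.
have : hn (eval (member 2 0 35) g) 38 = hn g 38 by rewrite hn_frame.
have : hx (eval (member 2 0 35) g) 3 = hx g 3 by rewrite hx_frame.
have : hx (eval (member 2 0 35) g) 4 = hx g 4 by rewrite hx_frame.
move: (eval (member 2 0 35) g) => g1 e4 e3 e38 e37 e36 e35 e32 e42.
rewrite /best -e38 -e37 -e36 -e4 => Hb.
rewrite evalIf /= e42 lt0b; case: ifP => bL.
  have nl : ~~ leaves E [set x in L] a b by rewrite /leaves !inE bL andbF.
  rewrite eval_skip; case: Hb => [[f0 H]|[f1 [c [d [H1 H2 H3 H4 H5]]]]]; [left|right].
    by split=> // x y [/H //|[-> ->]].
  split=> //; exists c, d; split=> // x y [/H5 //|[-> ->]]; by rewrite (negPf nl).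
have lab : leaves E [set x in L] a b by rewrite /leaves !inE aL bL.
have upd_state g2 : [/\ hn (eval prim_update g2) 36 = hn g2 32,
    hn (eval prim_update g2) 37 = hn g2 35, hx (eval prim_update g2) 4 = hx g2 3 &
    hn (eval prim_update g2) 38 = 1] by [].
case: Hb => [[f0 H]|[f1 [c [d [H1 H2 H3 H4 H5]]]]].
  rewrite evalIf /= f0 ltnn; have [u36 u37 u4 u38] := upd_state g1.
  right; split; first exact: u38.
  exists a, b; rewrite u36 u37 u4 e32 e35 e3.
  by split=> // x y [/H/negPf -> //|[-> ->]].
rewrite evalIf /= f1 evalS evalIf.
have cdE : [set c; d] \in E by have /and3P[] := H4.
have cd := edge_neq (@edges_card2 G) cdE.
have := lessP Z ab cd (isT : [&& 32 < 44, 35 < 44, 36 < 44 & 37 < 44])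
  (etrans e32 ga) (etrans e35 gb) H1 H2 (etrans e3 gx) H3.
have : hn (eval (less 32 35 3 36 37 4) g1) 32 = hn g1 32 by rewrite hn_frame.
have : hn (eval (less 32 35 3 36 37 4) g1) 35 = hn g1 35 by rewrite hn_frame.
have : hn (eval (less 32 35 3 36 37 4) g1) 36 = hn g1 36 by rewrite hn_frame.
have : hn (eval (less 32 35 3 36 37 4) g1) 37 = hn g1 37 by rewrite hn_frame.
have : hn (eval (less 32 35 3 36 37 4) g1) 38 = hn g1 38 by rewrite hn_frame.
have : hx (eval (less 32 35 3 36 37 4) g1) 3 = hx g1 3 by rewrite hx_frame.
have : hx (eval (less 32 35 3 36 37 4) g1) 4 = hx g1 4 by rewrite hx_frame.
move: (eval (less _ _ _ _ _ _) g1) => g2 d4 d3 d38 d37 d36 d35 d32 e49.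
rewrite [leval_test _ _]/= e49 lt0b -edge_rankE //; right.
case: (ltnP (rk [set a; b]) (rk [set c; d])) => lt.
  have [u36 u37 u4 u38] := upd_state g2.
  split; first exact: u38.
  exists a, b; rewrite u36 u37 u4 d32 d35 d3 e32 e35 e3.
  split=> // x y [C'|[-> ->]] lxy //; exact: leq_trans (ltnW lt) (H5 _ _ C' lxy).
rewrite eval_skip d38; split=> //; exists c, d; rewrite d36 d37 d4; split=> //.
by move=> x y [/H5 //|[-> ->]].
Qed.

Lemma prim_scan h L :
  hl h 0 = ids L -> size L <= Z ^ 2 -> hn h 38 = 0 ->
  best [set x in L] (fun x y => x \in L /\ y \in inc x)
    (eval (each 2 31 0 32 (nbrs 33 34 35 3 32 prim_candidate)) h).
Proof.
move=> hL sL h38; set X := [set x in L].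
pose I k g := best X (fun x y => x \in take k L /\ y \in inc x) g.
have := @each_list R G Z 2 31 0 32 (nbrs 33 34 35 3 32 prim_candidate) h (ids L) I
  isT isT isT hL.
rewrite size_map => /(_ sL); rewrite /I take_size; apply.
  by left; split=> // a b []; rewrite take0.
move=> k g _ gL kL Ik.
have [a0 _] : exists a0 : G, true by case: (L) kL => // a l _; exists a.
rewrite (nth_ids a0) //; set a := nth a0 L k.
have aL : a \in L by apply: mem_nth.
pose C m x y := (x \in take k L /\ y \in inc x) \/ (x = a /\ y \in take m (inc a)).
pose J m g := best X (C m) g /\ hl g 0 = ids L.
have [||||Jb _] := @nbrsP R G Z degZ 33 34 35 3 32 prim_candidate (lsetn g 32 (vid a)) a J
  isT isT isT.
- by [].
- split=> //; case: Ik => [[f0 H]|[f1 [c [d [H1 H2 H3 H4 H5]]]]]; [left|right].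
    by split=> // x y [/H //|[_]]; rewrite take0.
  by split=> //; exists c, d; split=> // x y [/H5 //|[_]]; rewrite take0.
- move=> m g' v mi ev ga _ [Jb gL'].
  set g1 := lsetx _ _ _.
  have vE : [set a; v] \in E by rewrite -mem_inc ev mem_nth.
  have Jb1 : best X (C m) g1 by [].
  have := @prim_candidateP L (C m) g1 a v ga erefl erefl aL vE gL' sL Jb1.
  move=> Hb; split; last by rewrite /= hl_frame.
  suff : best X (C m.+1) (eval prim_candidate g1) by [].
  have CE x y : C m.+1 x y -> C m x y \/ (x = a /\ y = v).
    rewrite /C (take_nth a0) // -?(set_nth_default a0) //.
    case=> [H|[-> ]]; first by left; left.
    rewrite mem_rcons inE => /orP[/eqP ->|H]; last by left; right.
    by right; rewrite ev (set_nth_default a).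
  case: Hb => [[f0 H]|[f1 [c [d [H1 H2 H3 H4 H5]]]]]; [left|right]; split=> //.
    by move=> x y /CE/H.
  by exists c, d; split=> // x y /CE/H5.
- by [].
move: Jb; rewrite /C take_size.
case=> [[f0 H]|[f1 [c [d [H1 H2 H3 H4 H5]]]]]; [left|right]; split=> //.
  move=> x y []; rewrite (take_nth a0) // mem_rcons inE => /orP[/eqP ->|xk] yx; apply: H.
    by right.
  by left.
exists c, d; split=> // x y []; rewrite (take_nth a0) // mem_rcons inE => /orP[/eqP ->|xk] yx;
  apply: H5; first by right.
by left.
Qed.

Lemma prim_cmdP h z : hn h 30 = vid z ->
  exists L, [/\ hl (eval prim_cmd h) 0 = ids L, L =i prim E rk Z z & size L <= Z.+1].
Proof.
move=> hz; rewrite /prim_cmd 2!evalS.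
pose I i g := exists L, [/\ hl g 0 = ids L, [set x in L] = prim E rk i z & size L <= i.+1].
have [||L [gL eL sL]] := @iter_inv _ (eval prim_step) I Z
    (eval (LI (IPush 0 30)) (eval (LI (IClear 0)) h)); last first.
- by exists L; split=> // x; rewrite -eL inE.
- move=> i g iZ [L [gL eL sL]].
  have sL2 : size L <= Z ^ 2 := leq_square_of_leqS Z4 (leq_trans sL (leqW iZ)).
  rewrite /prim_step 2!evalS; set g1 := eval (LI _) g.
  have gL1 : hl g1 0 = ids L by [].
  have := prim_scan gL1 sL2 erefl.
  have : hl (eval (each 2 31 0 32 (nbrs 33 34 35 3 32 prim_candidate)) g1) 0 = ids L.
    by rewrite hl_frame.
  move: (eval (each _ _ _ _ _) _) => g2 g2L [[f0 H]|[f1 [a [b [H1 H2 H3 H4 H5]]]]].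
    have t0 : leval_test (LTPos 38) g2 = false by rewrite /= f0.
    exists L; rewrite evalIf t0; split=> //; last exact: leqW.
    rewrite primS -eL /grow; case: pickP => // b /existsP[a /andP[lab _]].
    have /and3P[aL _ abE] := lab; have := H a b _; rewrite lab => /(_ _)/negP [] //.
    by split; [move: aL; rewrite inE|rewrite mem_inc].
  have t1 : leval_test (LTPos 38) g2 by rewrite /= f1.
  exists (rcons L b); rewrite evalIf t1; split.
  - by rewrite evalI /= updE /= g2L H2 map_rcons.
  - have nb : isnext E rk [set x in L] b.
      apply/existsP; exists a; apply/exitsP; split=> // c d lcd; apply: H5 (lcd).
      by have /and3P[cL _ cdE] := lcd; split; [move: cL; rewrite inE|rewrite mem_inc].
    rewrite primS -eL (grow_next rk_inj nb).
    by apply/setP => x; rewrite !inE mem_rcons inE.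
  - by rewrite size_rcons.
- exists [:: z]; split=> //; first by rewrite !evalI /= !updE /= hz.
  by apply/setP => x; rewrite !inE.
Qed.

(** Above the cap the search is truncated and nothing is promised except that y comes first, which
    keeps y in S even after the list is cut. *)
Lemma bfs_cmdP h y : hn h 20 = vid y ->
  exists L, [/\ hl (eval bfs_cmd h) 1 = ids L, exists L', L = y :: L' &
    #|inflow E rk Z y| <= Z ^ 2 -> {subset inflow E rk Z y <= L} /\ size L <= Z ^ 2].
Proof.
move=> hy; rewrite /bfs_cmd 2!evalS; set h1 := eval (LI (IPush _ _)) _.
set IN := inflow E rk Z y.
have yIN : y \in IN by rewrite inE prim_refl.
pose small := #|IN| <= Z ^ 2.
pose good L := uniq L /\ {subset L <= IN}.
have size_good L : small -> good L -> size L <= Z ^ 2.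
  move=> sm [uL sL]; apply: leq_trans sm; rewrite -(card_uniqP uL).
  by apply/subset_leq_card/subsetP.
pose closed k L := forall x, x \in take k L -> forall v, v \in inc x -> v \in IN -> v \in L.
pose I k g := hn g 20 = vid y /\ exists L, [/\ hl g 1 = ids L, exists L', L = y :: L' &
  small -> good L /\ closed k L].
have [||k [[_ [L [gL Ly HL]]] kZ kend]] :=
  @each_queue R G Z 2 21 1 22 (nbrs 23 24 25 5 22 bfs_candidate) h1 I isT isT.
- split=> //; exists [:: y]; split; last 1 first.
  + by move=> _; split=> //; split=> // x; rewrite inE => /eqP ->.
  + by rewrite /h1 !evalI /= !updE /= hy.
  + by exists [::].
- move=> k g gk kL [gy [L0 [gL Ly H0]]].
  have kL0 : k < size L0 by move: kL; rewrite gL size_map.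
  rewrite gL (nth_ids y) //; set x := nth y L0 k.
  pose J m g := hn g 20 = vid y /\ exists L2, hl g 1 = ids (L0 ++ L2) /\
    (small -> [/\ good (L0 ++ L2), closed k (L0 ++ L2) &
       forall v, v \in take m (inc x) -> v \in IN -> v \in L0 ++ L2]).
  have [||||J1 [L2 [gL2 HL2]]] := @nbrsP R G Z degZ 23 24 25 5 22 bfs_candidate
      (lsetn g 22 (vid x)) x J isT isT isT.
  + by [].
  + split=> //; exists [::]; rewrite cats0; split=> // sm.
    by have [g0 c0] := H0 sm; split=> // v; rewrite take0.
  + move=> m g' v mi ev gx _ [gy' [L2 [gL2 HL2]]].
    set g1 := lsetx _ _ _.
    have gL3 : hl g1 1 = ids (L0 ++ L2) by [].
    have gv : hn g1 25 = vid v by [].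
    have gy1 : hn g1 20 = vid y by [].
    have [L3 [gJ HJ]] : exists L3, hl (eval bfs_candidate g1) 1 = ids (L0 ++ L3) /\
        (small -> [/\ good (L0 ++ L3), {subset L0 ++ L2 <= L0 ++ L3} &
                      v \in IN -> v \in L0 ++ L3]).
      rewrite /bfs_candidate evalS.
      (* On a list longer than [Z ^ 2] the membership test reads only a prefix; its answer is
         trusted below the cap only. *)
      have Hm : small -> hn (eval (member 2 1 25) g1) 42 = (v \in L0 ++ L2).
        move=> sm; have [gd _ _] := HL2 sm.
        by apply: member_ids gv gL3 _; apply: size_good.
      have : hn (eval (member 2 1 25) g1) 20 = vid y by rewrite hn_frame.
      have : hn (eval (member 2 1 25) g1) 25 = vid v by rewrite hn_frame.
      have : hl (eval (member 2 1 25) g1) 1 = ids (L0 ++ L2) by rewrite hl_frame.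
      move: (eval (member 2 1 25) g1) Hm => g2 Hm g2L g2v g2y.
      rewrite evalIf; case: ifP => /= f42.
        rewrite eval_skip; exists L2; split=> // sm; have [gd _ _] := HL2 sm; split=> //.
        by move: f42; rewrite Hm // lt0b.
      rewrite 3!evalS; set g3 := eval (LI (ICopy 30 25)) g2.
      have [P [gP eP sP]] := @prim_cmdP g3 v g2v.
      have : hn (eval prim_cmd g3) 20 = vid y by rewrite hn_frame.
      have : hn (eval prim_cmd g3) 25 = vid v by rewrite hn_frame.
      have : hl (eval prim_cmd g3) 1 = ids (L0 ++ L2) by rewrite hl_frame.
      move: (eval prim_cmd g3) gP => g4 gP g4L g4v g4y.
      have := member_ids g4y gP (leq_square_of_leqS Z4 sP).
      have : hn (eval (member 2 0 20) g4) 25 = vid v by rewrite hn_frame.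
      have : hl (eval (member 2 0 20) g4) 1 = ids (L0 ++ L2) by rewrite hl_frame.
      move: (eval (member 2 0 20) g4) => g5 g5L g5v g5m.
      have yv : (y \in P) = (v \in IN) by rewrite eP inE.
      rewrite evalIf /= g5m lt0b yv; case: ifP => vIN; last first.
        rewrite eval_skip; exists L2; split=> // sm; have [gd _ _] := HL2 sm; split=> //.
      exists (rcons L2 v); rewrite evalI /= updE /= g5L g5v -rcons_cat map_rcons; split=> // sm.
      have [[ug sg] _ _] := HL2 sm; split.
      - split; first by rewrite rcons_uniq ug andbT; move: f42; rewrite Hm // lt0b => ->.
        by move=> w; rewrite mem_rcons inE => /orP[/eqP -> //|/sg].
      - by move=> w wL; rewrite mem_rcons inE wL orbT.
      - by rewrite mem_rcons inE eqxx.
    split; first by rewrite /= updE /= hn_frame.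
    exists L3; split=> // sm; have [gd sub vL] := HJ sm; have [_ cl Hi] := HL2 sm.
    split=> //.
    * move=> w; rewrite takel_cat ?(ltnW kL0) // => wk t tw tIN; apply: sub.
      by apply: (cl w) tw tIN; rewrite takel_cat ?(ltnW kL0).
    * move=> w; rewrite (take_nth x) // mem_rcons inE -ev => /orP[/eqP -> //|wi wIN].
      by apply: sub; apply: Hi.
  + by [].
  split=> //; exists (L0 ++ L2); split=> //.
    by have [L' ->] := Ly; exists (L' ++ L2).
  move=> sm; have [gd cl Hi] := HL2 sm; split=> // w.
  have -> : take k.+1 (L0 ++ L2) = rcons (take k (L0 ++ L2)) x.
    by rewrite !takel_cat ?(ltnW kL0) // (take_nth y).
  rewrite mem_rcons inE => /orP[/eqP -> t tx|]; last exact: cl.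
  by apply: Hi; rewrite take_size.
exists L; split=> // sm; have [gd cl] := HL sm; split; last exact: size_good.
(* L is duplicate-free inside the inflow, so below the cap the budget suffices to process every
   entry; L is then closed, and connectivity of the inflow finishes. *)
have Lk : size L <= k.
  by case: kend => [->|]; [apply: size_good|rewrite gL size_map].
move=> x xIN; have := inflow_conn rk_inj cG xIN.
apply: (connect_ind (P := fun x => x \in L)); first by have [L' ->] := Ly; rewrite inE eqxx.
move=> a b aL; rewrite /adj mem_within => /and3P[abE aIN bIN].
by apply: (cl a); rewrite ?take_oversize // mem_inc.
Qed.

Lemma exploreP (r : nat) u h L0 :
  hn h r = vid u -> hl h 3 = ids L0 ->
  exists L, [/\ hl (eval (explore r) h) 3 = ids (L0 ++ L), L =i prim E rk Z u &
                size L <= Z.+1].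
Proof.
move=> hr hL; rewrite /explore 2!evalS; set h1 := eval (LI _) h.
have [P [gP eP sP]] := @prim_cmdP h1 u hr.
exists P; split=> //; rewrite copyP // gP hl_frame //.
by rewrite [hl h1 3]hL take_oversize ?size_map ?map_cat // leq_square_of_leqS.
Qed.

Lemma collectP h u v : hn h 0 = vid u -> hn h 1 = vid v ->
  exists S, [/\ hl (eval collect h) 2 = ids S, size S <= Z ^ 4, u \in S, v \in S &
    forall y, y \in prim E rk Z u :|: prim E rk Z v -> #|inflow E rk Z y| <= Z ^ 2 ->
      {subset inflow E rk Z y <= S}].
Proof.
move=> h0 h1; rewrite /collect 4!evalS.
set g1 := eval (LI (IClear 3)) h.
have [Lu [g2L eu su]] := @exploreP 0 u g1 [::] h0 erefl.
have : hn (eval (explore 0) g1) 1 = vid v by rewrite hn_frame.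
move: (eval (explore 0) g1) g2L => g2 g2L g2v.
have [Lv [g3L ev sv]] := @exploreP 1 v g2 Lu g2v g2L.
move: (eval (explore 1) g2) g3L => g3 g3L.
set g4 := eval (LI (IClear 2)) g3.
set L := Lu ++ Lv in g3L.
have sL : size (ids L) <= Z ^ 2.
  by rewrite size_map size_cat expnS expn1; nia.
pose I k g := exists S, [/\ hl g 2 = ids S, size S <= k * Z ^ 2 &
  forall y, y \in take k L -> y \in S /\
    (#|inflow E rk Z y| <= Z ^ 2 -> {subset inflow E rk Z y <= S})].
have g4L : hl g4 3 = ids L by [].
have [||S [gS sS HS]] := @each_list R G Z 2 10 3 20
  (LSeq bfs_cmd (each 2 12 1 13 (LI (IPush 2 13)))) g4 (ids L) I isT isT isT g4L sL.
- by exists [::]; split=> // y; rewrite take0.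
- move=> k g gk gL kL [S [gS sS HS]].
  have kL' : k < size L by rewrite size_map in kL.
  rewrite (nth_ids u) //; set y := nth u L k; set g5 := lsetn g 20 (vid y).
  rewrite evalS; have [Q [gQ Qy HQ]] := @bfs_cmdP g5 y erefl.
  have gS' : hl (eval bfs_cmd g5) 2 = ids S by rewrite hl_frame.
  exists (S ++ take (Z ^ 2) Q); split.
  + by rewrite [hl (lsetn _ _ _) _]/= copyP // gS' gQ map_cat map_take.
  + rewrite size_cat mulSn addnC leq_add // size_take_min; exact: geq_minl.
  + move=> w; rewrite (take_nth u) // mem_rcons inE => /orP[/eqP ->|/HS[wS wI]]; last first.
      by split=> [|/wI sub x /sub]; rewrite mem_cat ?wS // => ->.
    have Z2 : 0 < Z ^ 2 by rewrite expn_gt0; lia.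
    split.
      have [Q' ->] := Qy; rewrite mem_cat; case: (Z ^ 2) Z2 => // n _.
      by rewrite /= inE eqxx orbT.
    move=> /HQ[sub sQ] x /sub xQ; rewrite mem_cat take_oversize //.
    by rewrite xQ orbT.
rewrite size_map take_size in sS HS.
have inL y : y \in prim E rk Z u :|: prim E rk Z v -> y \in L.
  by rewrite mem_cat eu ev inE.
exists S; split=> //.
- by apply: leq_trans sS _; rewrite (expnD Z 2 2) leq_mul2r -(size_map (@vid R G)) sL orbT.
- by have [] := HS u; rewrite ?inL // inE prim_refl.
- by have [] := HS v; rewrite ?inL // inE prim_refl orbT.
- by move=> y /inL/HS[].
Qed.

Lemma get_weightP h u v : hn h 0 = vid u -> hn h 1 = vid v -> [set u; v] \in E ->
  hx (eval get_weight h) 6 = wt [set u; v].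
Proof.
move=> h0 h1 uvE.
pose I k g := hn g 1 = vid v /\ (v \in take k (inc u) -> hx g 6 = wt [set u; v]).
have [|||_ H] := @nbrsP R G Z degZ 14 15 16 7 0 (if_eq 16 1 (LI (IRCopy 6 7))) h u I
  isT isT isT h0.
- by split=> //; rewrite take0.
- move=> k g w ki ew g0 _ [g1 H]; split; first by rewrite /= updE /= hn_frame.
  rewrite (take_nth u) // -ew mem_rcons inE if_eqE.
  set g' := lsetx _ _ _.
  have g'1 : hn g' 1 = vid v by [].
  have g'16 : hn g' 16 = vid w by [].
  rewrite g'1 g'16; case: (eqVneq (vid w) (vid v)) => [/(@vid_inj _ G) e|ne]; first by move=> _; rewrite -e.
  by case/orP=> [/eqP e|/H //]; rewrite e eqxx in ne.
- by [].
by apply: H; rewrite take_size mem_inc.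
Qed.

(** Never truncated: the list is duplicate-free and contained in S, which has at most [Z ^ 4]
    entries. *)
Lemma reach_cmdP h u v S :
  hn h 0 = vid u -> hn h 1 = vid v -> hx h 6 = wt [set u; v] -> [set u; v] \in E ->
  hl h 2 = ids S -> size S <= Z ^ 4 -> u \in S ->
  exists L, [/\ hl (eval reach_cmd h) 1 = ids L, size L <= Z ^ 4 &
    forall x, (x \in L) = conn (lighter rk (within E [set x in S]) [set u; v]) u x].
Proof.
move=> h0 h1 h6 uvE hS sS uS; have uv := edge_neq (@edges_card2 G) uvE.
set F := lighter _ _ _.
have FE x y : ([set x; y] \in F) =
    [&& [set x; y] \in E, x \in S, y \in S & rk [set x; y] < rk [set u; v]].
  by rewrite inE mem_within !inE -!andbA.
pose env g := [/\ hn g 0 = vid u, hn g 1 = vid v, hx g 6 = wt [set u; v] & hl g 2 = ids S].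
pose good L := [/\ uniq L, u \in L & forall x, x \in L -> x \in S /\ conn F u x].
have good_size L : good L -> size L <= Z ^ 4.
  move=> [uL _ H]; apply: leq_trans sS; apply: uniq_leq_size => // x /H[].
  by [].
pose closed k L := forall x, x \in take k L -> forall y, [set x; y] \in F -> y \in L.
pose I k g := env g /\ exists L, [/\ hl g 1 = ids L, good L & closed k L].
rewrite /reach_cmd 2!evalS; set g1 := eval (LI (IPush _ _)) _.
have [||k [[_ [L [gL gd cl]]] kZ kend]] :=
  @each_queue R G Z 4 21 1 22 (nbrs 23 24 25 5 22 reach_candidate) g1 I isT isT.
- split=> //; exists [:: u]; split=> //.
  + by rewrite /g1 !evalI /= !updE /= h0.
  + by split=> //; rewrite ?inE // => x; rewrite inE => /eqP ->; split=> //; apply: conn0.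
- move=> k g gk kL [eg [L0 [gL gd0 cl0]]].
  have kL0 : k < size L0 by move: kL; rewrite gL size_map.
  rewrite gL (nth_ids u) //; set x := nth u L0 k.
  have xL0 : x \in L0 by apply: mem_nth.
  pose J m g := env g /\ exists L2, [/\ hl g 1 = ids (L0 ++ L2), good (L0 ++ L2),
    closed k (L0 ++ L2) &
    forall y, y \in take m (inc x) -> [set x; y] \in F -> y \in L0 ++ L2].
  have [||||J1 [L2 [gL2 gd2 cl2 Hi]]] := @nbrsP R G Z degZ 23 24 25 5 22 reach_candidate
      (lsetn g 22 (vid x)) x J isT isT isT.
  + by [].
  + by split=> //; exists [::]; rewrite cats0; split=> // y; rewrite take0.
  + move=> m g' w mi ew gx _ [eg' [L2 [gL2 gd2 cl2 Hi]]].
    set g2 := lsetx _ _ _.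
    have xwE : [set x; w] \in E by rewrite -mem_inc ew mem_nth.
    have g2L : hl g2 1 = ids (L0 ++ L2) by [].
    have [e0 e1 e6 e2] : env g2 by [].
    have [L3 [gJ gd3 sub Hw]] : exists L3, [/\ hl (eval reach_candidate g2) 1 = ids (L0 ++ L3),
        good (L0 ++ L3), {subset L0 ++ L2 <= L0 ++ L3} & [set x; w] \in F -> w \in L0 ++ L3].
      rewrite /reach_candidate evalS.
      have := @member_ids 4 1 25 g2 w _ erefl g2L (good_size _ gd2).
      have : hl (eval (member 4 1 25) g2) 1 = ids (L0 ++ L2) by rewrite hl_frame.
      have : hl (eval (member 4 1 25) g2) 2 = ids S by rewrite hl_frame.
      have : hn (eval (member 4 1 25) g2) 0 = vid u by rewrite hn_frame.
      have : hn (eval (member 4 1 25) g2) 1 = vid v by rewrite hn_frame.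
      have : hn (eval (member 4 1 25) g2) 22 = vid x by rewrite hn_frame.
      have : hn (eval (member 4 1 25) g2) 25 = vid w by rewrite hn_frame.
      have : hx (eval (member 4 1 25) g2) 5 = wt [set x; w] by rewrite hx_frame.
      have : hx (eval (member 4 1 25) g2) 6 = wt [set u; v] by rewrite hx_frame.
      move: (eval (member 4 1 25) g2) => g3 x6 x5 r25 r22 r1 r0 l2 l1 r42.
      rewrite evalIf [leval_test _ _]/= r42 lt0b; case: ifP => wL.
        by rewrite eval_skip; exists L2; split.
      rewrite evalS; have := member_ids r25 l2 sS.
      have : hl (eval (member 4 2 25) g3) 1 = ids (L0 ++ L2) by rewrite hl_frame.
      have : hn (eval (member 4 2 25) g3) 0 = vid u by rewrite hn_frame.
      have : hn (eval (member 4 2 25) g3) 1 = vid v by rewrite hn_frame.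
      have : hn (eval (member 4 2 25) g3) 22 = vid x by rewrite hn_frame.
      have : hn (eval (member 4 2 25) g3) 25 = vid w by rewrite hn_frame.
      have : hx (eval (member 4 2 25) g3) 5 = wt [set x; w] by rewrite hx_frame.
      have : hx (eval (member 4 2 25) g3) 6 = wt [set u; v] by rewrite hx_frame.
      move: (eval (member 4 2 25) g3) => g4 y6 y5 s25 s22 s1 s0 k1 s42.
      rewrite evalIf [leval_test _ _]/= s42 lt0b; case: ifP => wS; last first.
        by rewrite eval_skip; exists L2; split=> //; rewrite FE wS !andbF.
      have xw := edge_neq (@edges_card2 G) xwE.
      rewrite evalS evalIf; have := lessP Z xw uv (isT : [&& 22 < 44, 25 < 44, 0 < 44 & 1 < 44])
        s22 s25 s0 s1 y5 y6.
      have : hl (eval (less 22 25 5 0 1 6) g4) 1 = ids (L0 ++ L2) by rewrite hl_frame.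
      have : hn (eval (less 22 25 5 0 1 6) g4) 25 = vid w by rewrite hn_frame.
      move: (eval (less _ _ _ _ _ _) g4) => g5 t25 j1 t49.
      rewrite [leval_test _ _]/= t49 lt0b -edge_rankE //.
      have [_ _ /(_ x)] := gd2; rewrite mem_cat xL0 => /(_ isT)[xS ux].
      have xwF : ([set x; w] \in F) = (rk [set x; w] < rk [set u; v]).
        by rewrite FE xwE xS wS.
      case: (boolP (rk [set x; w] < rk [set u; v])) => lt; last first.
        by rewrite eval_skip; exists L2; split=> //; rewrite xwF (negPf lt).
      exists (rcons L2 w); rewrite -rcons_cat; split.
      - by rewrite evalI /= updE /= t25 j1 map_rcons.
      - have [ul uin Hl] := gd2; split; first by rewrite rcons_uniq wL.
          by rewrite mem_rcons inE uin orbT.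
        move=> y; rewrite mem_rcons inE => /orP[/eqP ->|/Hl //]; split=> //.
        by apply: conn_trans ux (conn1 _); rewrite xwF.
      - by move=> y yL; rewrite mem_rcons inE yL orbT.
      - by rewrite mem_rcons inE eqxx.
    split.
      by split; rewrite /= ?updE /= ?hn_frame ?hx_frame ?hl_frame.
    exists L3; split=> //.
    * move=> y; rewrite takel_cat ?(ltnW kL0) // => yk t yt; apply: sub.
      by apply: (cl2 y) yt; rewrite takel_cat ?(ltnW kL0).
    * move=> y; rewrite (take_nth x) // mem_rcons inE -ew => /orP[/eqP -> //|yi yF].
      by apply: sub; apply: Hi.
  + by [].
  split=> //; exists (L0 ++ L2); split=> // y.
  have -> : take k.+1 (L0 ++ L2) = rcons (take k (L0 ++ L2)) x.
    by rewrite !takel_cat ?(ltnW kL0) // (take_nth u).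
  rewrite mem_rcons inE => /orP[/eqP -> t xt|]; last exact: cl2.
  apply: Hi => //; rewrite take_size mem_inc.
  by move: xt; rewrite FE => /andP[].
exists L; split=> //; first exact: good_size.
have Lk : size L <= k.
  by case: kend => [->|]; [apply: good_size|rewrite gL size_map].
have [_ uL HL] := gd.
move=> x; apply/idP/idP => [/HL[] //|].
apply: (connect_ind (P := fun x => x \in L)) => // a b aL ab.
by apply: (cl a) ab; rewrite take_oversize.
Qed.

Lemma edge_cmdP h u v : hn h 0 = vid u -> hn h 1 = vid v -> [set u; v] \in E ->
  exists S : {set G}, [/\ u \in S, v \in S,
    forall y, y \in prim E rk Z u :|: prim E rk Z v -> #|inflow E rk Z y| <= Z ^ 2 ->
      inflow E rk Z y \subset S
  & hn (eval edge_cmd h) 0 = ~~ conn (lighter rk (within E S) [set u; v]) u v].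
Proof.
move=> h0 h1 uvE; rewrite /edge_cmd 5!evalS.
have [S [g1S sS uS vS HS]] := collectP h0 h1.
have : hn (eval collect h) 0 = vid u by rewrite hn_frame.
have : hn (eval collect h) 1 = vid v by rewrite hn_frame.
move: (eval collect h) g1S => g1 g1S g1v g1u.
have := get_weightP g1u g1v uvE.
have : hn (eval get_weight g1) 0 = vid u by rewrite hn_frame.
have : hn (eval get_weight g1) 1 = vid v by rewrite hn_frame.
have : hl (eval get_weight g1) 2 = ids S by rewrite hl_frame.
move: (eval get_weight g1) => g2 g2S g2v g2u g2w.
have [L [g3L sL HL]] := reach_cmdP g2u g2v g2w uvE g2S sS uS.
have : hn (eval reach_cmd g2) 1 = vid v by rewrite hn_frame.
move: (eval reach_cmd g2) g3L => g3 g3L g3v.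
have := member_ids g3v g3L sL; move: (eval (member 4 1 1) g3) => g4 g4m.
exists [set x in S]; split; rewrite ?inE //.
  by move=> y yP yI; apply/subsetP => x xI; rewrite inE; apply: (HS y).
by rewrite !evalI /= !updE /= g4m HL; case: (conn _ _ _).
Qed.

End Specs.

(** * The program and its analysis *)

Import Order.TTheory GRing.Theory Num.Theory.
Local Open Scope ring_scope.

(* X[1] := 2 ^ n * W and Z := d + 1. *)
Definition setup (n : nat) : prog :=
  seqs (nseq n (RAdd 1 1 1) ++ [:: NConst 4 1]) (NAdd 5 2 4).

(* Z stays equal to q ^ 2 * (d + 1), where q is the factor applied to eps. *)
Definition scale_body : prog := seqs [:: RAdd 0 0 0; NAdd 5 5 5] (NAdd 5 5 5).

(* Registers 0 and 1 receive the smaller and the larger of the two ids, so that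
   both orientations of an edge lead to the same run. *)
Definition sort_ids : prog :=
  Seq (If (TLe 0 1) (seqs [:: NConst 3 0] (NAdd 16 1 3))
        (seqs [:: NConst 3 0; NAdd 16 0 3] (NAdd 0 1 3)))
      (Atom (NConst 2 0)).

Definition msg_prog (n : nat) : prog :=
  Seq (setup n)
    (If (TRLe 1 0) (Atom (NConst 0 1))
      (Seq (While (TRLt 0 1) scale_body) (Seq sort_ids (compile 0 edge_cmd)))).

(** * Runs of the machine program *)

Section Run.
Variables (R : realType) (oracle : nat -> nat -> option (nat * R)) (omega : tape).
Local Notation exec := (exec oracle omega).
Local Notation run := (foldl (fun s i => istep oracle omega i s)).
Implicit Types s : state R.
Local Open Scope ring_scope.

Lemma run_double n s :
  nmem (run s (nseq n (RAdd 1 1 1))) = nmem s /\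
  forall x, rmem (run s (nseq n (RAdd 1 1 1))) x =
    if x == 1%N then 2 ^+ n * rmem s 1 else rmem s x.
Proof.
elim: n s => [|n IH] s /=.
  by split=> // x; rewrite expr0 mul1r; case: eqP => // ->.
case: (IH (istep oracle omega (RAdd 1 1 1) s)) => -> Hx; split=> // x.
rewrite Hx /=; case: eqP => // nx; last by rewrite updE; case: eqP.
by rewrite updE eqxx exprSr -mulrA mulr_natl mulr2n.
Qed.

Lemma setupP n s : exists s' q,
  [/\ exec (setup n) s s' n.+2 q,
      forall a, nmem s' a = if a == 5%N then (nmem s 2 + 1)%N
                            else if a == 4%N then 1%N else nmem s a &
      forall x, rmem s' x = if x == 1%N then 2 ^+ n * rmem s 1 else rmem s x].
Proof.
have [q E] := exec_seqs oracle omega (nseq n (RAdd 1 1 1) ++ [:: NConst 4 1]) (NAdd 5 2 4) s.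
rewrite size_cat size_nseq /= addn1 foldl_cat /= in E.
have [Hn Hx] := run_double n s.
by do 2!eexists; split; [exact: E|move=> a; rewrite /= Hn|exact: Hx].
Qed.

Lemma scaleP (J : nat) s :
  (forall i, (i < J)%N -> 2 ^+ i * rmem s 0 < rmem s 1) ->
  rmem s 1 <= 2 ^+ J * rmem s 0 ->
  exists s' t q, [/\ exec (While (TRLt 0 1) scale_body) s s' t q,
    (t <= 4 * J + 1)%N,
    forall a, nmem s' a = if a == 5%N then (4 ^ J * nmem s 5)%N else nmem s a &
    forall x, rmem s' x = if x == 0%N then 2 ^+ J * rmem s 0 else rmem s x].
Proof.
elim: J s => [|J IH] s lt le.
  do 3!eexists; split; first apply: ExecWhileStop.
  - by rewrite /= -leNgt; move: le; rewrite expr0 mul1r.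
  - by [].
  - by move=> a; rewrite expn0 mul1n; case: eqP => // ->.
  - by move=> x; rewrite expr0 mul1r; case: eqP => // ->.
have [q1 E1] := exec_seqs oracle omega [:: RAdd 0 0 0; NAdd 5 5 5] (NAdd 5 5 5) s.
move: E1; set s1 := istep _ _ _ _ => E1.
have s1n a : nmem s1 a = if a == 5%N then (4 * nmem s 5)%N else nmem s a.
  by rewrite /s1 /= !updE /=; case: eqP => // _; lia.
have s1x x : rmem s1 x = if x == 0%N then 2 * rmem s 0 else rmem s x.
  by rewrite /s1 /= !updE; case: eqP => // _; rewrite mulr_natl mulr2n.
have [i iJ|| s2 [t2 [q2 [E2 t2J Hn Hx]]]] := IH s1.
- by rewrite !s1x /= mulrA -exprSr; apply: lt.
- by rewrite !s1x /= mulrA -exprSr.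
do 3!eexists; split; first apply: ExecWhileStep; [|exact: E1|exact: E2|..].
- by rewrite /=; have := lt 0%N isT; rewrite expr0 mul1r.
- by rewrite /=; lia.
- by move=> a; rewrite Hn !s1n /=; case: eqP => // _; rewrite expnSr mulnA.
- by move=> x; rewrite Hx !s1x /=; case: eqP => // _; rewrite mulrA exprSr.
Qed.

Lemma sort_idsP s : exists s' t q, [/\ exec sort_ids s s' t q, (t <= 6)%N, rmem s' = rmem s &
  forall a, nmem s' a = if a == 0%N then minn (nmem s 0) (nmem s 1)
    else if a == 16%N then maxn (nmem s 0) (nmem s 1) else if a == 3%N then 0%N
    else if a == 2%N then 0%N else nmem s a].
Proof.
case: (leqP (nmem s 0) (nmem s 1)) => le.
  have [q E] := exec_seqs oracle omega [:: NConst 3 0] (NAdd 16 1 3) s.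
  do 3!eexists; split; first apply: ExecSeq.
  - by apply: ExecIf; rewrite /= le; exact: E.
  - exact: (ExecAtom _ _ (NConst 2 0)).
  - by [].
  - by [].
  - move=> a; rewrite /= !updE /= addn0.
    by case: (a =P 2) => [-> //|]; case: (a =P 16) => [-> //|]; case: (a =P 0%N) => [->|].
have [q E] := exec_seqs oracle omega [:: NConst 3 0; NAdd 16 0 3] (NAdd 0 1 3) s.
do 3!eexists; split; first apply: ExecSeq.
- by apply: ExecIf; rewrite /= leqNgt le; exact: E.
- exact: (ExecAtom _ _ (NConst 2 0)).
- by [].
- by [].
- move=> a; rewrite /= !updE /= !addn0.
  by case: (a =P 2) => [-> //|]; case: (a =P 16) => [-> //|]; case: (a =P 0%N) => [->|].
Qed.

End Run.

Section Answer.
Variables (R : realType) (G : wgraph R) (d : nat) (eps : R) (n : nat).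
Local Notation W := (max_weight G).
Local Open Scope ring_scope.

Lemma msg_prog_trivial omega (u v : G) : 2 ^+ n * W <= eps ->
  exists s t q, [/\ exec (ask G) omega (msg_prog n) (init d eps u v) s t q,
    (t <= n + 4)%N & nmem s 0 = 1%N].
Proof.
move=> le; have [s1 [q1 [E1 Hn Hx]]] := setupP (ask G) omega n (init d eps u v).
do 3!eexists; split; first apply: ExecSeq.
- exact: E1.
- apply: ExecIf; rewrite /= !Hx /= le; exact: (ExecAtom _ _ (NConst 0 1)).
- by lia.
- by [].
Qed.

(** What the preamble leaves behind: the sorted ids in registers 0 and 1, and in real register 0 the
    scaled eps. *)
Definition start (J : nat) (u v : G) : lstate R :=
  LState (nth 0%N [:: minn (vid u) (vid v); maxn (vid u) (vid v)])
         (fun x => if x == 0%N then 2 ^+ J * eps else 0) (fun=> [::]).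

Lemma startC J (u v : G) : start J u v = start J v u.
Proof. by rewrite /start minnC maxnC. Qed.

Lemma msg_prog_search omega (u v : G) J (Z := (4 ^ J * d.+1)%N) :
  eps < 2 ^+ n * W ->
  (forall i, (i < J)%N -> 2 ^+ i * eps < 2 ^+ n * W) -> 2 ^+ n * W <= 2 ^+ J * eps ->
  exists s t q, [/\ exec (ask G) omega (msg_prog n) (init d eps u v) s t q,
    (t <= n + 4 * J + 10 + lsize edge_cmd * Z.+1 ^ ldepth edge_cmd)%N &
    nmem s 0 = hn (leval (ask G) Z edge_cmd (start J u v)) 0].
Proof.
move=> lt0 lt le; have [s1 [q1 [E1 Hn Hx]]] := setupP (ask G) omega n (init d eps u v).
have [i iJ||s2 [t2 [q2 [E2 t2J Hn2 Hx2]]]] := @scaleP R (ask G) omega J s1.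
- by rewrite !Hx /=; apply: lt.
- by rewrite !Hx.
have [s3 [t3 [q3 [E3 t36 Hx3 Hn3]]]] := sort_idsP (ask G) omega s2.
have rep : represents Z (start J u v) s3.
  split=> /=.
  - move=> r; rewrite Hn3 !Hn2 !Hn /reg; case: r => [|[|r]] //.
    have nea b : (b < 17)%N -> (16 * r.+2 == b)%N = false by move=> b17; lia.
    have r3 : (3 <= 16 * r.+2)%N by lia.
    by rewrite !nea // [LHS](@nth_default _ 0%N [:: vid u; vid v; d]) //= nth_nil.
  - move=> x; rewrite Hx3 Hx2 !Hx /rreg; case: x => [|x] //.
    have nex b : (b < 2)%N -> (2 * x.+1 == b)%N = false by move=> b2; lia.
    have x2 : (2 <= 2 * x.+1)%N by lia.
    by rewrite !nex // [LHS](@nth_default _ 0 [:: eps; W]).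
  - move=> j j8; rewrite Hn3 !Hn2 !Hn /len; case: j j8 => [|j] // j8.
    have nea b : (b < 17)%N -> (16 * j.+1 + 2 == b)%N = false by move=> b17; lia.
    have j3 : (3 <= 16 * j.+1 + 2)%N by lia.
    by rewrite !nea // [LHS](@nth_default _ 0%N [:: vid u; vid v; d]).
  - by [].
  - by rewrite Hn3 /= Hn2 /= Hn.
  - by rewrite Hn3 /= Hn2 /= Hn /= addn1.
have [s4 [t4 [q4 [E4 H4 _ t4le]]]] :=
  @compileP R (ask G) omega Z 0 edge_cmd isT (start J u v) s3 rep.
do 3!eexists; split; first apply: ExecSeq.
- exact: E1.
- apply: ExecIf; rewrite /= !Hx /= leNgt lt0 /=.
  exact: ExecSeq E2 (ExecSeq E3 E4).
- have := lcost_le Z edge_cmd; move: (lcost _ _) t4le (lsize _ * _)%N => c t4le b.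
  by lia.
- exact: rep_n H4 0.
Qed.

End Answer.

(** * Weights of spanning sets *)

Section Weights.
Variables (R : realType) (G : wgraph R).
Local Notation E := (edges G).
Local Notation T := (kruskal E (@edge_rank R G)).
Local Notation W := (max_weight G).
Local Notation n := (#|G|%:R : R).

Lemma wt_max f : f \in E -> wt f <= W.
Proof. by move=> fE; rewrite /max_weight (bigD1 f) //= le_max lexx. Qed.

Lemma max_weight_ge0 : 0 <= W.
Proof.
rewrite /max_weight; apply: (big_ind (fun x : R => 0 <= x)) => // [x y x0 y0|f fE].
  by rewrite le_max x0.
by apply: le_trans (wt_ge1 fE).
Qed.

Lemma weight_ge_card (F : {set {set G}}) : F \subset E -> #|F|%:R <= weight F.
Proof.
move=> FE; rewrite /weight -sum1_card natr_sum; apply: ler_sum => f fF.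
exact: wt_ge1 (subsetP FE _ fF).
Qed.

Lemma weight_le_max (F : {set {set G}}) : F \subset E -> weight F <= #|F|%:R * W.
Proof.
move=> FE; rewrite /weight -sum1_card natr_sum mulr_suml; apply: ler_sum => f fF.
by rewrite mul1r; apply: wt_max (subsetP FE _ fF).
Qed.

Lemma kruskal_weight (F : {set {set G}}) :
  F \subset E -> spanning_connected F -> weight T <= weight F.
Proof.
move=> FE cF; have [|A [wA AE TA]] := @kruskal_opt _ E (@edges_card2 G) _
  (@edge_rank_inj R G) (fun A => weight A <= weight F) F FE cF (lexx _).
  move=> A f g wA fA gA gE fE lt; apply: le_trans wA.
  rewrite /weight big_setU1 ?inE ?negb_and ?gA ?orbT // [leRHS](big_setD1 f) //=.
  by rewrite lerD2r; apply: edge_rank_wt.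
apply: le_trans wA; rewrite /weight [leRHS](big_setID T) /= (setIidPr TA) lerDl.
by apply: sumr_ge0 => f; rewrite inE => /andP[_ /(subsetP AE)/wt_ge1]; apply: le_trans.
Qed.

Lemma mst_ge (b : R) :
  (forall F : {set {set G}}, F \subset E -> spanning_connected F -> b <= weight F) ->
  b <= mst_weight G.
Proof.
move=> Hb; rewrite /mst_weight.
apply: (big_ind (fun x : R => b <= x)) => [|x y bx bY|F /asboolP[FE cF _]].
- by apply: Hb => //; apply: graph_connected.
- by rewrite le_min bx.
- exact: Hb.
Qed.

Lemma mst_card : (1 < #|G|)%N -> n <= 2 * mst_weight G.
Proof.
move=> n1; rewrite -ler_pdivrMl ?ltr0n //; apply: mst_ge => F FE cF.
apply: le_trans (weight_ge_card FE); rewrite ler_pdivrMl ?ltr0n // -natrM ler_nat mul2n.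
by apply: (spanning_card _ cF n1) => f /(subsetP FE)/edges_card2.
Qed.

(** The factor 2 in the hypothesis pays for [mst_card], where the optimum is only bounded below by
    half the number of vertices. With at most one vertex there are no edges at all. *)
Lemma light_spanner (K : {set {set G}}) (eps : R) :
  T \subset K -> K \subset E -> 0 < eps ->
  2 * (#|K :\: T|%:R * W) <= eps * n ->
  #|K|%:R <= (1 + eps) * n /\ weight K <= (1 + eps) * mst_weight G.
Proof.
move=> TK KE eps0 HX; set X := K :\: T in HX.
have XE : X \subset E by apply: subset_trans (subsetDl _ _) KE.
have mst0 : 0 <= mst_weight G.
  by apply: mst_ge => F FE _; apply: le_trans (weight_ge_card FE).
have X_le : #|X|%:R <= #|X|%:R * W.
  by apply: le_trans (weight_ge_card XE) (weight_le_max XE).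
have TW : weight T <= mst_weight G by apply: mst_ge; apply: kruskal_weight.
have Tn : #|T|%:R <= n.
  rewrite ler_nat; apply: card_kruskal; [exact: edges_card2|exact: edge_rank_inj|].
  exact: graph_connected.
have nE : #|K|%:R = #|T|%:R + #|X|%:R :> R.
  by rewrite -natrD -(cardsID T K) (setIidPr TK).
have wE : weight K = weight T + weight X.
  by rewrite /weight (big_setID T) /= (setIidPr TK).
have wX := weight_le_max XE.
have X0 : 0 <= #|X|%:R :> R by [].
split; first by rewrite nE mulrDl mul1r; lra.
case: (ltnP 1 #|G|) => n1.
  have nm := mst_card n1; rewrite wE mulrDl mul1r.
  have : eps * n <= eps * (2 * mst_weight G) by rewrite ler_pM2l.
  lra.
suff -> : K = set0 by rewrite /weight big_set0 mulr_ge0 // addr_ge0 // ltW.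
apply/eqP; rewrite -subset0; apply/subsetP => f /(subsetP KE)/edges_card2 f2.
by have := max_card (mem f); rewrite f2 leqNgt ltnS n1.
Qed.

End Weights.

Lemma prob_ge_always (R : realType) (P : tape -> Prop) (p : R) :
  p <= 1 -> (forall omega, P omega) -> prob_ge P p.
Proof.
move=> p1 HP; exists 0%N => L _.
have -> : [set r : {ffun 'I_L -> bool} | `[< P (pad r) >]] = setT.
  by apply/setP => r; rewrite !inE; apply/asboolP.
rewrite cardsT card_ffun card_bool card_ord.
by rewrite -[leRHS]mul1r ler_wpM2r.
Qed.

(** * Correctness and running time *)

Section Final.
Variables (R : realType) (H : sgraph) (G : wgraph R) (d : nat) (eps : R).
Hypotheses (eps0 : 0 < eps) (mf : minor_free H G) (dG : degree_bounded G d).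
Local Notation E := (edges G).
Local Notation rk := (@edge_rank R G).
Local Notation T := (kruskal E rk).
Local Notation W := (max_weight G).
Local Notation r := #|H|.
Local Notation A := (msg_prog r.+3).

Lemma answers_yesE omega (u v : G) s t q :
  exec (ask G) omega A (init d eps u v) s t q ->
  (answers_yes A d eps omega u v <-> nmem s 0 <> 0%N).
Proof.
move=> E1; split=> [[s' [t' [q' [E2 ne]]]]|ne]; last by exists s, t, q.
by have [<- _ _] := exec_det E2 E1.
Qed.

Lemma trivial_extra : 2 ^+ r.+3 * W <= eps -> 2 * (#|E :\: T|%:R * W) <= eps * #|G|%:R.
Proof.
move=> le; have := card_edges_le mf (@edge_rank_inj R G).
rewrite -(ler_nat R) natrM natrX => X_le.
have W0 := max_weight_ge0 G.
have : #|E :\: T|%:R * W <= 2 ^+ r * #|G|%:R * W by rewrite ler_wpM2r.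
have : (2 ^+ r.+3 * W) * #|G|%:R <= eps * #|G|%:R by rewrite ler_wpM2r.
have : 0 <= 2 ^+ r * #|G|%:R * W by rewrite !mulr_ge0 // exprn_ge0.
rewrite !exprS; lra.
Qed.

Lemma card_nbh (u : G) : (#|nbh E u| <= d)%N.
Proof.
apply: leq_trans (dG u); rewrite -(card_uniqP (inc_uniq u)).
by apply/subset_leq_card/subsetP => v; rewrite inE -mem_inc.
Qed.

Section Search.
Variable J : nat.
Hypothesis J0 : (0 < J)%N.
Let Z := (4 ^ J * d.+1)%N.
Let out (u v : G) := hn (leval (ask G) Z edge_cmd (start eps J u v)) 0.

Lemma search_bound_square : Z = ((2 ^ J) ^ 2 * d.+1)%N.
Proof. by rewrite /Z -expnM (mulnC J) expnM. Qed.

Lemma search_out (u v : G) : [set u; v] \in E ->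
  exists S : {set G}, [/\ u \in S, v \in S,
    forall y, y \in prim E rk Z u :|: prim E rk Z v -> (#|inflow E rk Z y| <= Z ^ 2)%N ->
      inflow E rk Z y \subset S
  & out u v = ~~ conn (lighter rk (within E S) [set u; v]) u v].
Proof.
wlog le : u v / (vid u <= vid v)%N => [H0 uvE|uvE].
  case/orP: (leq_total (vid u) (vid v)) => le; first exact: H0.
  have [|S [vS uS HS e]] := H0 _ _ le; first by rewrite setUC.
  exists S; split=> //; first by move=> y yP; apply: HS; rewrite setUC.
  by rewrite /out startC; rewrite /out in e; rewrite e conn_sym setUC.
have degZ (x : G) : (size (inc x) <= Z)%N.
  apply: leq_trans (dG x) _; rewrite /Z; apply: leq_trans (leqnSn _) _.
  by rewrite leq_pmull // expn_gt0.
have d0 : (0 < d)%N.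
  by apply: leq_trans (dG u); have : v \in inc u; [rewrite mem_inc|case: (inc u)].
have Z4 : (4 <= Z)%N.
  apply: (@leq_trans (4 ^ J)); last by rewrite leq_pmulr.
  by rewrite -[leqLHS]expn1 leq_exp2l.
have h0 : hn (start eps J u v) 0 = vid u by rewrite /= (minn_idPl le).
have h1 : hn (start eps J u v) 1 = vid v by rewrite /= (maxn_idPr le).
exact: (edge_cmdP degZ Z4 h0 h1 uvE).
Qed.

(** The origin of [r.+3]: the 2 of [light_spanner] times the 3 of [extra_edges_local] is at most
    [2 ^ 3], and [2 ^ r] is the sparsity of the quotient. *)
Lemma search_extra (K : {set {set G}}) :
  2 ^+ r.+3 * W <= 2 ^+ J * eps -> K \subset E ->
  (forall u v, [set u; v] \in K -> out u v <> 0%N) ->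
  2 * (#|K :\: T|%:R * W) <= eps * #|G|%:R.
Proof.
move=> le KE HK.
have q1 : (1 < 2 ^ J)%N by rewrite -{1}(expn0 2) ltn_exp2l.
have Hloc : (#|K :\: T| * 2 ^ J <= 2 ^ r * (3 * #|G|))%N.
  apply: (extra_edges_local mf (@edge_rank_inj R G) (graph_connected G) card_nbh q1 search_bound_square KE).
  move=> u v uvK; have [S [uS vS HS e]] := search_out (subsetP KE _ uvK).
  by exists S; split=> //; have := HK u v uvK; rewrite e; case: (conn _ _ _).
move: Hloc; rewrite -(ler_nat R) !natrM !natrX => X_le.
have W0 := max_weight_ge0 G.
set X := (#|K :\: T|%:R : R) in X_le *.
have c0 : 0 < 2 ^+ r :> R by apply: exprn_gt0.
have H1 : X * (2 ^+ r.+3 * W) <= X * (2 ^+ J * eps) by rewrite ler_wpM2l.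
have H2 : X * 2 ^+ J * eps <= 2 ^+ r * (3 * #|G|%:R) * eps by rewrite ler_wpM2r // ltW.
rewrite -(ler_pM2l c0); move: H1 H2; rewrite !exprS.
have : 0 <= 2 ^+ r * (eps * #|G|%:R) by rewrite !mulr_ge0 // ltW.
lra.
Qed.

Lemma search_complete (u v : G) : [set u; v] \in T -> out u v <> 0%N.
Proof.
move=> uvT; have uvE := subsetP (kruskal_sub E rk) _ uvT.
have [S [_ _ _ ->]] := search_out uvE.
move: uvT; rewrite mem_kruskal // => nc.
suff -> : ~~ conn (lighter rk (within E S) [set u; v]) u v by [].
by apply: contra nc; apply: connS; apply: lighterS; apply: within_sub.
Qed.

End Search.

(** The answers [out] do not depend on the tape, so every event about the kept edges holds for all
    tapes or for none. *)
Lemma msg_prog_run : exists out : G -> G -> nat,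
  [/\ forall u v, [set u; v] \in E -> out u v = out v u,
    forall u v, [set u; v] \in T -> out u v <> 0%N,
    forall K : {set {set G}}, K \subset E ->
      (forall u v, [set u; v] \in K -> out u v <> 0%N) ->
      2 * (#|K :\: T|%:R * W) <= eps * #|G|%:R &
    exists B : nat,
      (forall omega u v, [set u; v] \in E -> exists s t q,
        [/\ exec (ask G) omega A (init d eps u v) s t q, (t <= B)%N & nmem s 0 = out u v]) /\
      ((2 ^+ r.+3 * W <= eps /\ B = (r + 7)%N) \/
       exists J, [/\ (0 < J)%N, eps < 2 ^+ r.+3 * W, 2 ^+ J * eps < 2 ^+ r.+4 * W &
         B = (r + 4 * J + 13 + lsize edge_cmd * (4 ^ J * d.+1).+1 ^ ldepth edge_cmd)%N])].
Proof.
case: (leP (2 ^+ r.+3 * W) eps) => [le|lt].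
  exists (fun _ _ => 1%N); split=> //.
    move=> K KE _; apply: le_trans (trivial_extra le).
    rewrite ler_wpM2l // ler_wpM2r ?max_weight_ge0 // ler_nat.
    exact/subset_leq_card/setSD.
  exists (r + 7)%N; split; last by left.
  move=> omega u v _; have [s [t [q [E1 tB sO]]]] := msg_prog_trivial d omega u v le.
  by exists s, t, q; split=> //; apply: leq_trans tB _; lia.
have exJ : exists J, 2 ^+ r.+3 * W <= 2 ^+ J * eps.
  exists (Num.bound (2 ^+ r.+3 * W / eps)); rewrite -ler_pdivrMr //.
  apply: le_trans (_ : (Num.bound (2 ^+ r.+3 * W / eps))%:R <= _).
    apply/ltW/archi_boundP; rewrite divr_ge0 ?(ltW eps0) //.
    by rewrite mulr_ge0 ?max_weight_ge0 // exprn_ge0.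
  by move: (Num.bound _) => N; rewrite -natrX ler_nat ltnW // ltn_expl.
(* J is least, so the doubling overshoots by less than a factor 2; this yields
   [2 ^+ J * eps < 2 ^+ r.+4 * W], on which the time bound rests. *)
have [J le Jmin] := ex_minnP exJ.
have J0 : (0 < J)%N.
  by case: J le {Jmin} => //; rewrite expr0 mul1r leNgt lt.
have ltJ i : (i < J)%N -> 2 ^+ i * eps < 2 ^+ r.+3 * W.
  by move=> iJ; rewrite ltNge; apply/negP => /Jmin; rewrite leqNgt iJ.
exists (fun u v => hn (leval (ask G) (4 ^ J * d.+1) edge_cmd (start eps J u v)) 0); split.
- by move=> u v _; rewrite startC.
- by move=> u v; apply: search_complete.
- by move=> K; apply: search_extra.
- exists (r + 4 * J + 13 + lsize edge_cmd * (4 ^ J * d.+1).+1 ^ ldepth edge_cmd)%N.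
  split; last first.
    right; exists J; split=> //; have := ltJ J.-1; rewrite prednK // => /(_ (leqnn _)).
    rewrite (exprS 2 r.+3) -[X in _ -> 2 ^+ X * _ < _](prednK J0) (exprS 2 J.-1).
    by rewrite -!mulrA ltr_pM2l.
  move=> omega u v _; have [s [t [q [E1 tB sO]]]] := msg_prog_search d omega u v lt ltJ le.
  by exists s, t, q; split=> //; apply: leq_trans tB _; lia.
Qed.

End Final.

Lemma nat_le_exp (R : realType) (b : R) k : 2 <= b -> k%:R <= b ^+ k.
Proof.
move=> b2; apply: (@le_trans _ _ (2 ^+ k)); last by rewrite lerXn2r ?nnegrE //; lra.
by rewrite -natrX ler_nat ltnW // ltn_expl.
Qed.

(** Each quantity is at most a power of b. From [W <= b * eps] follows [2 ^+ J <= b ^+ (r + 5)]. For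
    d alone the hypothesis [eps < 2 ^+ r.+3 * W] is essential: it gives [d <= 2 ^+ r.+3 * b], hence
    [d.+1 <= b ^+ (r + 5)]. Thus Z is at most the third power of [b ^+ (r + 5)]; the final 2 in the
    exponent absorbs the sum of three terms. *)
Lemma search_time (R : realType) (W eps : R) (d r J S D : nat)
    (b := Num.max 2 (W * d%:R / eps)) :
  0 < eps -> 1 <= W -> (0 < d)%N ->
  eps < 2 ^+ r.+3 * W -> 2 ^+ J * eps < 2 ^+ r.+4 * W ->
  (r + 4 * J + 13 + S * (4 ^ J * d.+1).+1 ^ D)%:R
    <= b ^+ (r + 13 + S + D * (3 * r.+4.+1 + 1) + 2).
Proof.
move=> eps0 W1 d0 lt ltJ.
have b2 : 2 <= b by rewrite /b le_max lexx.
have b1 : 1 <= b by lra.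
have b0 : 0 < b by lra.
have Wd : W * d%:R <= b * eps by rewrite -ler_pdivrMr // /b le_max lexx orbT.
have d1 : 1 <= d%:R :> R by rewrite ler1n.
have W0 : 0 < W by lra.
have pow2 k : 2 ^+ k <= b ^+ k by rewrite lerXn2r ?nnegrE //; lra.
have mono i j : (i <= j)%N -> b ^+ i <= b ^+ j by move=> ij; apply: ler_weXn2l.
have WE : W <= b * eps by apply: le_trans Wd; rewrite ler_peMr // ltW.
have [q_le d_le] : 2 ^+ J <= b ^+ r.+4.+1 /\ d.+1%:R <= b ^+ r.+4.+1.
  rewrite (exprSr b r.+4) (exprSr b r.+3); move: lt ltJ; rewrite (exprS 2 r.+3).
  have p0 : 0 < 2 ^+ r.+3 :> R by apply: exprn_gt0.
  move: (2 ^+ r.+3) (2 ^+ J) (b ^+ r.+3) (pow2 r.+3) p0 => p q P pP p0 lt ltJ.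
  have P0 : 0 < P by apply: lt_le_trans pP.
  have bP : 2 * p <= b * P by apply: ler_pM => //; apply: ltW.
  split.
    rewrite -(ler_pM2r eps0); apply: le_trans (ltW ltJ) _.
    rewrite (_ : P * b * b * eps = b * P * (b * eps)); last by ring.
    by apply: ler_pM; rewrite // ltW // mulr_gt0.
  have H1 : d%:R <= p * b.
    rewrite -(ler_pM2r eps0); apply: (@le_trans _ _ (d%:R * (p * W))).
      by rewrite ler_pM2l ?ltr0n // ltW.
    by rewrite mulrCA -(mulrA p) ler_pM2l // mulrC.
  apply: (@le_trans _ _ (2 * p * b)); first by rewrite -natr1 -(mulrA 2); lra.
  by rewrite ler_pM2r // mulrC [X in _ <= X]mulrC mulrC.
have Z_le : (4 ^ J * d.+1).+1%:R <= b ^+ (3 * r.+4.+1 + 1).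
  have -> : (4 ^ J)%N = (2 ^ J * 2 ^ J)%N by rewrite -expnMn.
  set q := b ^+ r.+4.+1 in q_le d_le.
  have H1 : (2 ^ J * 2 ^ J * d.+1)%:R <= b ^+ (3 * r.+4.+1).
    rewrite (mulnC 3) exprM -/q !exprS expr0 mulr1 !natrM natrX mulrA.
    by apply: ler_pM => //; rewrite ?mulr_ge0 ?exprn_ge0 //; apply: ler_pM; rewrite ?exprn_ge0.
  have H2 : 1 <= b ^+ (3 * r.+4.+1) by rewrite exprn_ege1.
  rewrite addn1 exprSr -natr1; move: (b ^+ _) H1 H2 => x H1 H2.
  have : x * 2 <= x * b by rewrite ler_pM2l //; lra.
  lra.
set m := (r + 13 + S + D * (3 * r.+4.+1 + 1))%N.
have m1 : (r + 13 <= m)%N by rewrite /m -addnA leq_addr.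
have T1 : (r + 13)%:R <= b ^+ m by apply: le_trans (nat_le_exp _ b2) (mono _ _ m1).
have T2 : (4 * J)%:R <= b ^+ m.
  apply: (@le_trans _ _ (b ^+ (2 + r.+4.+1))).
    2: by apply: mono; apply: leq_trans m1; clear; lia.
  rewrite natrM exprD; apply: ler_pM => //.
    by have := pow2 2; rewrite -natrX.
  by apply: le_trans q_le; rewrite -natrX ler_nat ltnW // ltn_expl.
have T3 : (S * (4 ^ J * d.+1).+1 ^ D)%:R <= b ^+ m.
  apply: (@le_trans _ _ (b ^+ (S + D * (3 * r.+4.+1 + 1)))).
    2: by apply: mono; rewrite /m -addnA leq_addl.
  rewrite natrM exprD; apply: ler_pM => //; first exact: nat_le_exp.
  by rewrite (mulnC D) exprM natrX lerXn2r ?nnegrE // exprn_ge0 // ltW.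
rewrite (addnAC r) natrD natrD; apply: (@le_trans _ _ (4 * b ^+ m)).
  have : 0 <= b ^+ m by rewrite exprn_ge0 // ltW.
  by move: (b ^+ m) T1 T2 T3 => x; lra.
rewrite exprD mulrC ler_wpM2l ?exprn_ge0 ?(ltW b0) //.
by have := pow2 2%N; rewrite -natrX.
Qed.

Theorem theorem8 :
  forall (R : realType) (H : sgraph) (delta : R), 0 < delta ->
  exists (A : prog) (C : R),
  forall (G : wgraph R) (d : nat) (eps : R),
    0 < eps -> minor_free H G -> degree_bounded G d ->
    local_msg A G d eps delta (msg_bound C (max_weight G) eps d).
Proof.
move=> R H delta delta0; set r := #|H|.
set S := lsize edge_cmd; set D := ldepth edge_cmd.
pose m := (r + 13 + S + D * (3 * r.+4.+1 + 1) + 2)%N.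
exists (msg_prog r.+3), m%:R => G d eps eps0 mf dG.
have [out [outC outT outX [B [HB Bcase]]]] := msg_prog_run eps0 mf dG.
have ans omega u v : [set u; v] \in edges G ->
    answers_yes (msg_prog r.+3) d eps omega u v <-> out u v <> 0%N.
  move=> uvE; have [s [t [q [E1 _ sO]]]] := HB omega u v uvE.
  by rewrite -sO; apply: (answers_yesE E1).
have keptE omega (u v : G) : ([set u; v] \in kept (msg_prog r.+3) G d eps omega) =
    ([set u; v] \in edges G) && (out u v != 0%N).
  rewrite inE; case: (boolP ([set u; v] \in _)) => //= uvE.
  apply/asboolP/idP => [[a [b [e yes]]]|/eqP ne].
    apply/eqP; case: (set2_eq e) => -[ea eb]; subst a b; first exact/(ans omega).
    by rewrite outC //; apply/(ans omega); rewrite // setUC.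
  by exists u, v; split=> //; apply/ans.
have kept_sub omega : kept (msg_prog r.+3) G d eps omega \subset edges G.
  by apply/subsetP => f; rewrite inE => /andP[].
have krus omega : kruskal (edges G) (@edge_rank R G) \subset kept (msg_prog r.+3) G d eps omega.
  apply/subsetP => f fT; have fE := subsetP (kruskal_sub _ _) _ fT.
  have [u [v [_ ef]]] := edge_ends (@edges_card2 G) fE; subst f.
  by rewrite keptE fE; apply/eqP; apply: outT.
split.
- move=> omega u v uvE; have [s [t [q [E1 tB _]]]] := HB omega u v uvE.
  have t_le : t%:R <= msg_bound m%:R (max_weight G) eps d.
    have W1 : 1 <= max_weight G by apply: le_trans (wt_ge1 uvE) (wt_max uvE).
    have d0 : (0 < d)%N.
      by apply: leq_trans (dG u); have : v \in inc u; [rewrite mem_inc|case: (inc u)].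
    rewrite /msg_bound; set b := Num.max _ _.
    have b2 : 2 <= b by rewrite /b le_max lexx.
    apply: (@le_trans _ _ (b ^+ m)).
      apply: (@le_trans _ _ B%:R); first by rewrite ler_nat.
      case: Bcase => [[_ ->]|[J [J0 lt ltJ ->]]]; last exact: search_time.
      apply: le_trans (nat_le_exp _ b2) _; apply: ler_weXn2l; first by lra.
      by rewrite /m; lia.
    rewrite -powR_mulrn; last by lra.
    (* The base is at least 1 and the maximum in the exponent at least 1, so the bound [b ^+ m] is
       already enough. *)
    apply: ler_powR; first by lra.
    by rewrite -{1}[m%:R]mulr1 ler_wpM2l // le_max lexx.
  exists s, t, q; split=> //; apply: le_trans t_le.
  by rewrite ler_nat; apply: exec_queries E1.
- move=> omega u v uvE; rewrite !ans ?(setUC [set v]) //.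
  by rewrite outC.
- apply: prob_ge_always => // omega; apply: spanningS (krus omega) _.
  exact/kruskal_connected/graph_connected.
- apply: prob_ge_always => [|omega]; first by rewrite lerBlDr lerDl ltW.
  apply: (light_spanner (krus omega)) => //; apply: outX => // u v.
  by rewrite keptE => /andP[_ /eqP].
Qed.
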